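(* Let $\mathbb{K}$ be an algebraically closed field of characteristic zero and let $X$ be a normal affine algebraic surface over $\mathbb{K}$ with a commutative monoid structure of rank $r$. Then $X$ is toric, so that $\mathbb{K}[X]=\bigoplus_{u\in S_X}\mathbb{K}\chi^u$, and the commutative monoid structures of rank $r$ on $X$ are classified up to isomorphism as follows. 1) If $r=2$, then $X$ is endowed with the toric monoid structure, and the comultiplication $\mathbb{K}[X]\to\mathbb{K}[X]\otimes\mathbb{K}[X]$ is given by $$\chi^u\mapsto\chi^u\otimes\chi^u\quad\text{for any }u\in S_X.$$ 2) If $r=1$, then the comultiplication $\mathbb{K}[X]\to\mathbb{K}[X]\otimes\mathbb{K}[X]$ is given by $$\chi^u\mapsto(\chi^u\otimes\chi^u)\,(1\otimes\chi^e+\chi^e\otimes1)^{\langle p_i,u\rangle}\quad\text{for any }u\in S_X,$$ where $p_i$ is the primitive vector on a ray of the fan of $X$ and $e\in\mathfrak{R}_i$ is a Demazure root corresponding to this ray. 3) If $r=0$, then $X=\mathbb{A}^2$ and $X$ has the vector monoid structure, with the comultiplication determined by $$\chi^u\mapsto\chi^u\otimes1+1\otimes\chi^u$$ for $u$ ranging over the standard basis vectors of $\mathbb{Z}^2_{\ge0}$ (that is, $x_j\mapsto x_j\otimes1+1\otimes x_j$ for the coordinate functions $x_1,x_2$).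
   Context: An algebraic monoid is an irreducible algebraic variety $X$ with an associative multiplication $\mu\colon X\times X\to X$ that is a morphism of varieties and has a unit. A morphism of algebraic monoids is a morphism of varieties that preserves products and units; an isomorphism is an invertible morphism whose inverse is a morphism. The set $G(X)$ of invertible elements is a connected algebraic group, open in $X$. If $X$ is affine and commutative, then $G(X)\cong\mathbb{G}_m^r\times\mathbb{G}_a^s$, where $\mathbb{G}_m=(\mathbb{K}^\times,\times)$ and $\mathbb{G}_a=(\mathbb{K},+)$; the number $r$ is the rank of the monoid. The comultiplication is the homomorphism of $\mathbb{K}$-algebras $\mathbb{K}[X]\to\mathbb{K}[X]\otimes\mathbb{K}[X]$ dual to $\mu$. The vector monoid structure on $\mathbb{A}^2$ is vector addition. The toric monoid structure on an affine toric variety is the monoid structure with $G(X)$ equal to the acting torus (it is unique up to isomorphism). A normal irreducible surface $X$ is toric if a torus $T\cong(\mathbb{K}^\times)^2$ acts effectively on it with an open orbit. Let $M$ be the character lattice of $T$ and $N$ the dual lattice of one-parameter subgroups, with pairing $\langle\cdot,\cdot\rangle$. Identifying $T$ with the open orbit (by choosing a point in it), characters $\chi^u$, $u\in M$, become rational functions on $X$, and for affine $X$ one has $\mathbb{K}[X]=\bigoplus_{u\in S_X}\mathbb{K}\chi^u$, where $S_X=M\cap\omega$ for a rational polyhedral cone $\omega\subseteq M_{\mathbb{Q}}=M\otimes\mathbb{Q}$. Let $\sigma\subseteq N_{\mathbb{Q}}=N\otimes\mathbb{Q}$ be the dual cone; the fan of $X$ consists of the faces of $\sigma$. Let $\rho_1,\dots,\rho_m$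 be the rays of $\sigma$ and $p_i\in N$ the primitive lattice vector on $\rho_i$. The set of Demazure roots corresponding to $\rho_i$ is $$\mathfrak{R}_i=\{e\in M\mid\langle p_i,e\rangle=-1,\ \langle p_j,e\rangle\ge0\text{ for all }j\ne i\}.$$ For $e\in\mathfrak{R}_i$ the function $\chi^e$ lies in $\mathbb{K}(X)$ but not in $\mathbb{K}[X]$; the expression in 2) is understood by binomial expansion, i.e. as $\sum_{j=0}^{a}\binom{a}{j}\chi^{u+(a-j)e}\otimes\chi^{u+je}$ with $a=\langle p_i,u\rangle$, and all $\chi^{u+je}$ with $0\le j\le a$ lie in $\mathbb{K}[X]$. ''Classified up to isomorphism'' means that every commutative monoid structure of the given rank on $X$ is isomorphic to one of the listed ones and the listed comultiplications do define such structures; different Demazure roots are allowed to give isomorphic structures. *)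

(* Defs.v *)
From mathcomp Require Import all_boot all_order all_algebra.
From mathcomp Require Export mpoly.

Set Implicit Arguments.
Unset Strict Implicit.
Unset Printing Implicit Defensive.

Import Order.TTheory GRing.Theory Num.Theory.
Local Open Scope ring_scope.

(* Classical varieties over an algebraically closed field: a point of A^n is a
   row vector, a (quasi-)affine variety is a subset of A^n, and functions and
   maps are total on A^n but only their values on the variety matter. *)
Section Varieties.
Variable K : closedFieldType.

Definition pset n := 'rV[K]_n -> Prop.

Definition ev n (P : {mpoly K[n]}) (x : 'rV[K]_n) : K := P.@[fun i => x 0 i].

Definition affine_space n : pset n := fun=> True.

Definition zariski_closed n (Z : pset n) : Prop :=
  exists S : {mpoly K[n]} -> Prop,
    forall x, Z x <-> (forall P, S P -> ev P x = 0).

Definition open_in n (X U : pset n) : Prop :=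
  exists Z, zariski_closed Z /\ forall x, U x <-> (X x /\ ~ Z x).

Definition nonempty n (X : pset n) : Prop := exists x, X x.

Definition irreducible n (X : pset n) : Prop :=
  nonempty X /\
  forall Z1 Z2, zariski_closed Z1 -> zariski_closed Z2 ->
    (forall x, X x -> Z1 x \/ Z2 x) ->
    (forall x, X x -> Z1 x) \/ (forall x, X x -> Z2 x).

Definition affine_variety n (X : pset n) : Prop :=
  zariski_closed X /\ irreducible X.

Definition coordinate_ring n (X : pset n) (f : 'rV[K]_n -> K) : Prop :=
  exists P, forall x, X x -> f x = ev P x.

Definition regular_on n (U : pset n) (f : 'rV[K]_n -> K) : Prop :=
  forall x, U x -> exists V, [/\ open_in U V, V x &
    exists A B, forall y, V y -> ev B y != 0 /\ f y = ev A y / ev B y].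

Definition morphism m n (U : pset m) (V : pset n)
    (phi : 'rV[K]_m -> 'rV[K]_n) : Prop :=
  (forall x, U x -> V (phi x)) /\
  forall j, regular_on U (fun x => phi x 0 j).

Record isomorphism m n (U : pset m) (V : pset n)
    (phi : 'rV[K]_m -> 'rV[K]_n) (psi : 'rV[K]_n -> 'rV[K]_m) : Prop :=
  Isomorphism {
    iso_morph : morphism U V phi;
    iso_inv_morph : morphism V U psi;
    iso_cancel : forall x, U x -> psi (phi x) = x;
    iso_inv_cancel : forall y, V y -> phi (psi y) = y }.

Definition prod_var m n (X : pset m) (Y : pset n) : pset (m + n) :=
  fun z => X (lsubmx z) /\ Y (rsubmx z).

(* Rational functions on X are represented by pairs (U, f) with U a nonempty
   open subset of X and f regular on U; finitely many of them have a common
   domain when X is irreducible. *)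
Definition rational_on n (X U : pset n) (f : 'rV[K]_n -> K) : Prop :=
  [/\ open_in X U, nonempty U & regular_on U f].

Definition alg_independent n d (U : pset n)
    (f : 'I_d -> 'rV[K]_n -> K) : Prop :=
  forall P : {mpoly K[d]},
    (forall x, U x -> P.@[fun i => f i x] = 0) -> P = 0.

Definition has_alg_independent n (X : pset n) (d : nat) : Prop :=
  exists (U : pset n) (f : 'I_d -> 'rV[K]_n -> K),
    [/\ open_in X U, nonempty U,
        forall i, regular_on U (f i) & alg_independent U f].

(* dim X is the transcendence degree of K(X) over K. *)
Definition has_dim n (X : pset n) (d : nat) : Prop :=
  has_alg_independent X d /\ ~ has_alg_independent X d.+1.

(* K[X] is integrally closed in K(X). *)
Definition normal_variety n (X : pset n) : Prop :=
  forall U f, rational_on X U f ->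
    (exists (d : nat) (c : 'I_d -> 'rV[K]_n -> K),
       (forall i, coordinate_ring X (c i)) /\
       forall x, U x -> f x ^+ d + \sum_(i < d) c i x * f x ^+ i = 0) ->
    exists g, coordinate_ring X g /\ forall x, U x -> g x = f x.

Definition normal_affine_surface n (X : pset n) : Prop :=
  [/\ affine_variety X, normal_variety X & has_dim X 2].

Record comm_monoid n (X : pset n)
    (mu : 'rV[K]_n -> 'rV[K]_n -> 'rV[K]_n) (e : 'rV[K]_n) : Prop :=
  CommMonoid {
    mon_morph :
      morphism (prod_var X X) X (fun z => mu (lsubmx z) (rsubmx z));
    mon_assoc : forall x y z, X x -> X y -> X z ->
      mu x (mu y z) = mu (mu x y) z;
    mon_comm : forall x y, X x -> X y -> mu x y = mu y x;
    mon_unit : X e;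
    mon_unitl : forall x, X x -> mu e x = x;
    mon_unitr : forall x, X x -> mu x e = x }.

Definition monoid_iso m n
    (X : pset m) (mu : 'rV[K]_m -> 'rV[K]_m -> 'rV[K]_m) (e : 'rV[K]_m)
    (Y : pset n) (nu : 'rV[K]_n -> 'rV[K]_n -> 'rV[K]_n) (e' : 'rV[K]_n) :
    Prop :=
  exists phi psi,
    [/\ isomorphism X Y phi psi,
        forall x y, X x -> X y -> phi (mu x y) = nu (phi x) (phi y)
      & phi e = e'].

Definition invertibles n (X : pset n)
    (mu : 'rV[K]_n -> 'rV[K]_n -> 'rV[K]_n) (e : 'rV[K]_n) : pset n :=
  fun x => X x /\ exists y, [/\ X y, mu x y = e & mu y x = e].

Definition torus d : pset d := fun t => forall i, t 0 i != 0.

Definition tmul d (s t : 'rV[K]_d) : 'rV[K]_d := \row_i (s 0 i * t 0 i).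

Definition torus_one d : 'rV[K]_d := const_mx 1.

Definition GmGa r s : pset (r + s) := prod_var (@torus r) (@affine_space s).

Definition GmGa_mul r s (x y : 'rV[K]_(r + s)) : 'rV[K]_(r + s) :=
  row_mx (tmul (lsubmx x) (lsubmx y)) (rsubmx x + rsubmx y).

Definition has_rank n (X : pset n)
    (mu : 'rV[K]_n -> 'rV[K]_n -> 'rV[K]_n) (e : 'rV[K]_n) (r : nat) : Prop :=
  exists (s : nat) (phi : 'rV[K]_(r + s) -> 'rV[K]_n)
         (psi : 'rV[K]_n -> 'rV[K]_(r + s)),
    isomorphism (@GmGa r s) (invertibles X mu e) phi psi /\
    forall x y, GmGa x -> GmGa y -> phi (GmGa_mul x y) = mu (phi x) (phi y).

Definition comm_monoid_of_rank n (X : pset n)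
    (mu : 'rV[K]_n -> 'rV[K]_n -> 'rV[K]_n) (e : 'rV[K]_n) (r : nat) : Prop :=
  comm_monoid X mu e /\ has_rank X mu e r.

Definition orbit_of n (act : 'rV[K]_2 -> 'rV[K]_n -> 'rV[K]_n)
    (x0 : 'rV[K]_n) : pset n :=
  fun x => exists t, torus t /\ x = act t x0.

Record toric_structure n (X : pset n)
    (act : 'rV[K]_2 -> 'rV[K]_n -> 'rV[K]_n) (x0 : 'rV[K]_n) : Prop :=
  ToricStructure {
    act_morph :
      morphism (prod_var (@torus 2) X) X (fun z => act (lsubmx z) (rsubmx z));
    act_one : forall x, X x -> act (torus_one 2) x = x;
    act_mul : forall s t x, torus s -> torus t -> X x ->
      act (tmul s t) x = act s (act t x);
    act_effective : forall t, torus t ->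
      (forall x, X x -> act t x = x) -> t = torus_one 2;
    act_base : X x0;
    act_open : open_in X (orbit_of act x0) }.

Definition toric n (X : pset n) : Prop :=
  exists act x0, toric_structure X act x0.

(* The torus being G_m^2, M and N are Z^2 with the standard pairing. *)
Definition pairing (R : pzRingType) (p u : 'rV[R]_2) : R :=
  \sum_i p 0 i * u 0 i.

Definition torus_char (u : 'rV[int]_2) (t : 'rV[K]_2) : K :=
  \prod_i t 0 i ^ u 0 i.

End Varieties.

Section Cones.

Definition cone := 'rV[rat]_2 -> Prop.

Definition to_rat (u : 'rV[int]_2) : 'rV[rat]_2 := map_mx intr u.

Definition rational_polyhedral (omega : cone) : Prop :=
  exists (k : nat) (V : 'M[rat]_(k, 2)), forall u,
    omega u <-> exists c : 'rV[rat]_k, (forall i, 0 <= c 0 i) /\ u = c *m V.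

Definition dual_cone (omega : cone) : cone :=
  fun v => forall u, omega u -> 0 <= pairing v u.

Definition face (sigma tau : cone) : Prop :=
  exists m, dual_cone sigma m /\
    forall v, tau v <-> (sigma v /\ pairing v m = 0).

(* p is the primitive lattice vector on a ray of the fan of faces of sigma. *)
Definition ray_generator (sigma : cone) (p : 'rV[int]_2) : Prop :=
  coprimez (p 0 0) (p 0 1) /\
  exists tau, face sigma tau /\
    forall v, tau v <-> exists c : rat, 0 <= c /\ v = c *: to_rat p.

Definition demazure_root (sigma : cone) (p e : 'rV[int]_2) : Prop :=
  [/\ ray_generator sigma p, pairing p e = -1 &
      forall q, ray_generator sigma q -> q != p -> 0 <= pairing q e].

End Cones.

Section Comultiplications.
Variables (K : closedFieldType) (n : nat) (X : pset K n).
Variables (act : 'rV[K]_2 -> 'rV[K]_n -> 'rV[K]_n) (x0 : 'rV[K]_n).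
Variables (omega : cone) (chi : 'rV[int]_2 -> 'rV[K]_n -> K).
Variables (mu : 'rV[K]_n -> 'rV[K]_n -> 'rV[K]_n) (e0 : 'rV[K]_n).

(* chi u is the character u transported to the open orbit by t |-> act t x0,
   and K[X] is the direct sum of the lines K (chi u), u in S_X = M :&: omega.
   In particular, for u in S_X, chi u is a regular function on all of X. *)
Record character_grading : Prop := CharacterGrading {
  grading_cone : rational_polyhedral omega;
  grading_char : forall u t, torus t -> chi u (act t x0) = torus_char u t;
  grading_regular : forall u, omega (to_rat u) -> coordinate_ring X (chi u);
  grading_span : forall f, coordinate_ring X f ->
    exists (s : seq 'rV[int]_2) (c : 'rV[int]_2 -> K),
      (forall u, u \in s -> omega (to_rat u)) /\
      forall x, X x -> f x = \sum_(u <- s) c u * chi u x;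
  grading_free : forall (s : seq 'rV[int]_2) (c : 'rV[int]_2 -> K),
    uniq s -> (forall u, u \in s -> omega (to_rat u)) ->
    (forall x, X x -> \sum_(u <- s) c u * chi u x = 0) ->
    forall u, u \in s -> c u = 0 }.

(* K[X] (x) K[X] is realised as K[X x X], the functions of two points of X. *)
Definition tens (f g : 'rV[K]_n -> K) (x y : 'rV[K]_n) : K := f x * g y.

Definition comult (f : 'rV[K]_n -> K) (x y : 'rV[K]_n) : K := f (mu x y).

Definition toric_comult : Prop :=
  forall u, omega (to_rat u) -> forall x y, X x -> X y ->
    comult (chi u) x y = tens (chi u) (chi u) x y.

(* chi^u |-> (chi^u (x) chi^u) (1 (x) chi^e + chi^e (x) 1)^<p, u>, expanded by
   the binomial formula. Here <p, u> >= 0 as p lies in the dual of omega. *)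
Definition root_comult (p e : 'rV[int]_2) : Prop :=
  forall u, omega (to_rat u) -> forall x y, X x -> X y ->
    let a := `|pairing p u|%N in
    comult (chi u) x y =
      \sum_(j < a.+1) tens (chi (u + e *+ (a - j))) (chi (u + e *+ j)) x y
                        *+ 'C(a, j).

Definition vector_comult (u1 u2 : 'rV[int]_2) : Prop :=
  forall u, u \in [:: u1; u2] -> forall x y, X x -> X y ->
    comult (chi u) x y = tens (chi u) (fun=> 1) x y + tens (fun=> 1) (chi u) x y.

(* G(X) is the acting torus, identified with the open orbit via x0. *)
Definition toric_monoid : Prop :=
  [/\ comm_monoid X mu e0,
      forall x, invertibles X mu e0 x <-> orbit_of act x0 x
    & forall s t, torus s -> torus t ->
        mu (act s x0) (act t x0) = act (tmul s t) x0].

End Comultiplications.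

Section Classification.
Variables (K : closedFieldType) (n : nat) (X : pset K n).
Variables (act : 'rV[K]_2 -> 'rV[K]_n -> 'rV[K]_n) (x0 : 'rV[K]_n).
Variables (omega : cone) (chi : 'rV[int]_2 -> 'rV[K]_n -> K).

(* A comultiplication determines mu on X, hence also its unit. *)
Definition classification_rank2 : Prop :=
  exists mu0 e0,
    [/\ comm_monoid_of_rank X mu0 e0 2,
        toric_monoid X act x0 mu0 e0,
        toric_comult X omega chi mu0
      & forall mu e, comm_monoid_of_rank X mu e 2 ->
          monoid_iso X mu e X mu0 e0].

Definition classification_rank1 : Prop :=
  (forall mu e, comm_monoid_of_rank X mu e 1 ->
     exists p d mu0 e0,
       [/\ demazure_root (dual_cone omega) p d,
           comm_monoid_of_rank X mu0 e0 1,
           root_comult X omega chi mu0 p d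
         & monoid_iso X mu e X mu0 e0]) /\
  (forall p d, demazure_root (dual_cone omega) p d ->
     exists mu0 e0,
       comm_monoid_of_rank X mu0 e0 1 /\ root_comult X omega chi mu0 p d).

(* u1, u2 is the basis of M that identifies S_X with the standard Z_{>=0}^2,
   so that chi u1, chi u2 are the coordinate functions of X = A^2. *)
Definition classification_rank0 : Prop :=
  exists u1 u2 : 'rV[int]_2,
    [/\ col_mx u1 u2 \in unitmx,
        forall u, omega (to_rat u) <->
          exists a b : nat, u = u1 *+ a + u2 *+ b,
        exists psi, isomorphism X (@affine_space K 2)
          (fun x => row_mx (chi u1 x)%:M (chi u2 x)%:M) psi
      & exists mu0 e0,
        [/\ comm_monoid_of_rank X mu0 e0 0,
            vector_comult X chi mu0 u1 u2,
            monoid_iso X mu0 e0 (@affine_space K 2) +%R 0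
          & forall mu e, comm_monoid_of_rank X mu e 0 ->
              monoid_iso X mu e X mu0 e0]].

End Classification.

(* Main.v *)
Require Import Defs.
From Stdlib Require Import Classical ClassicalEpsilon.
From mathcomp Require Import all_boot all_order all_algebra.
From mathcomp Require Import zify ring.

Set Implicit Arguments.
Unset Strict Implicit.
Unset Printing Implicit Defensive.

Import Order.TTheory GRing.Theory Num.Theory.
Local Open Scope ring_scope.


(** The unit group G of the monoid is where a single regular function does not
    vanish (units_principal): translations act on a finite dimensional space of
    functions that contains the coordinates, and x is a unit as soon as its
    matrix is invertible.  So G is open and dense, and r + s = 2 by comparing
    transcendence degrees (rank_dim).

    In each rank the torus inside G = G_m^r x G_a^s, the points with nonzero
    coordinates, parametrises a dense open subset of X in such a way that K[X] is
    spanned by the characters it contains (toric_param).  For r = 2 this torus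
    acts on X.  For r = 1 the space of the pulled back functions is invariant
    under translations by G_a, hence, in characteristic 0, under derivation by
    the additive coordinate, so it is spanned by monomials t^k x^j and contains
    t^k x^(j-1) with t^k x^j.  For r = 0 the function cutting out the complement
    of G is a polynomial without zeros on the plane, so it is constant and X = G.
    The torus of the parametrisation then acts on X (param_toric).

    A given toric structure on X is compared with the one coming from a monoid by
    toric_unique: two toric parametrisations of X have isomorphic weight monoids,
    and an isomorphism of weight monoids comes from an automorphism of X
    (param_iso).  By normality a weight monoid consists of the lattice points of
    the plane, of a half-plane, or of a pointed cone given by two primitive
    vectors p and q.  Invertible functions separate these types and half-planes
    are all equivalent.  In the pointed case a cocharacter of the second torus
    gives a derivation of K[X], whose homogeneous components for the first torus
    have as degrees either weights or roots, which are -1 on one of p and q and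
    nonnegative on the other.  If p and q do not form a basis, roots are
    nonnegative on p + q, and if no root is opposite on p and q only the degree 0
    is zero on p + q.  Then the lowest term of each character of the second torus
    is an eigenvector of the component of degree 0, and these lowest terms match
    the two lattices (toric_equiv_nosym).  The remaining surfaces are the cones
    over rational normal curves, whose degree is read off from the dimension of
    the maximal ideal of the vertex modulo its square (vertex_dim_le).

    Finally a comultiplication given on characters defines a monoid as soon as it
    does so on a dense subset (comultiplication_law, dense_monoid).  For a
    Demazure root d of the ray p the weights of the facet of p are the multiples
    of one weight f0, and every weight is k f0 - j d with j = pairing p u; the
    binomial formula is the group law of G_m x G_a for the function t^k x^j
    (root_monoid_structure).  Conversely a monoid of rank 1 provides the pair of
    p, the exponent of x, and d = (0, -1) (rank1_root).  An isomorphism of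
    varieties that respects the products on dense subsets is an isomorphism of
    monoids (dense_monoid_iso). *)

(** * The Nullstellensatz *)

Definition ideal_pred (R : comNzRingType) (J : R -> Prop) : Prop :=
  [/\ J 0, forall a b, J a -> J b -> J (a + b) & forall a b, J b -> J (a * b)].

Lemma ideal_sub (R : comNzRingType) (J : R -> Prop) a b :
  ideal_pred J -> J a -> J b -> J (a - b).
Proof. by case=> _ JD JM Ja Jb; apply: JD => //; rewrite -mulN1r; apply: JM. Qed.

Lemma nat_least (P : nat -> Prop) k : P k ->
  exists2 m, P m & forall j, P j -> (m <= j)%N.
Proof.
elim/ltn_ind: k => k IH Pk.
case: (classic (exists2 j, P j & (j < k)%N)) => [[j Pj ltjk]|no]; first exact: IH ltjk Pj.
exists k => // j Pj; rewrite leqNgt; apply/negP => ltjk; apply: no; by exists j.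
Qed.

Lemma nat_greatest (P : nat -> Prop) b k : P k ->
  (forall j, P j -> (j <= b)%N) ->
  exists2 m, P m & forall j, P j -> (j <= m)%N.
Proof.
move=> Pk Pb; have [|m [j Pj ->] minm] := @nat_least (fun i => exists2 j, P j & i = b - j)%N (b - k)%N.
  by exists k.
exists j => // i Pi; have := minm (b - i)%N (ex_intro2 _ _ i Pi erefl).
by have := Pb _ Pi; have := Pb _ Pj; lia.
Qed.

Lemma resultant_map (R S : nzRingType) (f : {rmorphism R -> S}) (p q : {poly R}) :
  f (lead_coef p) != 0 -> f (lead_coef q) != 0 ->
  f (resultant p q) = resultant (map_poly f p) (map_poly f q).
Proof.
move=> nz_fp nz_fq; rewrite /resultant /Sylvester_mx !size_map_poly_id0 //.
rewrite -det_map_mx /= map_col_mx; congr (\det (col_mx _ _));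
  by apply: map_lin1_mx => v; rewrite map_poly_rV rmorphM /= map_rVpoly.
Qed.

Section LyingOver.
Variables (K : closedFieldType) (R : comNzRingType) (f : {rmorphism R -> K}).
Variables (sec : K -> R) (J : {poly R} -> Prop).
Hypotheses (secK : cancel sec f) (idJ : ideal_pred J).

(** The image of J in K[T] is an ideal, since f is onto; it is generated by an
    element of minimal degree, which has a root unless it is constant. *)
Lemma image_ideal_root :
  (forall F, J F -> map_poly f F <> 1) ->
  exists x, forall F, J F -> (map_poly f F).[x] = 0.
Proof.
case: idJ => J0 JD JM no1.
have lift_poly (a : {poly K}) : exists A, map_poly f A = a.
  exists (\poly_(i < size a) sec a`_i).
  apply/polyP => i; rewrite coef_map coef_poly.
  case: ltnP => [_|lea] /=; last by rewrite raddf0 nth_default. by rewrite secK.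
case: (classic (exists2 F, J F & map_poly f F != 0)) => [[F JF nzF]|all0]; last first.
  exists 0 => F JF; case: (eqVneq (map_poly f F) 0) => [->|nz]; first by rewrite horner0.
  by case: all0; exists F.
pose P k := exists F, [/\ J F, map_poly f F != 0 & size (map_poly f F) = k].
have [|k [G [JG nzG szG]] min] := @nat_least P (size (map_poly f F)); first by exists F.
have dvdG F' : J F' -> map_poly f G %| map_poly f F'.
  move=> JF'; apply/modp_eq0P/eqP; apply: contraT => nz.
  have [Q defQ] := lift_poly (map_poly f F' %/ map_poly f G).
  have: P (size (map_poly f F' %% map_poly f G)).
    exists (F' - Q * G); have e : map_poly f (F' - Q * G) = map_poly f F' %% map_poly f G.
      by rewrite rmorphB rmorphM /= defQ {1}(divp_eq (map_poly f F') (map_poly f G)) addrC addKr.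
    by rewrite e; split=> //; apply: ideal_sub => //; apply: JM.
  by move/min; rewrite leqNgt -szG ltn_modp nzG.
case: (eqVneq (size (map_poly f G)) 1) => [/eqP/size_poly1P[c nzc defc]|sz1].
  have [A defA] := lift_poly (c^-1)%:P.
  by case: (no1 (A * G) (JM _ _ JG)); rewrite rmorphM /= defA defc -polyCM mulVf.
have [x /rootP rx] := closed_rootP _ sz1.
exists x => F' /dvdG /dvdpP[q ->]; by rewrite hornerM rx mulr0.
Qed.

(** Otherwise some F in J maps to 1, by image_ideal_root.  After adding a high
    multiple of the monic g both F and g are monic, so their resultant, which lies
    in the trace of J on R and is killed by f, specialises to the resultant of two
    coprime polynomials over K. *)
Lemma lying_over g : J g -> g \is monic -> (forall p, J p%:P -> f p = 0) ->
  exists x, forall F, J F -> (map_poly f F).[x] = 0.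
Proof.
move=> Jg mong tr; apply: image_ideal_root => F JF F1.
case: (idJ) => J0 JD JM.
have sz_g : (1 < size g)%N.
  rewrite ltnNge; apply/negP => le1; move: (mong); rewrite (size1_polyC le1).
  rewrite monicE lead_coefC => /eqP g1.
  have := tr _ (eq_rect _ J Jg _ (size1_polyC le1)); rewrite g1 rmorph1.
  by move/eqP; rewrite oner_eq0.
pose G := g * 'X^(size F); pose H := F + G.
have szG : size G = (size F + size g)%N.
  by rewrite /G size_mulXn // monic_neq0.
have ltF : (size F < size G)%N by rewrite szG -{1}[size F]addn0 ltn_add2l ltnW.
have szH : size H = size G by rewrite /H addrC size_polyDl.
have monH : H \is monic.
  by rewrite monicE /H lead_coefDr // -monicE /G monicMl ?monicXn.
have szH1 : (1 < size H)%N.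
  by rewrite szH szG; apply: (leq_trans sz_g); apply: leq_addl.
have [[u v] _ /= eres] := resultant_in_ideal szH1 sz_g.
have fres : f (resultant H g) = 0.
  apply: tr; rewrite eres; apply: (JD); apply: (JM) => //.
  by apply: (JD) => //; rewrite /G mulrC; apply: (JM).
have fm (h : {poly R}) : h \is monic -> f (lead_coef h) != 0.
  by move/monicP ->; rewrite rmorph1 oner_neq0.
have : resultant (map_poly f H) (map_poly f g) == 0.
  by rewrite -resultant_map ?fm // fres.
rewrite resultant_eq0; suff /eqP -> : coprimep (map_poly f H) (map_poly f g) by [].
rewrite rmorphD rmorphM /= F1 coprimep_sym mulrC addrC.
by rewrite coprimep_addl_mul coprimep1.
Qed.
End LyingOver.

(** Uniqueness of the digits in base N; it makes the weights of distinct monomials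
    distinct in Nagata's change of variables. *)
Lemma digits_inj N k (m m' : 'I_k -> nat) :
  (forall i, m i < N)%N -> (forall i, m' i < N)%N ->
  (\sum_i m i * N ^ i = \sum_i m' i * N ^ i)%N -> m =1 m'.
Proof.
elim: k m m' => [|k IH] m m' hm hm' /=; first by move=> _ [].
rewrite !big_ord_recl /= !expn0 !muln1.
have e (p : 'I_k.+1 -> nat) : (\sum_(i < k) p (lift ord0 i) * N ^ bump 0 i =
    N * \sum_(i < k) p (lift ord0 i) * N ^ i)%N.
  by rewrite big_distrr; apply: eq_bigr => i _ /=; rewrite /bump /= add1n expnS; ring.
rewrite !e => E.
have e0 : m ord0 = m' ord0.
  have := congr1 (modn^~ N) E.
  by rewrite ![(N * _)%N]mulnC ![(_ + _ * N)%N]addnC !modnMDl !modn_small.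
have N0 : (0 < N)%N by apply: leq_ltn_trans (hm ord0).
have := IH (m \o lift ord0) (m' \o lift ord0) (fun i => hm _) (fun i => hm' _).
move: E; rewrite e0 => /addnI /eqP; rewrite eqn_pmul2l // => /eqP E /(_ E) {}IH.
by move=> i; case: (unliftP ord0 i) => [j|] ->; [apply: IH | ].
Qed.

Section Nagata.
Variables (K : fieldType) (k N : nat).

Definition nagata_var (i : 'I_k.+1) : {poly {mpoly K[k]}} :=
  if unlift ord0 i is Some j then ('X_j)%:P + 'X^(N ^ i) else 'X.

(** Nagata's change of variables: 'X_0 becomes the polynomial variable and 'X_i
    becomes 'X_i + 'X_0 ^ (N ^ i). *)
Definition nagata (P : {mpoly K[k.+1]}) : {poly {mpoly K[k]}} :=
  mmap (polyC \o @mpolyC k K) nagata_var P.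

Definition monic_of_degree (p : {poly {mpoly K[k]}}) d :=
  (p \is monic) && (size p == d.+1).

Lemma monic_of_degree_prod (I : finType) (F : I -> {poly {mpoly K[k]}}) d e :
  (forall i, monic_of_degree (F i) (d i)) ->
  monic_of_degree (\prod_i F i ^+ e i) (\sum_i e i * d i)%N.
Proof.
have M p q a b : monic_of_degree p a -> monic_of_degree q b -> monic_of_degree (p * q) (a + b)%N.
  move=> /andP[mp /eqP sp] /andP[mq /eqP sq]; rewrite /monic_of_degree monicMl // mq.
  by rewrite size_monicM ?monic_neq0 // sp sq addnS addSn /=.
have one : monic_of_degree 1 0 by rewrite /monic_of_degree monic1 size_poly1.
move=> h; elim/big_ind2: _ => // [p a q b|i _]; first exact: M.
elim: (e i) => [|n IH]; first by rewrite expr0 mul0n.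
by rewrite exprS mulSn; apply: M.
Qed.

Lemma nagata_var_monic i : (0 < N)%N -> monic_of_degree (nagata_var i) (N ^ i).
Proof.
move=> N0; rewrite /monic_of_degree /nagata_var; case: unliftP => [j|] -> /=.
  have lt : (size (('X_j : {mpoly K[k]})%:P) < size ('X^(N ^ (bump 0 j)) : {poly {mpoly K[k]}}))%N.
    by rewrite size_polyXn; apply: (leq_ltn_trans (size_polyC_leq1 _)); rewrite ltnS expn_gt0 N0.
  by rewrite addrC monicE lead_coefDl // lead_coefXn eqxx size_polyDl // size_polyXn eqxx.
by rewrite monicX size_polyX expn0.
Qed.

Lemma lead_coef_sum_monic (T : eqType) (s : seq T) (c : T -> K) (M : T -> {poly {mpoly K[k]}}) (d : T -> nat) :
  uniq s -> s != [::] -> (forall x, x \in s -> c x != 0) ->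
  {in s &, injective d} -> (forall x, monic_of_degree (M x) (d x)) ->
  exists x, [/\ x \in s, lead_coef (\sum_(y <- s) ((c y)%:MP)%:P * M y) = (c x)%:MP
    & size (\sum_(y <- s) ((c y)%:MP)%:P * M y) = (d x).+1].
Proof.
have one y : c y != 0 -> monic_of_degree (M y) (d y) ->
   lead_coef (((c y)%:MP)%:P * M y) = (c y)%:MP /\ size (((c y)%:MP)%:P * M y) = (d y).+1.
  move=> nz /andP[mo /eqP sz]; rewrite lead_coef_Mmonic // lead_coefC; split=> //.
  by rewrite mul_polyC size_scale // mpolyC_eq0.
elim: s => // x s IH /= /andP[xs us] _ nz inj mon.
rewrite big_cons; have [|l1 s1] := one x _ (mon x); first by apply: nz; rewrite mem_head.
have [->|ns] := eqVneq s [::]; first by rewrite big_nil addr0; exists x; rewrite mem_head.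
have [||y [ys l2 s2]] := IH us ns _ _ mon.
- by move=> y ys; apply: nz; rewrite inE ys orbT.
- by move=> y z ys zs; apply: inj; rewrite inE ?ys ?zs orbT.
have nd : d x != d y.
  apply: contraNneq xs => /inj -> //; by rewrite inE ?eqxx ?ys ?orbT.
case: (ltngtP (d x) (d y)) nd => // lt _.
- exists y; split; [by rewrite inE ys orbT | |].
    by rewrite lead_coefDr ?s1 ?s2.
  by rewrite addrC size_polyDl ?s1 ?s2.
- exists x; split; [by rewrite inE eqxx | |].
    by rewrite lead_coefDl ?s1 ?s2.
  by rewrite size_polyDl ?s1 ?s2.
Qed.

(** The monomial m becomes monic of degree \sum_i m i * N ^ i.  These degrees are
    distinct when N exceeds all exponents, so one monomial dominates. *)
Lemma lead_coef_nagata (P : {mpoly K[k.+1]}) :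
  P != 0 -> (forall m i, m \in msupp P -> m i < N)%N ->
  exists2 c, c != 0 & lead_coef (nagata P) = c%:MP.
Proof.
move=> nzP hN.
have ns : msupp P != [::] by rewrite msupp_eq0.
have N0 : (0 < N)%N.
  by case: (msupp P) ns hN => // m s _ /(_ m ord0); rewrite mem_head => /(_ isT); apply: leq_ltn_trans.
have [m|m m' hm hm' e|m|m [hm e _]] := @lead_coef_sum_monic _ (msupp P) (fun m => P@_m)
  (fun m => \prod_i nagata_var i ^+ m i) (fun m => \sum_i m i * N ^ i)%N (msupp_uniq P) ns.
- by rewrite mcoeff_msupp.
- by apply/mnmP; apply: (digits_inj _ _ e) => i; apply: hN.
- by apply: monic_of_degree_prod => i; apply: nagata_var_monic.
- by exists P@_m; [rewrite -mcoeff_msupp | rewrite /nagata /mmap].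
Qed.
End Nagata.

Section Nullstellensatz.
Variables (K : closedFieldType).

Lemma mpoly_morph_eq (R : comNzRingType) n (S : nzRingType) (f g : {rmorphism {mpoly R[n]} -> S}) :
  (forall c, f c%:MP = g c%:MP) -> (forall i, f 'X_i = g 'X_i) -> f =1 g.
Proof.
move=> hc hX p; rewrite [p]mpolyE !rmorph_sum /=; apply: eq_bigr => m _.
rewrite -mul_mpolyC !rmorphM /= hc; congr (_ * _).
rewrite mpolyXE_id !rmorph_prod /=; apply: eq_bigr => i _.
by rewrite !rmorphXn /= hX.
Qed.

Variables (A : comNzRingType) (iota : {rmorphism K -> A}) (I : A -> Prop).
Hypotheses (idI : ideal_pred I) (I1 : ~ I 1).

(** Induction on k.  A nonzero relation between the a i becomes monic in a 0 over
    the elements b j = a j - a 0 ^ (N ^ j), to which the induction hypothesis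
    applies; lying_over extends the zero so obtained. *)
Lemma generic_zero k (a : 'I_k -> A) :
  exists c : 'I_k -> K, forall P, I (mmap iota a P) -> P.@[c] = 0.
Proof.
elim: k a => [|k IH] a.
  exists (fun=> 0) => P; have -> : P = (P@_0%MM)%:MP.
    by apply/mpolyP => m; rewrite mcoeffC (_ : m = 0%MM) ?eqxx ?mulr1 //; apply/mnmP => -[].
  rewrite mmapC mevalC => Ic; apply/eqP; apply: contraT => nz; case: I1.
  by have [_ _ IM] := idI; have := IM (iota (P@_0%MM)^-1) _ Ic; rewrite -rmorphM mulVf // rmorph1.
case: (classic (exists2 P, P != 0 & I (mmap iota a P))) => [[P nzP IP]|no]; last first.
  exists (fun=> 0) => P IP; case: (eqVneq P 0) => [->|nz]; first exact: meval0.
  by case: no; exists P.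
pose N := (\max_(m <- msupp P) mdeg m).+1.
have hN m i : m \in msupp P -> (m i < N)%N.
  move=> hm; rewrite ltnS; apply: (@leq_trans (mdeg m)); last exact: leq_bigmax_seq.
  by rewrite mdegE (bigD1 i) //= leq_addr.
have [c0 nzc0 lead] := lead_coef_nagata nzP hN.
pose b j := a (lift ord0 j) - a ord0 ^+ (N ^ (lift ord0 j)).
have [c hc] := IH b.
pose E : {rmorphism {poly {mpoly K[k]}} -> A} := horner_eval (a ord0) \o map_poly (mmap iota b).
have E_nagata Q : E (nagata N Q) = mmap iota a Q.
  apply: (@mpoly_morph_eq _ _ _ (E \o nagata N) (mmap iota a)) => [d|i].
    by rewrite /E /= /nagata !mmapC /= map_polyC /= mmapC /horner_eval hornerC.
  rewrite /E /= /nagata !mmapX !mmap1U /nagata_var /horner_eval.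
  case: unliftP => [j|] -> /=; last by rewrite map_polyX hornerX.
  by rewrite rmorphD /= map_polyC map_polyXn /= mmapX mmap1U !hornerE subrK.
have idJ : ideal_pred (fun F => I (E F)).
  by case: idI => I0 ID IM; split=> [|F G IF IG|F G IG]; rewrite ?rmorph0 ?rmorphD ?rmorphM /=; [|apply: ID|apply: IM].
pose g := ((c0^-1)%:MP)%:P * nagata N P.
have [||p Ip|x hx] := @lying_over _ _ (meval c) (@mpolyC k K) _ (mevalC c) idJ g.
- by case: idI => _ _ IM; rewrite rmorphM; apply: IM; rewrite E_nagata.
- by rewrite monicE lead_coefM lead_coefC lead -mpolyCM mulVf.
- by move: Ip; rewrite /E /= map_polyC /horner_eval hornerC /= => /hc.
exists (fun i => if unlift ord0 i is Some j then c j + x ^+ (N ^ i) else x) => Q IQ.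
rewrite -[RHS](hx (nagata N Q)) ?E_nagata //.
pose E' : {rmorphism {poly {mpoly K[k]}} -> K} := horner_eval x \o map_poly (meval c).
apply/esym; apply: (@mpoly_morph_eq _ _ _ (E' \o nagata N) (meval _)) => [d|i].
  by rewrite /E' /= /nagata !mmapC /= map_polyC /= mevalC /horner_eval hornerC mevalC.
rewrite /E' /= /nagata !mmapX mevalXU !mmap1U /nagata_var /horner_eval.
case: unliftP => [j|] _ /=; last by rewrite map_polyX hornerX.
by rewrite rmorphD /= map_polyC map_polyXn /= mevalXU !hornerE.
Qed.
End Nullstellensatz.

Theorem nullstellensatz (K : closedFieldType) n (I : {mpoly K[n]} -> Prop) :
  ideal_pred I -> ~ I 1 -> exists c : 'I_n -> K, forall P, I P -> P.@[c] = 0.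
Proof.
move=> idI I1; have [c hc] := @generic_zero K _ (@mpolyC n K) I idI I1 _ (fun i => 'X_i).
exists c => P IP; apply: hc; suff -> : mmap (@mpolyC n K) (fun i => 'X_i) P = P by [].
apply: (@mpoly_morph_eq _ _ _ (mmap _ _) idfun) => [d|i] /=; first exact: mmapC.
by rewrite mmapX mmap1U.
Qed.

(** * Polynomial and regular functions *)

Section Functions.
Variable K : closedFieldType.

Definition pfun n (f : 'rV[K]_n -> K) : Prop := exists P, forall x, f x = ev P x.

Section PFun.
Variable n : nat.
Implicit Types f g : 'rV[K]_n -> K.

Lemma pfun_ev P : pfun (@ev K n P). Proof. by exists P. Qed.

Lemma pfun_ext f g : f =1 g -> pfun f -> pfun g.
Proof. by move=> e [P hP]; exists P => x; rewrite -e. Qed.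

Lemma pfun_const c : @pfun n (fun=> c).
Proof. by exists c%:MP => x; rewrite /ev mevalC. Qed.

Lemma pfun_coord i : @pfun n (fun x => x 0 i).
Proof. by exists 'X_i => x; rewrite /ev mevalXU. Qed.

Lemma pfunD f g : pfun f -> pfun g -> pfun (fun x => f x + g x).
Proof. by move=> [P hP] [Q hQ]; exists (P + Q) => x; rewrite /ev mevalD hP hQ. Qed.

Lemma pfunM f g : pfun f -> pfun g -> pfun (fun x => f x * g x).
Proof. by move=> [P hP] [Q hQ]; exists (P * Q) => x; rewrite /ev mevalM hP hQ. Qed.

Lemma pfunB f g : pfun f -> pfun g -> pfun (fun x => f x - g x).
Proof. by move=> [P hP] [Q hQ]; exists (P - Q) => x; rewrite /ev mevalB hP hQ. Qed.

Lemma pfunX f k : pfun f -> pfun (fun x => f x ^+ k).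
Proof. by move=> [P hP]; exists (P ^+ k) => x; rewrite /ev rmorphXn /= hP. Qed.

Lemma pfun_sum (T : Type) (s : seq T) (p : pred T) (F : T -> 'rV[K]_n -> K) :
  (forall i, pfun (F i)) -> pfun (fun x => \sum_(i <- s | p i) F i x).
Proof.
move=> h; elim: s => [|a s IH].
  by apply: (pfun_ext _ (pfun_const 0)) => x; rewrite big_nil.
case: (boolP (p a)) => pa; last first.
  by apply: (pfun_ext _ IH) => x; rewrite big_cons (negPf pa).
by apply: (pfun_ext _ (pfunD (h a) IH)) => x; rewrite big_cons pa.
Qed.

(** Polynomial functions are generated by constants and coordinates. *)
Lemma pfun_ind (Pr : ('rV[K]_n -> K) -> Prop) :
  (forall f g, f =1 g -> Pr f -> Pr g) -> (forall c, Pr (fun=> c)) ->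
  (forall i, Pr (fun x => x 0 i)) ->
  (forall f g, pfun f -> pfun g -> Pr f -> Pr g -> Pr (fun x => f x + g x)) ->
  (forall f g, pfun f -> pfun g -> Pr f -> Pr g -> Pr (fun x => f x * g x)) ->
  forall f, pfun f -> Pr f.
Proof.
move=> ext C X D M f [P hP].
suff [pP PrP] : pfun (ev P) /\ Pr (ev P) by apply: ext PrP.
rewrite [P]mpolyE.
have M' f' g' : pfun f' /\ Pr f' -> pfun g' /\ Pr g' -> 
   pfun (fun x => f' x * g' x) /\ Pr (fun x => f' x * g' x).
  by move=> [? ?] [? ?]; split; [apply: pfunM | apply: M].
elim: (msupp P) => [|m s [IH1 IH2]].
  split; [apply: (pfun_ext _ (pfun_const 0)) | apply: (ext (fun=> 0))] => // x;
  by rewrite big_nil /ev meval0.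
suff [h1 h2] : pfun (ev (P@_m *: 'X_[m])) /\ Pr (ev (P@_m *: 'X_[m])).
  split; [apply: (pfun_ext _ (pfunD h1 IH1)) | apply: (ext _ _ _ (D _ _ h1 IH1 h2 IH2))] => // x;
  by rewrite big_cons /ev mevalD.
suff [h1 h2] : pfun (ev 'X_[m]) /\ Pr (ev 'X_[m]).
  have [h3 h4] := M' _ _ (conj (pfun_const P@_m) (C P@_m)) (conj h1 h2).
  by split; [apply: (pfun_ext _ h3) | apply: (ext _ _ _ h4)] => x; rewrite /ev mevalZ.
have E (x : 'rV[K]_n) : \prod_(i <- enum 'I_n) (x 0 i) ^+ m i = ev 'X_[m] x.
  by rewrite /ev mevalX big_enum.
suff [h1 h2] : pfun (fun x : 'rV_n => \prod_(i <- enum 'I_n) (x 0 i) ^+ m i) /\ 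
    Pr (fun x => \prod_(i <- enum 'I_n) (x 0 i) ^+ m i).
  by split; [apply: (pfun_ext E) | apply: (ext _ _ E)].
elim: (enum 'I_n) => [|i s' [h1 h2]].
  split; [apply: (pfun_ext _ (pfun_const 1)) | apply: (ext (fun=> 1))] => // x;
  by rewrite big_nil.
suff H1 : pfun (fun x : 'rV_n => x 0 i ^+ m i) /\ Pr (fun x => x 0 i ^+ m i).
  have [h3 h4] := M' _ _ H1 (conj h1 h2).
  by split; [apply: (pfun_ext _ h3) | apply: (ext _ _ _ h4)] => x; rewrite big_cons.
elim: (m i) => [|k H1]; first by split; [exact: pfun_const | exact: C].
have [h3 h4] := M' _ _ (conj (pfun_coord i) (X i)) H1.
by split; [apply: (pfun_ext _ h3) | apply: (ext _ _ _ h4)] => x; rewrite exprS.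
Qed.
End PFun.

Lemma pfun_comp m n (f : 'rV[K]_n -> K) (g : 'rV[K]_m -> 'rV[K]_n) :
  pfun f -> (forall j, pfun (fun x => g x 0 j)) -> pfun (fun x => f (g x)).
Proof.
move=> pf pg; pattern f; apply: pfun_ind pf => //.
- by move=> f1 f2 e; apply: pfun_ext.
- exact: pfun_const.
- by move=> f1 f2 _ _; apply: pfunD.
- by move=> f1 f2 _ _; apply: pfunM.
Qed.

(** By Nagata's change of variables P has a restriction to a curve that is a
    nonzero polynomial in one variable. *)
Lemma mpoly_nonzero_point n (P : {mpoly K[n]}) : P != 0 -> exists x, ev P x != 0.
Proof.
case: n P => [|k] P nz.
  exists 0; move: nz; have -> : P = (P@_0%MM)%:MP.
    by apply/mpolyP => m; rewrite mcoeffC (_ : m = 0%MM) ?eqxx ?mulr1 //; apply/mnmP => -[].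
  by rewrite mpolyC_eq0 /ev mevalC.
pose N := (\max_(m <- msupp P) mdeg m).+1.
have hN m i : m \in msupp P -> (m i < N)%N.
  move=> hm; rewrite ltnS; apply: (@leq_trans (mdeg m)); last exact: leq_bigmax_seq.
  by rewrite mdegE (bigD1 i) //= leq_addr.
have [c0 nzc0 lead] := lead_coef_nagata nz hN.
have /closed_nonrootP [x hx] : map_poly (meval (fun=> 0)) (nagata N P) != 0.
  apply: contra_neq nzc0 => e.
  have := coef_map (meval (fun=> 0)) (nagata N P) (size (nagata N P)).-1.
  by rewrite e coef0 -lead_coefE lead /= mevalC.
pose E' : {rmorphism {poly {mpoly K[k]}} -> K} := horner_eval x \o map_poly (meval (fun=> 0)).
exists (\row_i if unlift ord0 i is Some j then x ^+ (N ^ i) else x).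
rewrite /ev -[P.@[_]](_ : E' (nagata N P) = _) //.
apply: (@mpoly_morph_eq _ _ _ (E' \o nagata N) (meval _)) => [d|i].
  by rewrite /E' /= /nagata !mmapC /= map_polyC /= mevalC /horner_eval hornerC mevalC.
rewrite /E' /= /nagata !mmapX mevalXU !mmap1U /nagata_var /horner_eval !mxE.
case: unliftP => [j|] _ /=; last by rewrite map_polyX hornerX.
by rewrite rmorphD /= map_polyC map_polyXn /= mevalXU !hornerE.
Qed.

Lemma mpoly_nonzero_point2 n (P Q : {mpoly K[n]}) : P != 0 -> Q != 0 ->
  exists x, ev P x != 0 /\ ev Q x != 0.
Proof.
move=> nP nQ; have [|x] := @mpoly_nonzero_point n (P * Q); first by rewrite mulf_neq0.
by rewrite /ev mevalM mulf_eq0 negb_or => /andP; exists x.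
Qed.

Lemma coordinate_ring_pfun n (X : pset K n) f : pfun f -> coordinate_ring X f.
Proof. by case=> P hP; exists P. Qed.

Lemma coordinate_ring_ext n (X : pset K n) f g : (forall x, X x -> f x = g x) ->
  coordinate_ring X f -> coordinate_ring X g.
Proof. by move=> e [P hP]; exists P => x Xx; rewrite -e ?hP. Qed.

Lemma coordinate_ring_comp m n (X : pset K m) (Y : pset K n) f (g : 'rV[K]_m -> 'rV[K]_n) :
  coordinate_ring Y f -> (forall x, X x -> Y (g x)) ->
  (forall j, coordinate_ring X (fun x => g x 0 j)) -> coordinate_ring X (fun x => f (g x)).
Proof.
move=> [P hP] gXY hg.
have /fin_all_exists [Q hQ] := hg.
have [R hR] : pfun (fun x => ev P (\row_j ev (Q j) x)).
  apply: pfun_comp (pfun_ev P) _ => j; exists (Q j) => x; by rewrite mxE.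
exists R => x Xx; rewrite -hR hP; last exact: gXY.
by congr (ev P _); apply/rowP => j; rewrite mxE hQ.
Qed.

(** An open neighbourhood of x contains one of the form P <> 0; multiplying the
    numerator and the denominator by P makes the quotient valid wherever the
    denominator does not vanish. *)
Lemma regularP n (U : pset K n) f :
  regular_on U f <-> forall x, U x -> exists A B, ev B x != 0 /\
     forall y, U y -> ev B y != 0 -> f y = ev A y / ev B y.
Proof.
split=> [h x Ux|h x Ux].
  have [V [[Z [[S hS] hV]] Vx [A [B hAB]]]] := h x Ux.
  have [_ nZx] := proj1 (hV x) Vx.
  case: (classic (exists2 P, S P & ev P x != 0)) => [[P SP nP]|no]; last first.
    case: nZx; apply/hS => P SP; case: (eqVneq (ev P x) 0) => // nz; case: no; by exists P.
  exists (A * P), (B * P); split; first by rewrite /ev mevalM mulf_neq0 // (hAB x Vx).1.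
  move=> y Uy; rewrite /ev !mevalM mulf_eq0 negb_or => /andP[nB nPy].
  have Vy : V y by apply/hV; split=> // /hS /(_ _ SP) /eqP; apply/negP.
  by rewrite (hAB y Vy).2 -mulf_div divff // mulr1.
have [A [B [nB hAB]]] := h x Ux.
exists (fun y => U y /\ ev B y != 0); split=> //.
  exists (fun y => ev B y = 0); split.
    by exists (fun P => P = B) => y; split=> [e P ->|] //; apply.
  by move=> y; split=> -[Uy] /eqP.
by exists A, B => y [Uy nBy]; split=> //; apply: hAB.
Qed.

Section Regular.
Variables (n : nat) (U : pset K n).
Implicit Types f g : 'rV[K]_n -> K.

Lemma regular_ext f g : (forall x, U x -> f x = g x) -> regular_on U f -> regular_on U g.
Proof.
move=> e /regularP h; apply/regularP => x /h [A [B [nB hAB]]]; exists A, B; split=> // y Uy nBy.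
by rewrite -e // hAB.
Qed.

Lemma regular_cr f : coordinate_ring U f -> regular_on U f.
Proof.
move=> [P hP]; apply/regularP => x Ux; exists P, 1; rewrite /ev meval1 oner_neq0; split=> // y Uy _.
by rewrite meval1 divr1 hP.
Qed.

Lemma regular_pfun f : pfun f -> regular_on U f.
Proof. by move=> pf; apply/regular_cr/coordinate_ring_pfun. Qed.

Lemma regularD f g : regular_on U f -> regular_on U g -> regular_on U (fun x => f x + g x).
Proof.
move=> /regularP hf /regularP hg; apply/regularP => x Ux.
have [A [B [nB hAB]]] := hf x Ux; have [C [D [nD hCD]]] := hg x Ux.
exists (A * D + C * B), (B * D); rewrite /ev mevalM mulf_neq0 //; split=> // y Uy.
rewrite mevalD !mevalM mulf_eq0 negb_or => /andP[nBy nDy].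
by rewrite hAB // hCD // addf_div.
Qed.

Lemma regularM f g : regular_on U f -> regular_on U g -> regular_on U (fun x => f x * g x).
Proof.
move=> /regularP hf /regularP hg; apply/regularP => x Ux.
have [A [B [nB hAB]]] := hf x Ux; have [C [D [nD hCD]]] := hg x Ux.
exists (A * C), (B * D); rewrite /ev mevalM mulf_neq0 //; split=> // y Uy.
rewrite !mevalM mulf_eq0 negb_or => /andP[nBy nDy].
by rewrite hAB // hCD // mulf_div.
Qed.

Lemma regularV f : (forall x, U x -> f x != 0) -> regular_on U f -> regular_on U (fun x => (f x)^-1).
Proof.
move=> nf /regularP hf; apply/regularP => x Ux.
have [A [B [nB hAB]]] := hf x Ux.
have nA : ev A x != 0.
  by have := nf x Ux; rewrite hAB //; apply: contraNneq => ->; rewrite mul0r.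
exists (B * B), (A * B); rewrite /ev mevalM mulf_neq0 //; split=> // y Uy.
rewrite !mevalM mulf_eq0 negb_or => /andP[nAy nBy].
by rewrite hAB // invf_div -mulf_div divff // mulr1.
Qed.

Lemma regular_sum (T : Type) (s : seq T) (p : pred T) (F : T -> 'rV[K]_n -> K) :
  (forall i, regular_on U (F i)) -> regular_on U (fun x => \sum_(i <- s | p i) F i x).
Proof.
move=> h; elim: s => [|a s IH].
  by apply: (regular_ext _ (regular_pfun (pfun_const n 0))) => x; rewrite big_nil.
case: (boolP (p a)) => pa; last first.
  by apply: (regular_ext _ IH) => x; rewrite big_cons (negPf pa).
by apply: (regular_ext _ (regularD (h a) IH)) => x; rewrite big_cons pa.
Qed.

Lemma regular_prod (T : Type) (s : seq T) (p : pred T) (F : T -> 'rV[K]_n -> K) :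
  (forall i, regular_on U (F i)) -> regular_on U (fun x => \prod_(i <- s | p i) F i x).
Proof.
move=> h; elim: s => [|a s IH].
  by apply: (regular_ext _ (regular_pfun (pfun_const n 1))) => x; rewrite big_nil.
case: (boolP (p a)) => pa; last first.
  by apply: (regular_ext _ IH) => x; rewrite big_cons (negPf pa).
by apply: (regular_ext _ (regularM (h a) IH)) => x; rewrite big_cons pa.
Qed.

Lemma regularX f k : regular_on U f -> regular_on U (fun x => f x ^+ k).
Proof.
move=> h; elim: k => [|k IH].
  by apply: regular_ext (regular_pfun (pfun_const n 1)) => x; rewrite expr0.
by apply: regular_ext (regularM h IH) => x; rewrite exprS.
Qed.

Lemma regularXz f (k : int) : (forall x, U x -> f x != 0) -> regular_on U f ->
  regular_on U (fun x => f x ^ k).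
Proof.
move=> nf h; case: k => k; first exact: regularX.
by apply: regularV (regularX _ h) => x /nf; apply: expf_neq0.
Qed.
End Regular.

Lemma regular_sub n (U V : pset K n) f : (forall x, V x -> U x) -> regular_on U f -> regular_on V f.
Proof.
move=> VU /regularP h; apply/regularP => x /VU/h [A [B [nB hAB]]]; exists A, B; split=> // y Vy.
by apply: hAB; apply: VU.
Qed.

Lemma regular_comp m n (U : pset K m) (V : pset K n) f (g : 'rV[K]_m -> 'rV[K]_n) :
  regular_on V f -> (forall x, U x -> V (g x)) ->
  (forall j, regular_on U (fun x => g x 0 j)) -> regular_on U (fun x => f (g x)).
Proof.
move=> /regularP hf UV hg.
have pg h : pfun h -> regular_on U (fun x => h (g x)).
  move=> ph; pattern h; apply: pfun_ind ph => //.
  - by move=> f1 f2 e; apply: regular_ext => x _; rewrite e.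
  - by move=> c; apply: regular_pfun; apply: pfun_const.
  - by move=> f1 f2 _ _; apply: regularD.
  - by move=> f1 f2 _ _; apply: regularM.
apply/regularP => x Ux; have [A [B [nB hAB]]] := hf _ (UV x Ux).
have [A1 [B1 [nB1 h1]]] := proj1 (regularP _ _) (pg _ (pfun_ev A)) x Ux.
have [A2 [B2 [nB2 h2]]] := proj1 (regularP _ _) (pg _ (pfun_ev B)) x Ux.
have nA2 : ev A2 x != 0.
  by move: nB; rewrite h2 //; apply: contraNneq => ->; rewrite mul0r.
exists (A1 * B2 * B2), (B1 * A2 * B2); rewrite /ev !mevalM !mulf_neq0 //; split=> // y Uy.
rewrite !mevalM !mulf_eq0 !negb_or => /andP[/andP[n1 n2] n3].
have nBy : ev B (g y) != 0 by rewrite h2 // mulf_neq0 ?invr_neq0.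
rewrite hAB //; last exact: UV.
by rewrite h1 // h2 // invf_div mulf_div -[RHS]mulf_div divff // mulr1.
Qed.

Lemma open_principal n (X : pset K n) P : open_in X (fun x => X x /\ ev P x != 0).
Proof.
exists (fun x => ev P x = 0); split; last by move=> x; split=> -[Xx] /eqP.
by exists (fun Q => Q = P) => y; split=> [e Q ->|] //; apply.
Qed.

Lemma open_inner n (X U : pset K n) x : open_in X U -> U x ->
  exists P, ev P x != 0 /\ forall y, X y -> ev P y != 0 -> U y.
Proof.
move=> [Z [[S hS] hU]] Ux; have [Xx nZx] := proj1 (hU x) Ux.
case: (classic (exists2 P, S P & ev P x != 0)) => [[P SP nP]|no]; last first.
  case: nZx; apply/hS => P SP; case: (eqVneq (ev P x) 0) => // nz; case: no; by exists P.
exists P; split=> // y Xy nPy; apply/hU; split=> // /hS /(_ _ SP) /eqP; exact/negP.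
Qed.

Lemma open_ext n (X U V : pset K n) : (forall x, U x <-> V x) -> open_in X U -> open_in X V.
Proof. by move=> e [Z [cZ h]]; exists Z; split=> // x; rewrite -e. Qed.

Lemma zariski_closed_setI n (X Y : pset K n) : zariski_closed X -> zariski_closed Y ->
  zariski_closed (fun x => X x /\ Y x).
Proof.
move=> [S hS] [T hT]; exists (fun P => S P \/ T P) => x; split.
  by move=> [/hS h1 /hT h2] P [/h1|/h2].
by move=> h; split; [apply/hS | apply/hT] => P hP; apply: h; [left | right].
Qed.

Lemma zariski_closed_preim m n (X : pset K n) (g : 'rV[K]_m -> 'rV[K]_n) :
  zariski_closed X -> (forall j, pfun (fun x => g x 0 j)) -> zariski_closed (fun x => X (g x)).
Proof.
move=> [S hS] pg; exists (fun P => exists2 Q, S Q & forall x, ev P x = ev Q (g x)) => x; split.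
  by move=> /hS h P [Q SQ ->]; apply: h.
move=> h; apply/hS => Q SQ; have [P hP] := pfun_comp (pfun_ev Q) pg.
by rewrite hP; apply: h; exists Q.
Qed.

Lemma zariski_closed_pfun n (f : 'rV[K]_n -> K) : pfun f -> zariski_closed (fun x => f x = 0).
Proof. by move=> [P hP]; exists (fun Q => Q = P) => x; rewrite hP; split=> [? ? ->|] //; apply. Qed.

Lemma zariski_closed_affine n : zariski_closed (@affine_space K n).
Proof. by exists (fun=> False). Qed.

Lemma pfun_lsubmx m n (j : 'I_m) : pfun (fun z : 'rV[K]_(m + n) => lsubmx z 0 j).
Proof. by apply: pfun_ext (pfun_coord _) => z; rewrite mxE. Qed.

Lemma pfun_rsubmx m n (j : 'I_n) : pfun (fun z : 'rV[K]_(m + n) => rsubmx z 0 j).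
Proof. by apply: pfun_ext (pfun_coord _) => z; rewrite mxE. Qed.

Lemma zariski_closed_prod m n (X : pset K m) (Y : pset K n) :
  zariski_closed X -> zariski_closed Y -> zariski_closed (prod_var X Y).
Proof.
move=> cX cY; apply: zariski_closed_setI.
  by apply: (zariski_closed_preim cX) => j; apply: pfun_lsubmx.
by apply: (zariski_closed_preim cY) => j; apply: pfun_rsubmx.
Qed.

(** The denominators of a regular function form an ideal without common zeros
    on the closed set X, and hence without any common zero. *)
Lemma regular_closed n (X : pset K n) f :
  zariski_closed X -> regular_on X f -> coordinate_ring X f.
Proof.
move=> [S hS] /regularP hf.
pose I B := exists A, forall x, X x -> ev B x * f x = ev A x.
have idI : ideal_pred I.
  split.
  - by exists 0 => x _; rewrite /ev !meval0 mul0r.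
  - move=> B C [A hA] [D hD]; exists (A + D) => x Xx.
    by rewrite /ev !mevalD mulrDl; congr (_ + _); [apply: hA | apply: hD].
  - by move=> B C [A hA]; exists (B * A) => x Xx; rewrite /ev !mevalM -mulrA; congr (_ * _); apply: hA.
case: (classic (I 1)) => [[A hA]|I1].
  by exists A => x Xx; rewrite -hA // /ev meval1 mul1r.
have [c hc] := nullstellensatz idI I1.
pose x : 'rV_n := \row_i c i.
have evc P : ev P x = P.@[c] by apply: meval_eq => i; rewrite mxE.
have Xx : X x.
  apply/hS => P SP; rewrite evc; apply: hc; exists 0 => y Xy.
  by rewrite (proj1 (hS y) Xy P SP) mul0r /ev meval0.
have [A [B [nB hAB]]] := hf x Xx.
suff : ev (B * B) x = 0 by rewrite /ev mevalM => /eqP; rewrite mulf_eq0 orbb; rewrite (negPf nB).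
rewrite evc; apply: hc; exists (A * B) => y Xy; rewrite /ev !mevalM.
case: (eqVneq (ev B y) 0) => [e|nz]; first by rewrite /ev in e; rewrite e !mulr0 mul0r.
by rewrite (hAB y Xy nz) /ev mulrAC -mulrA divfK // mulrC.
Qed.

(** The part of X where h <> 0 is isomorphic to the closed set h(x) t = 1, on which
    regular functions are polynomials. *)
Lemma regular_on_principal n (X : pset K n) h f :
  zariski_closed X -> regular_on (fun x => X x /\ ev h x != 0) f ->
  exists k A, forall x, X x -> ev h x != 0 -> ev h x ^+ k * f x = ev A x.
Proof.
move=> cX rf.
pose Y : pset K (n + 1) := fun z => X (lsubmx z) /\ ev h (lsubmx z) * rsubmx z 0 0 - 1 = 0.
have cY : zariski_closed Y.
  apply: zariski_closed_setI; first by apply: (zariski_closed_preim cX) => j; apply: pfun_lsubmx.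
  apply: zariski_closed_pfun; apply: pfunB; last exact: pfun_const.
  apply: pfunM; last exact: pfun_rsubmx.
  by apply: (pfun_comp (pfun_ev h)) => j; apply: pfun_lsubmx.
have [|F hF] := @regular_closed _ Y (fun z => f (lsubmx z)) cY.
  apply: (regular_comp rf) => [z [Xz e]|j]; last by apply: regular_pfun; apply: pfun_lsubmx.
  split=> //; apply/negP => /eqP e0; move: e; rewrite e0 mul0r sub0r => /eqP.
  by rewrite oppr_eq0 oner_eq0.
have [k [A hA]] : exists k A, forall x : 'rV_n, ev h x != 0 ->
    ev h x ^+ k * ev F (row_mx x (ev h x)^-1%:M) = ev A x.
  suff : forall G, pfun G -> exists k A, forall x : 'rV_n, ev h x != 0 ->
    ev h x ^+ k * G (row_mx x (ev h x)^-1%:M) = ev A x by apply; apply: pfun_ev.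
  apply: pfun_ind.
  - by move=> f1 f2 e [k [A hA]]; exists k, A => x nx; rewrite -e hA.
  - by move=> c; exists 0, c%:MP => x _; rewrite mul1r /ev mevalC.
  - move=> i; case: (split_ordP i) => j ->.
      by exists 0, 'X_j => x _; rewrite mul1r row_mxEl /ev mevalXU.
    by exists 1, 1 => x nx; rewrite row_mxEr mxE (ord1 j) eqxx /ev meval1 expr1 mulfV.
  - move=> f1 f2 _ _ [k [A hA]] [l [B hB]]; exists (k + l)%N, (h ^+ l * A + h ^+ k * B) => x nx.
    rewrite /ev mevalD !mevalM !rmorphXn /= exprD mulrDr.
    by rewrite -[A.@[_]]/(ev A x) -[B.@[_]]/(ev B x) -hA // -hB // /ev; ring.
  - move=> f1 f2 _ _ [k [A hA]] [l [B hB]]; exists (k + l)%N, (A * B) => x nx.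
    by rewrite /ev !mevalM -[A.@[_]]/(ev A x) -[B.@[_]]/(ev B x) -hA // -hB // /ev exprD; ring.
exists k, A => x Xx nx; rewrite -hA //; congr (_ * _).
have := hF (row_mx x (ev h x)^-1%:M); rewrite row_mxKl; apply.
by rewrite /Y row_mxKl row_mxKr mxE eqxx mulfV // subrr.
Qed.

Definition dense_in n (X D : pset K n) :=
  forall P, (forall x, D x -> ev P x = 0) -> forall x, X x -> ev P x = 0.

Lemma dense_sub n (X D E : pset K n) : (forall x, D x -> E x) -> dense_in X D -> dense_in X E.
Proof. by move=> s h P hP; apply: h => x /s/hP. Qed.

Lemma dense_cr n (X D : pset K n) f g : (forall x, D x -> X x) -> dense_in X D ->
  coordinate_ring X f -> coordinate_ring X g ->
  (forall x, D x -> f x = g x) -> forall x, X x -> f x = g x.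
Proof.
move=> DX dD [P hP] [Q hQ] e x Xx; apply/eqP; rewrite -subr_eq0 hP // hQ //.
have := dD (P - Q); rewrite /ev => h; rewrite -mevalB h // => y Dy.
rewrite mevalB -[P.@[_]]/(ev P y) -[Q.@[_]]/(ev Q y).
by have Xy := DX y Dy; rewrite -(hP y Xy) -(hQ y Xy) (e y Dy) subrr.
Qed.

Lemma irreducible_dense n (X U : pset K n) : irreducible X -> open_in X U -> nonempty U ->
  dense_in X U.
Proof.
move=> [_ irr] oU [x Ux] P hP.
have [Q [nQ hQ]] := open_inner oU Ux.
have [|||h|h] := irr (fun x => ev P x = 0) (fun x => ev Q x = 0).
- exact/zariski_closed_pfun/pfun_ev.
- exact/zariski_closed_pfun/pfun_ev.
- by move=> y Xy; case: (eqVneq (ev Q y) 0) => [|/(hQ y Xy)/hP]; [right | left].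
- exact: h.
have Xx : X x by case: oU => Z [_ /(_ x)] [/(_ Ux)] [].
by have := h x Xx => /eqP; rewrite (negPf nQ).
Qed.

(** One variable at a time. *)
Lemma dense_pfun2 n (X D : pset K n) (f : 'rV[K]_n -> 'rV[K]_n -> K) : dense_in X D ->
  (forall x, pfun (f x)) -> (forall y, pfun (f^~ y)) ->
  (forall x y, D x -> D y -> f x y = 0) -> forall x y, X x -> X y -> f x y = 0.
Proof.
move=> dD p1 p2 e x y Xx Xy.
have [P hP] := p2 y; rewrite hP; apply: (dD P) Xx => x' Dx'; rewrite -hP.
have [Q hQ] := p1 x'; rewrite hQ; apply: (dD Q) Xy => y' Dy'; rewrite -hQ; exact: e.
Qed.

End Functions.

(** * The unit group of an affine monoid is a principal open set *)

Section LinearAlgebra.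
Variable K : fieldType.

Definition independent_on (Z : Type) (B : Z -> Prop) m (phi : 'I_m -> Z -> K) :=
  forall c : 'I_m -> K, (forall b, B b -> \sum_i c i * phi i b = 0) -> forall i, c i = 0.

(** Independent functions are separated by finite combinations of evaluations:
    the vectors of their values span the whole space of vectors. *)
Lemma independent_isolate (Z : Type) (B : Z -> Prop) m (phi : 'I_m -> Z -> K) i0 :
  independent_on B phi ->
  exists N (g : 'I_N -> K) (b : 'I_N -> Z),
    (forall k, B (b k)) /\ forall i, \sum_k g k * phi i (b k) = (i == i0)%:R.
Proof.
move=> ind.
pose M N (b : 'I_N -> Z) : 'M[K]_(N, m) := \matrix_(k, i) phi i (b k).
pose P r := exists N (b : 'I_N -> Z), (forall k, B (b k)) /\ \rank (M N b) = r.
have noZ : 'I_0 -> Z by case.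
have [||r [N [b [Bb rk]]] max] := @nat_greatest P m (\rank (M 0%N noZ)).
- by exists 0%N, noZ; split=> // -[].
- by move=> r [N [b [_ <-]]]; apply: rank_leq_col.
have full : cokermx (M N b) = 0.
  apply/matrixP => i j; rewrite [RHS]mxE; apply: (ind (fun i => cokermx (M N b) i j)) => z Bz.
  pose b' (k : 'I_(N + 1)) := match split k with inl k => b k | inr _ => z end.
  have eM : M _ b' = col_mx (M N b) (\row_i phi i z).
    apply/matrixP => k l; rewrite !mxE /b'; case: splitP => k' _; by rewrite !mxE.
  have le : (\row_i phi i z <= M N b)%MS.
    have s : (M N b <= M _ b')%MS by rewrite eM -addsmxE addsmxSl.
    have/eqmxP e : (M N b == M _ b')%MS.
      rewrite -mxrank_leqif_eq // eqn_leq mxrankS //= rk max //; exists (N + 1)%N, b'; split=> // k.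
      by rewrite /b'; case: (split k).
    by rewrite e eM -addsmxE addsmxSr.
  have : (\row_i phi i z) *m cokermx (M N b) = 0 by apply/eqP; rewrite -submxE.
  move/matrixP/(_ 0 j); rewrite [LHS]mxE [RHS]mxE => H; rewrite -[RHS]H; apply: eq_bigr => k _.
  by rewrite [X in _ = X * _]mxE mulrC.
have : (delta_mx 0 i0 : 'rV_m) *m cokermx (M N b) = 0 by rewrite full mulmx0.
move/eqP; rewrite -submxE => /submxP [D hD].
exists N, (fun k => D 0 k), b; split=> // i.
have := congr1 (fun v : 'rV_m => v 0 i) hD; rewrite !mxE eqxx /= => ->.
by apply: eq_bigr => k _; rewrite mxE.
Qed.

Lemma tall_dependent m k (M : 'M[K]_(m, k)) : (k < m)%N ->
  exists2 r : 'rV_m, r != 0 & r *m M = 0.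
Proof.
move=> lt; have : kermx M != 0.
  by rewrite -mxrank_eq0 mxrank_ker -lt0n subn_gt0; apply: leq_ltn_trans lt; apply: rank_leq_col.
case/rowV0Pn => r /sub_kermxP rM nz; by exists r.
Qed.

Definition finite_rank (Y Z : Type) (BY : Y -> Prop) (BZ : Z -> Prop) (F : Z -> Y -> K) :=
  exists s : seq ((Z -> K) * (Y -> K)),
    forall z y, BZ z -> BY y -> F z y = \sum_(p <- s) p.1 z * p.2 y.

(** A linear relation between the factors a i allows one to eliminate one of them. *)
Lemma decomposition_shrink (Y Z : Type) (BY : Y -> Prop) (BZ : Z -> Prop) (F : Z -> Y -> K)
    N (a : 'I_N -> Z -> K) (b : 'I_N -> Y -> K) :
  (forall z y, BZ z -> BY y -> F z y = \sum_i a i z * b i y) ->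
  independent_on BZ a \/
  exists N' (a' : 'I_N' -> Z -> K) (b' : 'I_N' -> Y -> K), (N' < N)%N /\
    forall z y, BZ z -> BY y -> F z y = \sum_i a' i z * b' i y.
Proof.
move=> dec; case: (classic (independent_on BZ a)) => [|dep]; [by left | right].
have [c [hc [i0 /eqP nz]]] : exists c : 'I_N -> K, (forall z, BZ z -> \sum_i c i * a i z = 0) /\
   exists i, c i <> 0.
  apply: NNPP => no; apply: dep => c hc i; apply: NNPP => nz; apply: no; exists c; split=> //.
  by exists i.
case: N a b dec dep c hc i0 nz => [|N] a b dec dep c hc i0 nz; first by case: i0 {nz}.
exists N, (fun j => a (lift i0 j)),
  (fun j y => b (lift i0 j) y - c (lift i0 j) / c i0 * b i0 y); split=> // z y Bz By.
rewrite dec // (bigD1_ord i0) //=.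
have := hc z Bz; rewrite (bigD1_ord i0) //= => /eqP; rewrite addr_eq0 => /eqP e.
have -> : a i0 z = - (\sum_(i < N) c (lift i0 i) * a (lift i0 i) z) / c i0.
  by rewrite -e mulrC mulKf.
rewrite !mulNr !mulr_suml -sumrN -big_split /=; apply: eq_bigr => i _.
by ring.
Qed.

(** In a shortest decomposition both families of factors are independent. *)
Lemma finite_rank_decomposition (Y Z : Type) (BY : Y -> Prop) (BZ : Z -> Prop) (F : Z -> Y -> K) :
  finite_rank BY BZ F ->
  exists N (a : 'I_N -> Z -> K) (b : 'I_N -> Y -> K),
    [/\ forall z y, BZ z -> BY y -> F z y = \sum_i a i z * b i y,
        independent_on BZ a & independent_on BY b].
Proof.
move=> [s hs].
pose P N := exists (a : 'I_N -> Z -> K) (b : 'I_N -> Y -> K),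
   forall z y, BZ z -> BY y -> F z y = \sum_i a i z * b i y.
have [|N [a [b dec]] min] := @nat_least P (size s).
  exists (fun i => (tnth (in_tuple s) i).1), (fun i => (tnth (in_tuple s) i).2) => z y Bz By.
  by rewrite hs // big_tnth.
exists N, a, b; split=> //.
  case: (decomposition_shrink dec) => // -[N' [a' [b' [lt h]]]].
  by have := min N' (ex_intro _ a' (ex_intro _ b' h)); rewrite leqNgt lt.
have dec' y z : BY y -> BZ z -> F z y = \sum_i b i y * a i z.
  by move=> By Bz; rewrite dec //; apply: eq_bigr => i _; rewrite mulrC.
case: (decomposition_shrink (F := fun y z => F z y) dec') => // -[N' [b' [a' [lt h]]]].
have /min : P N'; last by rewrite leqNgt lt.
by exists a', b' => z y Bz By; rewrite h //; apply: eq_bigr => i _; rewrite mulrC.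
Qed.

(** Sequences in the span of a finite family on which the shift acts by the matrix
    A, with inverse A'.  Such a sequence is determined by any of its tails. *)
Definition reversible (a : nat -> K) := exists (I : finType) (g : I -> nat -> K)
    (A A' : I -> I -> K) (u : I -> K),
  [/\ forall i k, g i k.+1 = \sum_j A i j * g j k,
      forall i k, g i k = \sum_j A' i j * g j k.+1
    & forall k, a k = \sum_i u i * g i k].

Lemma reversible_ext a b : a =1 b -> reversible a -> reversible b.
Proof.
move=> e [I [g [A [A' [u [h1 h2 h3]]]]]]; exists I, g, A, A', u; split=> // k.
by rewrite -e.
Qed.

Lemma reversible_const c : reversible (fun=> c).
Proof.
exists unit, (fun _ _ => 1), (fun _ _ => 1), (fun _ _ => 1), (fun=> c).
by split=> *; rewrite big_const card_unit /= addr0 mulr1.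
Qed.

Lemma reversibleD a b : reversible a -> reversible b -> reversible (fun k => a k + b k).
Proof.
move=> [I [g [A [A' [u [h1 h2 h3]]]]]] [J [h [B [B' [v [e1 e2 e3]]]]]].
exists (I + J)%type, (fun i => match i with inl i => g i | inr j => h j end),
  (fun i j => match i, j with inl i, inl j => A i j | inr i, inr j => B i j | _, _ => 0 end),
  (fun i j => match i, j with inl i, inl j => A' i j | inr i, inr j => B' i j | _, _ => 0 end),
  (fun i => match i with inl i => u i | inr j => v j end).
have z0 (T : finType) (f : T -> K) : \sum_(i : T) 0 * f i = 0 by apply: big1 => i _; rewrite mul0r.
split=> [[i|j] k|[i|j] k|k]; rewrite big_sumType /=.
- by rewrite z0 addr0.
- by rewrite z0 add0r.
- by rewrite z0 addr0.
- by rewrite z0 add0r.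
- by rewrite h3 e3.
Qed.

Lemma reversibleM a b : reversible a -> reversible b -> reversible (fun k => a k * b k).
Proof.
move=> [I [g [A [A' [u [h1 h2 h3]]]]]] [J [h [B [B' [v [e1 e2 e3]]]]]].
exists (I * J)%type, (fun i k => g i.1 k * h i.2 k),
  (fun i j => A i.1 j.1 * B i.2 j.2), (fun i j => A' i.1 j.1 * B' i.2 j.2),
  (fun i => u i.1 * v i.2).
have dist (x y : I -> K) (z w : J -> K) :
   (\sum_i x i * y i) * (\sum_j z j * w j) = \sum_(p : I * J) x p.1 * z p.2 * (y p.1 * w p.2).
  rewrite big_distrlr pair_big /=; apply: eq_bigr => p _; ring.
split=> [i k|i k|k] /=.
- by rewrite h1 e1 -(dist (A i.1) (g^~ k) (B i.2) (h^~ k)).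
- by rewrite h2 e2 -(dist (A' i.1) (g^~ k.+1) (B' i.2) (h^~ k.+1)).
- by rewrite h3 e3 -(dist u (g^~ k) v (h^~ k)).
Qed.

(** Among the first #|I| + 1 vectors of values of the family there is a relation;
    shifted back so that its first term is the value at 0, it expresses a 0 by the
    values a k with k > 0. *)
Lemma reversible_tail a : reversible a -> (forall k, a k.+1 = 0) -> a 0%N = 0.
Proof.
move=> [I [g [A [A' [u [h1 h2 h3]]]]]] a0.
have [q nz qM] := tall_dependent (\matrix_(k < #|I|.+1, i < #|I|) g (enum_val i) k) (ltnSn _).
have rel i : \sum_(k < #|I|.+1) q 0 k * g i k = 0.
  have := congr1 (fun v : 'rV_#|I| => v 0 (enum_rank i)) qM; rewrite !mxE => H; rewrite -[RHS]H.
  by apply: eq_bigr => k _; rewrite mxE enum_rankK.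
have [s0 nzs] : exists i, q 0 i != 0.
  apply/existsP; apply: contraNT nz; rewrite negb_exists => /forallP z.
  by apply/eqP/rowP => i; rewrite mxE; apply/eqP; rewrite -[_ == _]negbK.
have [s /andP[ns _] min] := @arg_minnP _ s0 (fun i => (q 0 i != 0) && true) val (introT andP (conj nzs isT)).
have below (k : 'I_#|I|.+1) : (k < s)%N -> q 0 k = 0.
  by move=> lt; apply/eqP; apply: contraTT lt => n; rewrite -leqNgt min // n.
have shifted j : (j <= s)%N -> forall i, \sum_(k < #|I|.+1 | (s <= k)%N) q 0 k * g i (k - j)%N = 0.
  elim: j => [|j IH] le i.
    rewrite -[RHS](rel i) big_mkcond; apply: eq_bigr => k _; rewrite subn0.
    by case: leqP => // /below ->; rewrite mul0r.
  have -> : \sum_(k < #|I|.+1 | (s <= k)%N) q 0 k * g i (k - j.+1)%N =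
      \sum_l A' i l * \sum_(k < #|I|.+1 | (s <= k)%N) q 0 k * g l (k - j)%N.
    under [RHS]eq_bigr => l _ do rewrite mulr_sumr.
    rewrite exchange_big /=; apply: eq_bigr => k sk; rewrite (h2 i) mulr_sumr; apply: eq_bigr => l _.
    by rewrite subnSK; [rewrite mulrCA | apply: leq_trans sk].
  by apply: big1 => l _; rewrite IH ?mulr0 // ltnW.
have : \sum_(k < #|I|.+1 | (s <= k)%N) q 0 k * a (k - s)%N = 0.
  under eq_bigr => k _ do rewrite h3 mulr_sumr.
  rewrite exchange_big /= big1 // => i _.
  have := congr1 (fun z => u i * z) (shifted s (leqnn _) i); rewrite mulr0 mulr_sumr => H; rewrite -[RHS]H.
  by apply: eq_bigr => k _; rewrite mulrCA.
rewrite (bigD1 s) //= subnn big1 => [|k /andP[sk ks]].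
  by move/eqP; rewrite addr0 mulf_eq0 (negPf ns) => /eqP.
have lt : (s < k)%N by rewrite ltn_neqAle eq_sym ks.
by rewrite -(subnSK lt) a0 mulr0.
Qed.
End LinearAlgebra.

Section Units.
Variables (K : closedFieldType) (n : nat) (X : pset K n).
Variables (mu : 'rV[K]_n -> 'rV[K]_n -> 'rV[K]_n) (e : 'rV[K]_n).
Hypotheses (cX : zariski_closed X) (mon : comm_monoid X mu e).

Lemma mu_closed x y : X x -> X y -> X (mu x y).
Proof.
move=> Xx Xy; have := (mon_morph mon).1 (row_mx x y).
by rewrite row_mxKl row_mxKr; apply; rewrite /prod_var row_mxKl row_mxKr.
Qed.

Lemma mu_poly j : exists P, forall x y, X x -> X y -> mu x y 0 j = ev P (row_mx x y).
Proof.
have [P hP] := regular_closed (zariski_closed_prod cX cX) ((mon_morph mon).2 j).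
exists P => x y Xx Xy; rewrite -hP ?row_mxKl ?row_mxKr //.
by rewrite /prod_var row_mxKl row_mxKr.
Qed.

Lemma pfun_row_mxl y : forall j, pfun (fun x : 'rV[K]_n => (row_mx x y : 'rV_(n + n)) 0 j).
Proof.
move=> j; case: (split_ordP j) => i ->.
  by apply: (pfun_ext _ (pfun_coord K i)) => x; rewrite row_mxEl.
by apply: (pfun_ext _ (pfun_const _ (y 0 i))) => x; rewrite row_mxEr.
Qed.

Lemma pfun_row_mxr x : forall j, pfun (fun y : 'rV[K]_n => (row_mx x y : 'rV_(n + n)) 0 j).
Proof.
move=> j; case: (split_ordP j) => i ->.
  by apply: (pfun_ext _ (pfun_const _ (x 0 i))) => y; rewrite row_mxEl.
by apply: (pfun_ext _ (pfun_coord K i)) => y; rewrite row_mxEr.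
Qed.

Lemma mu_cr_l y j : X y -> coordinate_ring X (fun x => mu x y 0 j).
Proof.
move=> Xy; have [P hP] := mu_poly j.
apply: (@coordinate_ring_ext _ _ _ (fun x => ev P (row_mx x y))); first by move=> x Xx; rewrite hP.
by apply/coordinate_ring_pfun/(pfun_comp (pfun_ev P))/pfun_row_mxl.
Qed.

Lemma mu_cr_r x j : X x -> coordinate_ring X (fun y => mu x y 0 j).
Proof.
move=> Xx; have [P hP] := mu_poly j.
apply: (@coordinate_ring_ext _ _ _ (fun y => ev P (row_mx x y))); first by move=> y Xy; rewrite hP.
by apply/coordinate_ring_pfun/(pfun_comp (pfun_ev P))/pfun_row_mxr.
Qed.

(** A polynomial in two points is a finite sum of products. *)
Lemma mu_finite_rank : finite_rank (fun p : 'rV[K]_n * 'I_n => X p.1) X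
   (fun x p => mu x p.1 0 p.2).
Proof.
have fr (G : 'rV[K]_(n + n) -> K) : pfun G -> exists s : seq (('rV[K]_n -> K) * ('rV[K]_n -> K)),
    forall x y, G (row_mx x y) = \sum_(p <- s) p.1 x * p.2 y.
  move: G; apply: pfun_ind.
  - by move=> f g fg [s hs]; exists s => x y; rewrite -fg.
  - by move=> c; exists [:: (fun=> c, fun=> 1)] => x y; rewrite big_seq1 mulr1.
  - move=> j; case: (split_ordP j) => i ->.
      by exists [:: (fun x : 'rV_n => x 0 i, fun=> 1)] => x y; rewrite row_mxEl big_seq1 mulr1.
    by exists [:: (fun=> 1, fun x : 'rV_n => x 0 i)] => x y; rewrite row_mxEr big_seq1 mul1r.
  - by move=> f g _ _ [s hs] [t ht]; exists (s ++ t) => x y; rewrite big_cat hs ht.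
  - move=> f g _ _ [s hs] [t ht].
    exists [seq (fun x => p.1 x * q.1 x, fun y => p.2 y * q.2 y) | p <- s, q <- t] => x y.
    rewrite hs ht big_allpairs_dep mulr_suml; apply: eq_bigr => p _; rewrite mulr_sumr.
    by apply: eq_bigr => q _ /=; ring.
have part j : exists s : seq (('rV[K]_n -> K) * ('rV[K]_n -> K)),
    forall x y, X x -> X y -> mu x y 0 j = \sum_(p <- s) p.1 x * p.2 y.
  have [P hP] := mu_poly j; have [s hs] := fr _ (pfun_ev P); exists s => x y Xx Xy.
  by rewrite hP // hs.
have /fin_all_exists [s hs] := part.
exists (flatten [seq [seq (p.1, fun q : 'rV[K]_n * 'I_n => (q.2 == j)%:R * p.2 q.1) | p <- s j]
   | j <- enum 'I_n]) => x [y j] Xx Xy /=.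
rewrite big_flatten big_map big_enum (bigD1 j) //= big_map /= hs // [X in _ + X]big1 ?addr0.
  by apply: eq_bigr => p _; rewrite eqxx mul1r.
move=> i ij; rewrite big_map big1 // => p _ /=.
by rewrite eq_sym (negPf ij) mul0r mulr0.
Qed.

(** The functions f come from a shortest decomposition of mu as a sum of products;
    they span the translates of the coordinates, and rho y is the matrix of the
    translation by y. *)
Lemma translation_representation : exists m (f : 'I_m -> {mpoly K[n]})
    (R : 'M[{mpoly K[n]}]_m) (r : 'M[K]_(m, n)),
  let fv x : 'rV_m := \row_k ev (f k) x in
  let rho y : 'M_m := \matrix_(k, l) ev (R k l) y in
  [/\ independent_on X (fun k => ev (f k)),
      forall x y, X x -> X y -> fv (mu x y) = fv x *m rho y
    & forall x, X x -> x = fv x *m r].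
Proof.
have [m [a [b [dec ia ib]]]] := finite_rank_decomposition mu_finite_rank.
have Da k := independent_isolate k ib.
have Db k := independent_isolate k ia.
have a_eq k : exists N (g : 'I_N -> K) (q : 'I_N -> 'rV[K]_n * 'I_n),
    (forall i, X (q i).1) /\ forall x, X x -> a k x = \sum_i g i * mu x (q i).1 0 (q i).2.
  have [N [g [q [Xq h]]]] := Da k; exists N, g, q; split=> // x Xx.
  under eq_bigr => i _ do rewrite (dec x (q i) Xx (Xq i)) mulr_sumr.
  rewrite exchange_big /= (bigD1 k) //= [X in _ + X]big1 ?addr0 => [|l lk].
    under eq_bigr => i _ do rewrite mulrCA.
    by rewrite -mulr_sumr h eqxx mulr1.
  under eq_bigr => i _ do rewrite mulrCA.
  by rewrite -mulr_sumr h (negPf lk) mulr0.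
have b_eq k : exists N (g : 'I_N -> K) (z : 'I_N -> 'rV[K]_n),
    (forall i, X (z i)) /\ forall y j, X y -> b k (y, j) = \sum_i g i * mu (z i) y 0 j.
  have [N [g [z [Xz h]]]] := Db k; exists N, g, z; split=> // y j Xy.
  under eq_bigr => i _ do rewrite (dec (z i) (y, j) (Xz i) Xy) mulr_sumr.
  rewrite exchange_big /= (bigD1 k) //= [X in _ + X]big1 ?addr0 => [|l lk].
    under eq_bigr => i _ do rewrite mulrA.
    by rewrite -mulr_suml h eqxx mul1r.
  under eq_bigr => i _ do rewrite mulrA.
  by rewrite -mulr_suml h (negPf lk) mul0r.
have cr_sum N (g : 'I_N -> K) (F : 'I_N -> 'rV[K]_n -> K) :
    (forall i, coordinate_ring X (F i)) -> coordinate_ring X (fun x => \sum_i g i * F i x).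
  move=> h; have /fin_all_exists [P hP] := h.
  exists (\sum_i (g i)%:MP * P i) => x Xx; rewrite /ev raddf_sum /=; apply: eq_bigr => i _.
  by rewrite mevalM mevalC hP.
have /fin_all_exists [f hf] k : coordinate_ring X (a k).
  have [N [g [q [Xq h]]]] := a_eq k.
  apply: (@coordinate_ring_ext _ _ _ _ _ (fun x Xx => esym (h x Xx))).
  by apply: (cr_sum) => i; apply: mu_cr_l.
have rho_ex k : exists R : 'I_m -> {mpoly K[n]}, forall x y, X x -> X y ->
    a k (mu x y) = \sum_l a l x * ev (R l) y.
  have [N [g [q [Xq h]]]] := a_eq k.
  have /fin_all_exists [R hR] l : coordinate_ring X (fun y => \sum_i g i * b l (mu y (q i).1, (q i).2)).
    apply: (cr_sum) => i; have [N' [g' [z [Xz h']]]] := b_eq l.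
    apply: (@coordinate_ring_ext _ _ _ (fun y => \sum_i0 g' i0 * mu (z i0) (mu y (q i).1) 0 (q i).2)).
      by move=> y Xy; rewrite h' //; apply: mu_closed.
    apply: (cr_sum) => i'; apply: (coordinate_ring_comp (Y := X) (f := fun y => mu (z i') y 0 (q i).2)).
    - exact: mu_cr_r.
    - by move=> y Xy; apply: mu_closed.
    - by move=> j; apply: mu_cr_l.
  exists R => x y Xx Xy; rewrite h; last exact: mu_closed.
  under [RHS]eq_bigr => l _ do rewrite -hR // mulr_sumr.
  rewrite exchange_big /=; apply: eq_bigr => i _.
  rewrite -(mon_assoc mon) // (dec x (mu y (q i).1, (q i).2) Xx) /=; last exact: mu_closed.
  by rewrite mulr_sumr; apply: eq_bigr => l _; rewrite mulrCA.
have /fin_all_exists [R hR] := rho_ex.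
exists m, f, (\matrix_(l, k) R k l), (\matrix_(k, j) b k (e, j)); split.
- move=> c hc; apply: ia => x Xx; rewrite -[RHS](hc x Xx); apply: eq_bigr => k _.
  by rewrite hf.
- move=> x y Xx Xy; apply/rowP => k; rewrite !mxE -hf; last exact: mu_closed.
  by rewrite hR //; apply: eq_bigr => l _; rewrite !mxE hf.
- move=> x Xx; apply/rowP => j; rewrite !mxE -{1}(mon_unitr mon Xx).
  rewrite (dec x (e, j) Xx (mon_unit mon)); apply: eq_bigr => k _.
  by rewrite !mxE hf.
Qed.

(** The function is the determinant of rho.  If rho y is invertible, the vectors
    fv e *m rho y ^ k, k >= 0, are the values of f at the powers of y.  A
    polynomial relation valid on the values of f therefore holds for k >= 0, and
    by reversible_tail for k = - 1 too, so that there is a point of X with the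
    values fv e *m invmx (rho y): it is the inverse of y. *)
Theorem units_principal : exists d, forall x, X x -> (invertibles X mu e x <-> ev d x != 0).
Proof.
have [m [f [R [r /= [ind hom coords]]]]] := translation_representation.
pose fv x : 'rV_m := \row_k ev (f k) x; pose rho y : 'M_m := \matrix_(k, l) ev (R k l) y.
have det_ev y : ev (\det R) y = \det (rho y).
  rewrite /ev -det_map_mx; congr (\det _); apply/matrixP => i j; by rewrite !mxE.
exists (\det R) => y Xy; rewrite det_ev; split.
  move=> [_ [z [Xz yz _]]].
  have : rho y *m rho z = 1%:M.
    have rows (A : 'M[K]_m) : (forall x, X x -> fv x *m A = 0) -> A = 0.
      move=> h; apply/matrixP => i j; rewrite mxE; apply: (ind (fun i => A i j)) => x Xx.
      have := congr1 (fun v : 'rV_m => v 0 j) (h x Xx); rewrite !mxE => H; rewrite -[RHS]H.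
      by apply: eq_bigr => k _; rewrite mxE mulrC.
    apply/eqP; rewrite -subr_eq0; apply/eqP/rows => x Xx.
    rewrite mulmxBr mulmx1 mulmxA -/(fv x) -hom // -hom //; last exact: mu_closed.
    by rewrite -(mon_assoc mon) // yz (mon_unitr mon) // subrr.
  by case/mulmx1_unit; rewrite unitmxE unitfE.
rewrite -unitfE -unitmxE => un.
pose v := fv e *m invmx (rho y).
have pow k : exists2 x, X x & iter k.+1 (mulmxr (rho y)) v = fv x.
  elim: k => [|k [x Xx e1]]; first by exists e; [exact: mon_unit mon | rewrite /= mulmxKV].
  by exists (mu x y); [exact: mu_closed | rewrite iterS e1 /= -hom].
have rel Q : pfun Q -> (forall x, X x -> Q (fv x) = 0) -> Q v = 0.
  move=> pQ hQ; apply: (@reversible_tail _ (fun k => Q (iter k (mulmxr (rho y)) v))); last first.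
    by move=> k; have [x Xx ->] := pow k; apply: hQ.
  move: pQ {hQ}; move: Q; apply: pfun_ind.
  - by move=> g h gh; apply: reversible_ext => k.
  - exact: reversible_const.
  - move=> i; exists 'I_m, (fun i k => iter k (mulmxr (rho y)) v 0 i), (fun i j => rho y j i),
      (fun i j => invmx (rho y) j i), (fun j => (j == i)%:R); split=> [j k|j k|k].
    + by rewrite iterS mxE; apply: eq_bigr => l _; rewrite mulrC.
    + rewrite -[in LHS](mulmxK un (iter k _ v)) mxE; apply: eq_bigr => l _.
      by rewrite mulrC iterS.
    + by rewrite (bigD1 i) //= eqxx mul1r big1 ?addr0 // => j /negPf ->; rewrite mul0r.
  - by move=> g h _ _; apply: reversibleD.
  - by move=> g h _ _; apply: reversibleM.
have p_r j : pfun (fun w : 'rV[K]_m => (w *m r) 0 j).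
  apply: (@pfun_ext _ _ (fun w : 'rV_m => \sum_k w 0 k * r k j)); first by move=> w; rewrite mxE.
  by apply: pfun_sum => k; apply: pfunM (pfun_coord K k) (pfun_const _ _).
pose z := v *m r.
have Xz : X z.
  have [S hS] := cX; apply/hS => P SP; apply: (rel (fun w => ev P (w *m r))).
    exact: pfun_comp (pfun_ev P) p_r.
  by move=> x Xx; rewrite -coords //; apply: (proj1 (hS x) Xx).
have fz : fv z = v.
  apply/rowP => k; apply/eqP; rewrite -subr_eq0; apply/eqP.
  rewrite mxE; apply: (rel (fun w => ev (f k) (w *m r) - w 0 k)).
    by apply: pfunB (pfun_coord K k); apply: pfun_comp (pfun_ev _) p_r.
  by move=> x Xx; rewrite -coords // mxE subrr.
have zy : mu z y = e.
  rewrite (coords _ (mu_closed Xz Xy)) (coords _ (mon_unit mon)); congr (_ *m r).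
  have -> : \row_k ev (f k) (mu z y) = fv z *m rho y by apply: hom.
  by rewrite fz mulmxKV.
by split=> //; exists z; split=> //; rewrite (mon_comm mon).
Qed.
End Units.

(** * The rank and the dimension of the unit group *)

Section AlgebraicDependence.
Variable K : fieldType.

Lemma small_polys_dependent (I : finType) N (q : I -> {poly K}) :
  (forall i, size (q i) <= N)%N -> (N < #|I|)%N ->
  exists c : I -> K, (exists i, c i != 0) /\ \sum_i c i *: q i = 0.
Proof.
move=> sz lt; pose M : 'M[K]_(#|I|, N) := \matrix_(i, k) (q (enum_val i))`_k.
have : kermx M != 0.
  by rewrite -mxrank_eq0 mxrank_ker -lt0n subn_gt0; apply: leq_ltn_trans lt; apply: rank_leq_col.
case/rowV0Pn => c /sub_kermxP cM nz.
exists (fun i => c 0 (enum_rank i)); split.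
  apply/existsP; apply: contraNT nz; rewrite negb_exists => /forallP z.
  by apply/eqP/rowP => i; rewrite mxE -(enum_valK i); apply/eqP; rewrite -[_ == _]negbK.
apply/polyP => k; rewrite coef0 coef_sum.
case: (ltnP k N) => [ltk|le]; last first.
  by apply: big1 => i _; rewrite coefZ nth_default ?mulr0 //; apply: leq_trans le.
have := congr1 (fun v : 'rV_N => v 0 (Ordinal ltk)) cM; rewrite !mxE => H; rewrite -[RHS]H.
rewrite (reindex _ (onW_bij _ (@enum_val_bij I))) /=.
by apply: eq_bigr => i _; rewrite coefZ !mxE enum_valK.
Qed.

(** Two rational functions a1 / b, a2 / b of one variable are algebraically
    dependent: there are (D + 1)^2 products of powers up to D, and their numerators
    have a degree at most proportional to D. *)
Lemma rational_pair_dependent (a1 a2 b : {poly K}) : exists D (c : 'I_D.+1 * 'I_D.+1 -> K),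
  (exists i, c i != 0) /\ 
  \sum_i c i *: (a1 ^+ i.1 * a2 ^+ i.2 * b ^+ ((D - i.1) + (D - i.2))) = 0.
Proof.
pose s := ((size a1) + (size a2) + (size b)).+1; pose D := (2 * s)%N.
exists D; apply: (@small_polys_dependent _ (s * (2 * D)).+1) => [[i j]|]; last first.
  have E : ((2 * s).+1 * (2 * s).+1 = s * (2 * (2 * s)) + 4 * s + 1)%N by ring.
  rewrite card_prod !card_ord /D E; have : (0 < s)%N by []. lia.
have szX (p : {poly K}) k : (size p <= s)%N -> (size (p ^+ k) <= (s * k).+1)%N.
  move=> le; apply: leq_trans (size_poly_exp_leq _ _) _; rewrite ltnS leq_mul2r; apply/orP; right.
  by apply: leq_trans le; apply: leq_pred.
have h1 := @szX a1 i ltac:(rewrite /s; lia); have h2 := @szX a2 j ltac:(rewrite /s; lia).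
have h3 := @szX b ((D - i) + (D - j))%N ltac:(rewrite /s; lia).
apply: leq_trans (size_polyMleq _ _) _ => /=.
have h4 := size_polyMleq (a1 ^+ i) (a2 ^+ j).
have E : (s * (2 * D) = s * i + s * j + s * ((D - i) + (D - j)))%N.
  by rewrite -!mulnDr; congr (_ * _)%N; have := ltn_ord i; have := ltn_ord j; clear; lia.
rewrite E; move: h1 h2 h3 h4.
move: (size (a1 ^+ i * a2 ^+ j)%R) (size (a1 ^+ i)%R) (size (a2 ^+ j)%R) (size (b ^+ _)%R).
move: (s * i)%N (s * j)%N (s * _)%N; clear; lia.
Qed.
End AlgebraicDependence.

Section Rank.
Variables (K : closedFieldType) (n : nat) (X : pset K n).
Variables (mu : 'rV[K]_n -> 'rV[K]_n -> 'rV[K]_n) (e : 'rV[K]_n) (r s : nat).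
Variables (phi : 'rV[K]_(r + s) -> 'rV[K]_n) (psi : 'rV[K]_n -> 'rV[K]_(r + s)).
Hypotheses (affX : affine_variety X) (mon : comm_monoid X mu e).
Hypothesis iso : isomorphism (@GmGa K r s) (invertibles X mu e) phi psi.
Hypothesis hom : forall x y, GmGa x -> GmGa y -> phi (GmGa_mul x y) = mu (phi x) (phi y).

Definition torus_coords : {mpoly K[r + s]} := \prod_(i < r) 'X_(lshift s i).

Lemma GmGaE (g : 'rV[K]_(r + s)) : GmGa g <-> ev torus_coords g != 0.
Proof.
rewrite /ev rmorph_prod /=; split=> [[h _]|].
  by apply/prodf_neq0 => i _; rewrite mevalXU; have := h i; rewrite mxE.
by move/prodf_neq0 => h; split=> // i; have := h i isT; rewrite mevalXU mxE.
Qed.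

Definition GmGa_one : 'rV[K]_(r + s) := row_mx (const_mx 1) 0.

Lemma GmGa1 : GmGa GmGa_one.
Proof. by split=> // i; rewrite row_mxKl mxE oner_neq0. Qed.

Lemma GmGa_mul1 g : GmGa_mul GmGa_one g = g :> 'rV[K]_(r + s).
Proof.
rewrite /GmGa_mul row_mxKl row_mxKr add0r -[RHS]hsubmxK; congr row_mx.
by apply/rowP => i; rewrite !mxE mul1r.
Qed.

Lemma phi_unit g : GmGa g -> invertibles X mu e (phi g).
Proof. exact: (iso_morph iso).1. Qed.

Lemma invertible_unit : invertibles X mu e e.
Proof.
have Xe := mon_unit mon.
by split=> //; exists e; rewrite (mon_unitl mon).
Qed.

Lemma phi1 : phi GmGa_one = e.
Proof.
have := hom GmGa1 GmGa1; rewrite GmGa_mul1.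
have [X1 [y [Xy _ yp]]] := phi_unit GmGa1.
by move/(congr1 (mu y)); rewrite (mon_assoc mon) // yp (mon_unitl mon).
Qed.

Lemma psi_unit x : invertibles X mu e x -> GmGa (psi x).
Proof. exact: (iso_inv_morph iso).1. Qed.

Lemma units_open : open_in X (invertibles X mu e).
Proof.
have [d hd] := units_principal affX.1 mon.
apply: (open_ext _ (open_principal X d)) => x; split; first by case=> Xx; rewrite hd.
by move=> u; have := u; case=> Xx _; rewrite -hd.
Qed.

Lemma units_dense : dense_in X (invertibles X mu e).
Proof. by apply: (irreducible_dense affX.2 units_open); exists e; apply: invertible_unit. Qed.

Lemma phi_pull P : exists k A, forall g, GmGa g ->
  ev torus_coords g ^+ k * ev P (phi g) = ev A g.
Proof.
have [|k [A h]] := @regular_on_principal K _ (@affine_space K _) torus_coords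
  (fun g => ev P (phi g)) (zariski_closed_affine K _).
  apply: (@regular_sub _ _ (@GmGa K r s)) => [g [_ /GmGaE]//|].
  apply: (regular_comp (V := invertibles X mu e)) => [|g Gg|j].
  - by apply: regular_pfun; apply: pfun_ev.
  - exact: phi_unit.
  - exact: (iso_morph iso).2.
by exists k, A => g /GmGaE Gg; apply: h.
Qed.

Lemma psi_pull d : (forall x, X x -> (invertibles X mu e x <-> ev d x != 0)) ->
  forall j, exists k A, forall x, invertibles X mu e x -> ev d x ^+ k * psi x 0 j = ev A x.
Proof.
move=> hd j; have [|k [A h]] := @regular_on_principal _ _ _ d (fun x => psi x 0 j) affX.1.
  by apply: regular_sub ((iso_inv_morph iso).2 j) => x [Xx dx]; rewrite hd.
by exists k, A => x ux; apply: h; [case: ux | rewrite -hd //; case: ux].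
Qed.

(** The coordinates of psi are algebraically independent functions on the units. *)
Lemma rank_lt d : ~ has_alg_independent X d -> (r + s < d)%N.
Proof.
move=> no; rewrite ltnNge; apply/negP => le; apply: no.
exists (invertibles X mu e), (fun i x => psi x 0 (widen_ord le i)); split.
- exact: units_open.
- by exists e; apply: invertible_unit.
- by move=> i; apply: (iso_inv_morph iso).2.
move=> P hP; apply/eqP; apply: contraT => nzP.
have nzX : \prod_(i < d) 'X_i != 0 :> {mpoly K[d]}.
  apply/prodf_neq0 => i _; apply/eqP => /(congr1 (mcoeff U_(i))).
  by rewrite mcoeffXU eqxx mcoeff0 => /eqP; rewrite oner_eq0.
have [v [Pv Xv]] := mpoly_nonzero_point2 nzP nzX.
pose g : 'rV[K]_(r + s) := \row_j if insub (val j) is Some i then v 0 i else 1.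
have gj i : g 0 (widen_ord le i) = v 0 i by rewrite mxE valK.
have Gg : GmGa g.
  split=> // i; rewrite !mxE; case: insubP => [j _ _|_]; last exact: oner_neq0.
  by move: Xv; rewrite /ev rmorph_prod => /prodf_neq0 /(_ j isT); rewrite /= mevalXU.
have := hP _ (phi_unit Gg).
rewrite (@meval_eq _ _ _ (fun i => v 0 i)) => [/eqP|i]; first by rewrite -/(ev P v) (negPf Pv).
by rewrite (iso_cancel iso).
Qed.

Lemma regular_local U f x : open_in X U -> regular_on U f -> U x ->
  exists A B, ev B x != 0 /\ forall y, X y -> ev B y != 0 -> U y /\ f y = ev A y / ev B y.
Proof.
move=> oU /regularP rf Ux; have [C [nC hC]] := open_inner oU Ux.
have [A [B [nB hAB]]] := rf x Ux.
exists (A * C), (B * C); rewrite /ev !mevalM mulf_neq0 //; split=> // y Xy.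
rewrite !mevalM mulf_eq0 negb_or => /andP[nBy nCy]; have Uy := hC y Xy nCy; split=> //.
by rewrite hAB // -mulf_div divff // mulr1.
Qed.

(** The identity principle: a regular function is zero if it is so on a nonempty
    principal open set. *)
Lemma regular_eq0 U f B : open_in X U -> regular_on U f -> (exists2 x, X x & ev B x != 0) ->
  (forall x, U x -> ev B x != 0 -> f x = 0) -> forall x, U x -> f x = 0.
Proof.
move=> oU rf [x0 Xx0 nB] h x Ux.
have [A [C [nC hC]]] := regular_local oU rf Ux.
have Xx : X x by case: oU => Z [_ /(_ x)] [/(_ Ux)] [].
have [Uy ->] := hC x Xx nC; suff : ev (A * C) x = 0.
  by rewrite /ev mevalM => /eqP; rewrite mulf_eq0 -/(ev C x) (negPf nC) orbF => /eqP ->; rewrite mul0r.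
apply: (irreducible_dense affX.2 (open_principal X B)) => //; first by exists x0.
move=> y [Xy nBy]; rewrite /ev mevalM.
case: (eqVneq (ev C y) 0) => [|nCy]; first by rewrite /ev => ->; rewrite mulr0.
have [Uy' e1] := hC y Xy nCy; have := h y Uy' nBy; rewrite e1 => /eqP.
by rewrite mulf_eq0 invr_eq0 (negPf nCy) orbF /ev => /eqP ->; rewrite mul0r.
Qed.

Lemma GmGa_line : (r + s <= 1)%N -> exists l : 'rV[K]_(r + s) -> K,
  forall A : {mpoly K[r + s]}, exists a : {poly K}, forall g, ev A g = a.[l g].
Proof.
move=> le; exists (fun g => \sum_i g 0 i) => A.
move: (pfun_ev A); move: (ev A); apply: pfun_ind.
- by move=> f h fh [a ha]; exists a => g; rewrite -fh.
- by move=> c; exists c%:P => g; rewrite hornerC.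
- move=> i; exists 'X => g; rewrite hornerX (bigD1 i) //= big1 ?addr0 // => j ij.
  by case/negP: ij; apply/eqP/val_inj => /=; have := ltn_ord i; have := ltn_ord j; lia.
- by move=> f h _ _ [a ha] [b hb]; exists (a + b) => g; rewrite hornerD ha hb.
- by move=> f h _ _ [a ha] [b hb]; exists (a * b) => g; rewrite hornerM ha hb.
Qed.

(** If r + s <= 1 the pull-backs of all functions to the group are rational in one
    variable, so any two are dependent. *)
Lemma rank_gt1 : has_alg_independent X 2 -> (1 < r + s)%N.
Proof.
move=> [U [f [oU [x0 Ux0] rf ind]]]; rewrite ltnNge; apply/negP => le1.
have [l hl] := GmGa_line le1.
have [A1 [B1 [nB1 h1]]] := regular_local oU (rf 0) Ux0.
have [A2 [B2 [nB2 h2]]] := regular_local oU (rf 1) Ux0.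
have Xx0 : X x0 by case: oU => Z [_ /(_ x0)] [/(_ Ux0)] [].
have pull P : exists k a, forall g, GmGa g -> ev torus_coords g ^+ k * ev P (phi g) = a.[l g].
  by have [k [A hA]] := phi_pull P; have [a ha] := hl A; exists k, a => g Gg; rewrite hA.
pose B := B1 * B2; pose F1 := A1 * B2; pose F2 := A2 * B1.
have nB : ev B x0 != 0 by rewrite /ev mevalM mulf_neq0.
have hB y : X y -> ev B y != 0 -> [/\ U y, f 0 y = ev F1 y / ev B y & f 1 y = ev F2 y / ev B y].
  move=> Xy; rewrite /ev !mevalM mulf_eq0 negb_or => /andP[n1 n2].
  have [Uy ->] := h1 y Xy n1; have [_ ->] := h2 y Xy n2; split=> //.
    by rewrite -mulf_div divff // mulr1.
  by rewrite [B1.@[_] * _]mulrC -mulf_div divff // mulr1.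
clearbody B F1 F2.
have [k1 [a1 e1]] := pull F1; have [k2 [a2 e2]] := pull F2; have [k3 [b e3]] := pull B.
have [N [b' [a1' [a2' hh]]]] : exists N b' a1' a2', forall g, GmGa g ->
    [/\ ev torus_coords g ^+ N * ev B (phi g) = b'.[l g],
        ev torus_coords g ^+ N * ev F1 (phi g) = a1'.[l g]
      & ev torus_coords g ^+ N * ev F2 (phi g) = a2'.[l g]].
  have [t ht] := hl torus_coords.
  exists (k1 + k2 + k3)%N, (t ^+ (k1 + k2) * b), (t ^+ (k2 + k3) * a1), (t ^+ (k1 + k3) * a2) => g Gg.
  by split; rewrite hornerM horner_exp -ht -?e1 -?e2 -?e3 // !exprD; ring.
(* In b', a1', a2' the powers of the torus coordinates have been made equal. *)
have [D [c [[i0 nc] dep]]] := rational_pair_dependent a1' a2' b'.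
pose H := \sum_i c i *: (F1 ^+ i.1 * F2 ^+ i.2 * B ^+ ((D - i.1) + (D - i.2))).
have H0 x : X x -> ev H x = 0.
  apply: units_dense => {}x ux; rewrite -(iso_inv_cancel iso ux).
  have Gg := psi_unit ux; set g := psi x in Gg *; have [q1 q2 q3] := hh g Gg.
  have nt : ev torus_coords g != 0 by apply/GmGaE.
  apply: (mulfI (expf_neq0 (N * (2 * D)) nt)); rewrite mulr0.
  have := congr1 (horner^~ (l g)) dep; rewrite horner0 horner_sum => E; rewrite -[RHS]E /ev.
  rewrite raddf_sum mulr_sumr /=; apply: eq_bigr => i _.
  have le (j : 'I_D.+1) : (j <= D)%N by rewrite -ltnS.
  have -> : (N * (2 * D) = N * i.1 + N * i.2 + N * ((D - i.1) + (D - i.2)))%N.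
    by rewrite -!mulnDr; congr (_ * _)%N; have := le i.1; have := le i.2; clear; lia.
  rewrite mevalZ !mevalM !rmorphXn /= hornerZ !hornerM !horner_exp -q1 -q2 -q3 /ev.
  rewrite !exprMn !exprD !exprM !exprD; ring.
pose o0 : 'I_2 := 0; pose o1 : 'I_2 := 1.
pose mn (i : 'I_D.+1 * 'I_D.+1) : 'X_{1..2} := (U_(o0) *+ i.1 + U_(o1) *+ i.2)%MM.
pose P : {mpoly K[2]} := \sum_i c i *: 'X_[mn i].
have evP v : P.@[v] = \sum_i c i * (v 0 ^+ i.1 * v 1 ^+ i.2).
  by rewrite raddf_sum; apply: eq_bigr => i _ /=; rewrite mevalZ mpolyXD -!mpolyXn mevalM !rmorphXn /= !mevalXU.
have P0 : P = 0.
  apply: ind => x Ux; apply: (@regular_eq0 U (fun x => P.@[fun i => f i x]) B oU) Ux => //; last 2 first.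
  - by exists x0.
  - move=> y Uy nBy; have Xy : X y by case: oU => Z [_ /(_ y)] [/(_ Uy)] [].
    have [_ e1' e2'] := hB y Xy nBy; rewrite evP e1' e2'.
    apply: (mulfI (expf_neq0 (2 * D) nBy)); rewrite mulr0 -[RHS](H0 y Xy) /ev raddf_sum mulr_sumr /=.
    apply: eq_bigr => i _; have le (j : 'I_D.+1) : (j <= D)%N by rewrite -ltnS.
    have -> : (2 * D = i.1 + i.2 + ((D - i.1) + (D - i.2)))%N.
      by have := le i.1; have := le i.2; clear; lia.
    rewrite mevalZ !mevalM !rmorphXn /= -/(ev B y) -/(ev F1 y) -/(ev F2 y).
    have quot u : exists w, u = w * ev B y by exists (u / ev B y); rewrite divfK.
    have [w1 ->] := quot (ev F1 y); have [w2 ->] := quot (ev F2 y).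
    rewrite !mulfK // !exprMn !exprD; ring.
  apply: (@regular_ext _ _ _ (fun x => \sum_i c i * (f 0 x ^+ i.1 * f 1 x ^+ i.2))); first by move=> y _; rewrite evP.
  apply: regular_sum => i; apply: regularM; first by apply: regular_pfun; apply: pfun_const.
  by apply: regularM; apply: regularX; apply: rf.
have := congr1 (mcoeff (mn i0)) P0; rewrite mcoeff0 raddf_sum /= (bigD1 i0) //=.
rewrite mcoeffZ mcoeffX eqxx mulr1 big1 ?addr0 => [/eqP|i ne]; first by rewrite (negPf nc).
rewrite mcoeffZ mcoeffX; case: eqP => [E|]; last by rewrite mulr0.
case/negP: ne; case: i i0 E {nc} => [i1 i2] [j1 j2] /mnmP E; apply/eqP.
have := E o0; have := E o1; rewrite !mnmDE !mulmnE !mnm1E /= !mul1n !mul0n !addn0 !add0n.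
by move=> /val_inj -> /val_inj ->.
Qed.

Theorem rank_dim : has_dim X 2 -> (r + s = 2)%N.
Proof. by case=> /rank_gt1 h1 /rank_lt h2; apply/eqP; rewrite eqn_leq h1 -ltnS h2. Qed.
End Rank.

(** * Characters of the torus and toric parametrisations *)

Section Rank2Vectors.

Lemma sum_ord2 (V : nmodType) (F : 'I_2 -> V) : \sum_i F i = F 0 + F 1.
Proof. by rewrite big_ord_recl big_ord1; congr (_ + F _); apply: val_inj. Qed.

Lemma prod_ord2 (R : comPzSemiRingType) (F : 'I_2 -> R) : \prod_i F i = F 0 * F 1.
Proof. by rewrite big_ord_recl big_ord1; congr (_ * F _); apply: val_inj. Qed.

Lemma ord2_ind (P : 'I_2 -> Prop) : P 0 -> P 1 -> forall i, P i.
Proof.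
move=> P0 P1 [[|[|//]] h]; first by rewrite (_ : Ordinal h = 0) //; apply: val_inj.
by rewrite (_ : Ordinal h = 1) //; apply: val_inj.
Qed.

Lemma row2P (T : Type) (u v : 'rV[T]_2) : u 0 0 = v 0 0 -> u 0 1 = v 0 1 -> u = v.
Proof. by move=> h0 h1; apply/rowP; apply: ord2_ind. Qed.

Definition vec2 (T : Type) (a b : T) : 'rV[T]_2 := \row_i (if i == 0 then a else b).

Lemma vec2E0 (T : Type) (a b : T) : vec2 a b 0 0 = a. Proof. by rewrite mxE. Qed.
Lemma vec2E1 (T : Type) (a b : T) : vec2 a b 0 1 = b. Proof. by rewrite mxE. Qed.
Definition vec2E := (vec2E0, vec2E1).

Lemma pairingE (R : pzRingType) (p u : 'rV[R]_2) : pairing p u = p 0 0 * u 0 0 + p 0 1 * u 0 1.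
Proof. by rewrite /pairing sum_ord2. Qed.

Lemma pairingDr (R : pzRingType) (p u v : 'rV[R]_2) : pairing p (u + v) = pairing p u + pairing p v.
Proof. by rewrite /pairing -big_split; apply: eq_bigr => i _; rewrite mxE mulrDr. Qed.

Lemma pairingNr (R : pzRingType) (p u : 'rV[R]_2) : pairing p (- u) = - pairing p u.
Proof. by rewrite /pairing -sumrN; apply: eq_bigr => i _; rewrite mxE mulrN. Qed.

Lemma pairingBr (R : pzRingType) (p u v : 'rV[R]_2) : pairing p (u - v) = pairing p u - pairing p v.
Proof. by rewrite pairingDr pairingNr. Qed.

Lemma pairingMnr (R : pzRingType) (p u : 'rV[R]_2) k : pairing p (u *+ k) = pairing p u *+ k.
Proof. by elim: k => [|k IH]; rewrite ?mulr0n ?mulrSr ?pairingDr ?IH // /pairing big1 // => i _; rewrite mxE mulr0. Qed.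

End Rank2Vectors.

Section Characters.
Variable K : closedFieldType.
Implicit Types (t : 'rV[K]_2) (u v : 'rV[int]_2).

Lemma tcharD u v t : torus t -> torus_char (u + v) t = torus_char u t * torus_char v t.
Proof.
move=> ht; rewrite /torus_char -big_split; apply: eq_bigr => i _.
by rewrite mxE expfzDr.
Qed.

Lemma tchar0 t : torus_char 0 t = 1.
Proof. by rewrite /torus_char big1 // => i _; rewrite mxE expr0z. Qed.

Lemma tchar_neq0 u t : torus t -> torus_char u t != 0.
Proof. by move=> ht; apply/prodf_neq0 => i _; apply: expfz_neq0. Qed.

Lemma tcharN u t : torus t -> torus_char (- u) t = (torus_char u t)^-1.
Proof.
move=> ht; apply: (mulfI (tchar_neq0 u ht)).
by rewrite -tcharD // subrr tchar0 mulfV // tchar_neq0.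
Qed.

Lemma tcharB u v t : torus t -> torus_char (u - v) t = torus_char u t / torus_char v t.
Proof. by move=> ht; rewrite tcharD // tcharN. Qed.

Lemma tcharMn u k t : torus t -> torus_char (u *+ k) t = torus_char u t ^+ k.
Proof.
move=> ht; elim: k => [|k IH]; first by rewrite mulr0n tchar0.
by rewrite mulrS tcharD // IH exprS.
Qed.

Lemma tchar_tmul u s t : torus_char u (tmul s t) = torus_char u s * torus_char u t.
Proof.
by rewrite /torus_char -big_split; apply: eq_bigr => i _; rewrite mxE expfzMl.
Qed.

Lemma tchar_one u : torus_char u (torus_one K 2) = 1.
Proof. by rewrite /torus_char big1 // => i _; rewrite mxE exp1rz. Qed.

Lemma torus_one_in : torus (torus_one K 2).
Proof. by move=> i; rewrite mxE oner_neq0. Qed.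

Lemma torus_tmul s t : torus s -> torus t -> torus (tmul s t).
Proof. by move=> hs ht i; rewrite mxE mulf_neq0. Qed.

Lemma tmul1 t : tmul (torus_one K 2) t = t.
Proof. by apply/rowP => i; rewrite !mxE mul1r. Qed.

Lemma tmulC s t : tmul s t = tmul t s.
Proof. by apply/rowP => i; rewrite !mxE mulrC. Qed.

(** The one-parameter subgroup of the cocharacter p. *)
Definition one_param (p : 'rV[int]_2) (l : K) : 'rV[K]_2 := \row_i l ^ p 0 i.

Lemma one_param_torus p l : l != 0 -> torus (one_param p l).
Proof. by move=> nl i; rewrite mxE expfz_neq0. Qed.

Lemma tchar_one_param p u l : l != 0 -> torus_char u (one_param p l) = l ^ pairing p u.
Proof.
move=> nl; rewrite /torus_char prod_ord2 pairingE expfzDr // !mxE.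
by rewrite !exprz_exp.
Qed.

Lemma nonroot_avoid (q : {poly K}) : q != 0 -> exists2 x, x != 0 & ~~ root q x.
Proof.
move=> nq; have /closed_nonrootP [x] : q * 'X != 0 by rewrite mulf_neq0 ?polyX_eq0.
by rewrite rootM rootX negb_or => /andP[rx nx]; exists x.
Qed.

Lemma power_avoid1 (k : int) : k != 0 -> exists2 l : K, l != 0 & l ^ k != 1.
Proof.
move=> nk; have n0 : (0 < `|k|)%N by rewrite absz_gt0.
have [|l nl] := @nonroot_avoid ('X^(`|k|%N) - 1); first by rewrite -size_poly_eq0 size_XnsubC.
rewrite rootE !hornerE => h; exists l => //; apply: contraNneq h => h; rewrite subr_eq0.
move: h; case: k {nk n0} => k; first by move=> <-.
by rewrite NegzE /= -invr_expz => /eqP; rewrite invr_eq1.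
Qed.

Lemma tchar_separate u v : u != v -> exists2 t : 'rV[K]_2, torus t & torus_char u t != torus_char v t.
Proof.
move=> nuv; have [i ni] : exists i, (u - v) 0 i != 0.
  apply/existsP; apply: contraNT nuv; rewrite negb_exists -subr_eq0 => /forallP z.
  by apply/eqP/rowP => i; rewrite [RHS]mxE; apply/eqP; rewrite -[_ == _]negbK.
have [l nl hl] := power_avoid1 ni.
pose t := one_param (\row_j (j == i)%:R) l.
have ht : torus t by apply: one_param_torus.
exists t => //; rewrite -(inj_eq (mulIf (invr_neq0 (tchar_neq0 v ht)))) mulfV ?tchar_neq0 //.
rewrite -tcharB // tchar_one_param // /pairing (bigD1 i) //= big1 ?addr0.
  by move: hl; rewrite !mxE eqxx mul1r.
by move=> j /negPf nj; rewrite mxE nj mul0r.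
Qed.

(** Dedekind's independence of characters. *)
Lemma tchar_independent (s : seq 'rV[int]_2) (c : 'rV[int]_2 -> K) : uniq s ->
  (forall t, torus t -> \sum_(u <- s) c u * torus_char u t = 0) -> forall u, u \in s -> c u = 0.
Proof.
elim: s c => // a s IH c /= /andP[nas us] h.
have tail v : v \in s -> c v = 0.
  move=> vs; have nva : v != a by apply: contraNneq nas => <-.
  have [t0 ht0 sep] := tchar_separate nva.
  have := IH (fun u => c u * (torus_char u t0 - torus_char a t0)) us _ v vs.
  move=> H; apply: (mulIf (x := torus_char v t0 - torus_char a t0)); first by rewrite subr_eq0.
  rewrite mul0r; apply: H => t ht.
  have := h _ (torus_tmul ht0 ht); rewrite big_cons tchar_tmul => h1.
  have := h t ht; rewrite big_cons => h2.
  have h3 : \sum_(u <- s) c u * torus_char u (tmul t0 t) - 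
      torus_char a t0 * \sum_(u <- s) c u * torus_char u t = 0.
    move/eqP: h1; rewrite addrC addr_eq0 => /eqP ->; move/eqP: h2; rewrite addrC addr_eq0 => /eqP ->.
    by ring.
  rewrite -[RHS]h3 mulr_sumr -sumrB; apply: eq_bigr => w _.
  by rewrite tchar_tmul; ring.
move=> u; rewrite inE => /orP[/eqP ->|]; last exact: tail.
have := h _ torus_one_in; rewrite big_cons tchar_one mulr1 big_seq big1 ?addr0 // => v vs.
by rewrite tail // mul0r.
Qed.

(** By independence some combination of translations kills all characters of s but
    one. *)
Lemma tchar_isolate (s : seq 'rV[int]_2) u0 : uniq s -> u0 \in s ->
  exists N (g : 'I_N -> K) (b : 'I_N -> 'rV[K]_2), (forall k, torus (b k)) /\
    forall u, u \in s -> \sum_k g k * torus_char u (b k) = (u == u0)%:R.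
Proof.
move=> us u0s; have lt0 : (index u0 s < size s)%N by rewrite index_mem.
have [|N [g [b [tb h]]]] := @independent_isolate K _ (@torus K 2) (size s)
   (fun i t => torus_char (nth 0 s i) t) (Ordinal lt0).
  move=> c hc i; pose c' u := if insub (index u s) is Some i then c i else 0.
  have ci j : c' (nth 0 s (val j)) = c j.
    rewrite /c' index_uniq //; last exact: ltn_ord.
    by case: insubP => [k _ /val_inj ->//|]; rewrite (ltn_ord j).
  rewrite -ci; apply: (tchar_independent us) (mem_nth _ (ltn_ord i)) => t ht.
  rewrite (big_nth 0) big_mkord -[RHS](hc t ht); apply: eq_bigr => j _; by rewrite ci.
exists N, g, b; split=> // u ius; have ltu : (index u s < size s)%N by rewrite index_mem.
have := h (Ordinal ltu); rewrite /= nth_index // => ->; rewrite -val_eqE /=.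
by congr (_%:R); congr nat_of_bool; apply/eqP/eqP => [e|->//]; rewrite -(nth_index 0 ius) e nth_index.
Qed.

(** Laurent polynomials with exponents in S; only the values on the torus matter. *)
Definition laurent (S : 'rV[int]_2 -> Prop) (f : 'rV[K]_2 -> K) := exists l : seq (K * 'rV[int]_2),
  (forall p, p \in l -> S p.2) /\ forall t, torus t -> f t = \sum_(p <- l) p.1 * torus_char p.2 t.

Lemma collect_terms (l : seq (K * 'rV[int]_2)) : exists s (c : 'rV[int]_2 -> K),
  [/\ uniq s, forall u, u \in s -> exists2 p, p \in l & p.2 = u, forall u, u \in s -> c u != 0
    & forall G : 'rV[int]_2 -> K, \sum_(p <- l) p.1 * G p.2 = \sum_(u <- s) c u * G u].
Proof.
pose c u := \sum_(p <- l | p.2 == u) p.1.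
pose s0 := undup [seq p.2 | p <- l].
exists [seq u <- s0 | c u != 0], c; split.
- by rewrite filter_uniq // undup_uniq.
- by move=> u; rewrite mem_filter mem_undup => /andP[_ /mapP[p pl ->]]; exists p.
- by move=> u; rewrite mem_filter => /andP[].
move=> G; rewrite big_filter.
transitivity (\sum_(u <- s0) c u * G u); last first.
  rewrite [RHS]big_mkcond; apply: eq_bigr => u _; case: eqP => [->|//] /=; by rewrite mul0r.
under [RHS]eq_bigr => u _ do rewrite mulr_suml.
rewrite (exchange_big_dep xpredT) //= big_seq [RHS]big_seq; apply: eq_bigr => p pl.
rewrite -big_filter (_ : [seq i <- s0 | p.2 == i] = [:: p.2]) ?big_seq1 //.
have ps : p.2 \in s0 by rewrite mem_undup map_f.
rewrite -(filter_pred1_uniq (undup_uniq _) ps); apply: eq_filter => i /=; by rewrite eq_sym.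
Qed.

Lemma laurent_collect S f : laurent S f -> exists s (c : 'rV[int]_2 -> K),
  [/\ uniq s, forall u, u \in s -> S u, forall u, u \in s -> c u != 0
    & forall t, torus t -> f t = \sum_(u <- s) c u * torus_char u t].
Proof.
move=> [l [hS hf]]; have [s [c [us sl nc e]]] := collect_terms l; exists s, c; split=> //.
  by move=> u /sl [p /hS h <-].
by move=> t ht; rewrite hf // (e (fun u => torus_char u t)).
Qed.

Lemma laurent_sub S S' f : (forall u, S u -> S' u) -> laurent S f -> laurent S' f.
Proof. by move=> h [l [hS hf]]; exists l; split=> // p /hS /h. Qed.

Lemma laurent_ext S f g : (forall t, torus t -> f t = g t) -> laurent S f -> laurent S g.
Proof. by move=> e [l [hS hf]]; exists l; split=> // t ht; rewrite -e ?hf. Qed.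

Lemma laurentD S f g : laurent S f -> laurent S g -> laurent S (fun t => f t + g t).
Proof.
move=> [l [hl hf]] [m [hm hg]]; exists (l ++ m); split=> [p|t ht]; last by rewrite big_cat hf // hg.
by rewrite mem_cat => /orP[/hl|/hm].
Qed.

Lemma laurentM S f g : (forall u v, S u -> S v -> S (u + v)) ->
  laurent S f -> laurent S g -> laurent S (fun t => f t * g t).
Proof.
move=> SD [l [hl hf]] [m [hm hg]].
exists [seq (p.1 * q.1, p.2 + q.2) | p <- l, q <- m]; split=> [p|t ht].
  by case/allpairsP => [[p1 p2]] /= [/hl h1 /hm h2 ->] /=; apply: SD.
rewrite hf // hg // big_allpairs_dep mulr_suml; apply: eq_bigr => p _; rewrite mulr_sumr.
by apply: eq_bigr => q _ /=; rewrite tcharD //; ring.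
Qed.

Lemma laurent_const (S : _ -> Prop) c : S 0 -> laurent S (fun=> c).
Proof.
move=> S0; exists [:: (c, 0)]; split=> [p|t ht]; first by rewrite inE => /eqP ->.
by rewrite big_seq1 tchar0 mulr1.
Qed.

Lemma laurent_char (S : _ -> Prop) u : S u -> laurent S (torus_char u).
Proof.
move=> Su; exists [:: (1, u)]; split=> [p|t ht]; first by rewrite inE => /eqP ->.
by rewrite big_seq1 mul1r.
Qed.

(** By the independence of characters. *)
Lemma laurent_char_inv S u : laurent S (torus_char u) -> S u.
Proof.
case/laurent_collect => s [c [us Ss nc h]]; apply: Ss; apply: contraT => nus.
have := @tchar_independent (u :: s) (fun v => if v == u then -1 else c v).
rewrite /= nus us => /(_ isT) H; have /eqP : (if u == u then -1 else c u) = 0 :> K.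
  apply: H; last exact: mem_head.
  move=> t ht; rewrite big_cons eqxx h //.
  rewrite [X in _ + X](eq_big_seq (fun v => c v * torus_char v t)); first by rewrite mulN1r addNr.
  by move=> v vs; case: eqP => [e|//]; rewrite -e vs in nus.
by rewrite eqxx oppr_eq0 oner_eq0.
Qed.
End Characters.

Section IntegerLattice.

Lemma int_subgroup (L : int -> Prop) : L 0 -> (forall a b, L a -> L b -> L (a - b)) ->
  exists g : nat, forall k, L k <-> (g %| k)%Z.
Proof.
move=> L0 LB; have LN a : L a -> L (- a) by move=> La; rewrite -sub0r; apply: LB.
have LD a b : L a -> L b -> L (a + b) by move=> La Lb; rewrite -[b]opprK; apply: LB => //; apply: LN.
have LM (a : int) k : L a -> L (a * k).
  move=> La; have LMn n : L (a *+ n) by elim: n => [|n IH]; rewrite ?mulr0n ?mulrS //; apply: LD.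
  case: k => k; rewrite ?NegzE ?mulrN; first by have := LMn k; rewrite -mulr_natr natz.
  by apply: LN; have := LMn k.+1; rewrite -mulr_natr natz.
case: (classic (exists2 k, L k & k != 0)) => [[k Lk nk]|all0]; last first.
  exists 0%N => k; rewrite dvd0z; split=> [Lk|/eqP ->//]; apply: contraT => nk; case: all0; by exists k.
have Labs k' : L k' -> L `|k'|%N.
  by case: k' => k' h //=; rewrite NegzE in h; have := LN _ h; rewrite opprK.
have [|g [Lg g0] min] := @nat_least (fun g : nat => L g /\ (0 < g)%N) `|k|%N.
  by split; [exact: Labs | rewrite absz_gt0].
exists g => j; split=> [Lj|/dvdzP[q ->]]; last by rewrite mulrC; apply: LM.
have Lr : L (j %% g)%Z.
  have -> : (j %% g)%Z = j - g%:Z * (j %/ g)%Z by rewrite {2}(divz_eq j g); ring.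
  by apply: LB => //; apply: LM.
have ng : g%:Z != 0 by rewrite -lt0n in g0 *; case: g g0 {Lg min Lr}.
rewrite dvdzE; apply/dvdz_mod0P; apply/eqP; apply: contraT => nr.
have := min `|(j %% g)%Z|%N; rewrite absz_gt0 nr => /(_ (conj (Labs _ Lr) isT)).
have h0 := modz_ge0 j ng; have h1 := ltz_mod j ng.
by move: h0 h1; clear; lia.
Qed.

(** For c = 0 any z other than 0 and 1 will do; for c > 1 one uses characteristic 0. *)
Lemma root_unity_exists (K : closedFieldType) (charK : has_pchar0 K) (c : nat) : c != 1%N ->
  exists2 z : K, z != 0 & z != 1 /\ z ^+ c = 1.
Proof.
case: c => [_|[//|c] _].
  have [|z nz hz] := @nonroot_avoid K ('X - 1); first by rewrite polyXsubC_eq0.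
  by exists z => //; split=> //; move: hz; rewrite rootE !hornerE subr_eq0.
have sz : size (\poly_(i < c.+2) (1 : K)) != 1 by rewrite size_poly_eq ?oner_neq0.
have [z rz] := closed_rootP _ sz.
have h : z ^+ c.+2 - 1 = 0.
  rewrite subrX1; move: rz; rewrite rootE horner_poly => /eqP rz.
  by rewrite (eq_bigr (fun i : 'I_c.+2 => 1 * z ^+ i)) ?rz ?mulr0 // => i _; rewrite mul1r.
have z1 : z ^+ c.+2 = 1 by apply/eqP; rewrite -subr_eq0 h.
exists z; first by apply/eqP => z0; move/eqP: z1; rewrite z0 expr0n eq_sym oner_eq0.
split=> //; apply: contraTneq rz => ->; rewrite rootE horner_poly.
rewrite (eq_bigr (fun=> 1)) => [|i _]; last by rewrite expr1n mulr1.
by rewrite sumr_const card_ord (proj1 (pcharf0P K) charK).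
Qed.

(** Write L in the triangular form spanned by (g, h) and (0, c).  If c or g is not 1
    there is, in characteristic 0, a root of unity other than 1 that gives a
    nontrivial point of the torus where the characters of L are 1. *)
Lemma full_sublattice (K : closedFieldType) (charK : has_pchar0 K) (L : 'rV[int]_2 -> Prop) :
  L 0 -> (forall u v, L u -> L v -> L (u - v)) ->
  (forall t : 'rV[K]_2, torus t -> (forall u, L u -> torus_char u t = 1) -> t = torus_one K 2) ->
  forall u, L u.
Proof.
move=> L0 LB inj.
have LN a : L a -> L (- a) by move=> La; rewrite -sub0r; apply: LB.
have LD a b : L a -> L b -> L (a + b) by move=> La Lb; rewrite -[b]opprK; apply: LB => //; apply: LN.
have LM (a : 'rV[int]_2) (k : int) : L a -> L (k *: a).
  move=> La; have LMn n : L (a *+ n) by elim: n => [|n IH]; rewrite ?mulr0n ?mulrS //; apply: LD.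
  case: k => k; rewrite ?NegzE ?scaleNr; first by have := LMn k; rewrite -scaler_nat natz.
  by apply: LN; have := LMn k.+1; rewrite -scaler_nat natz.
have vB (a b a' b' : int) : vec2 a b - vec2 a' b' = vec2 (a - a') (b - b').
  by apply: row2P; rewrite !mxE.
have vE (w : 'rV[int]_2) : w = vec2 (w 0 0) (w 0 1) by apply: row2P; rewrite !mxE.
have tcharE (t : 'rV[K]_2) a b : torus_char (vec2 a b) t = t 0 0 ^ a * t 0 1 ^ b.
  by rewrite /torus_char prod_ord2 !vec2E.
have [||c hc] := @int_subgroup (fun b => L (vec2 0 b)).
- by rewrite (_ : vec2 0 0 = 0) //; apply: row2P; rewrite !mxE.
- by move=> a b La Lb; have := LB _ _ La Lb; rewrite vB subr0.
have [||g hg] := @int_subgroup (fun a => exists b, L (vec2 a b)).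
- by exists 0; rewrite (_ : vec2 0 0 = 0) //; apply: row2P; rewrite !mxE.
- by move=> a a' [b La] [b' Lb]; exists (b - b'); have := LB _ _ La Lb; rewrite vB.
have [h Lgh] := proj2 (hg g) (dvdzz g).
have decomp a b : L (vec2 a b) -> exists k : int, a = k * g /\ (c %| b - k * h)%Z.
  move=> Lab; have /dvdzP [k ek] : (g %| a)%Z by apply/hg; exists b.
  exists k; split=> //; apply/hc; have := LB _ _ Lab (LM _ k Lgh).
  rewrite (_ : k *: vec2 (g : int) h = vec2 (k * g) (k * h)) ?vB ?ek ?subrr //.
  by apply: row2P; rewrite !mxE.
(* A point (y, z) with z ^ c = 1 and y ^ g = z ^ (- h) is in the kernel of L. *)
have c1 : c = 1%N.
  apply/eqP; apply: contraT => nc; have [z nz [nz1 zc]] := root_unity_exists charK nc.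
  have zpow k : (c %| k)%Z -> z ^ k = 1.
    by case/dvdzP => q ->; rewrite mulrC -exprz_exp [z ^ c]zc exp1rz.
  have [y [ny hy]] : exists y, y != 0 /\ (forall k b, (c %| b - k * h)%Z -> 
      L (vec2 (k * g) b) -> y ^ (k * g) * z ^ b = 1).
    case: (posnP g) => [g0|gpos].
      exists 1; split=> [|k b _]; first exact: oner_neq0.
      by rewrite g0 mulr0 => /hc /zpow ->; rewrite exp1rz mulr1.
    have sz : size ('X^g - (z ^ (- h))%:P : {poly K}) != 1.
      by rewrite size_XnsubC // eqSS -lt0n.
    have [y] := closed_rootP _ sz; rewrite rootE !hornerE subr_eq0 => /eqP yg.
    have ny : y != 0.
      by apply/eqP => y0; move/eqP: yg; rewrite y0 expr0n eqn0Ngt gpos eq_sym (negPf (expfz_neq0 _ nz)).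
    exists y; split=> // k b ck _.
    have -> : y ^ (k * g) = (y ^+ g) ^ k by rewrite [k * _]mulrC -exprz_exp.
    rewrite yg exprz_exp -expfzDr //; apply: zpow.
    by rewrite mulNr [h * k]mulrC addrC.
  have tt : torus (vec2 y z) by apply: ord2_ind; rewrite !vec2E.
  have /(congr1 (fun v : 'rV_2 => v 0 1)) : vec2 y z = torus_one K 2.
    apply: (inj) => // u; rewrite (vE u) tcharE !vec2E => Lu.
    by have [k [ek ck]] := decomp _ _ Lu; rewrite ek in Lu *; apply: hy.
  by rewrite vec2E mxE => /eqP; rewrite (negPf nz1).
have g1 : g = 1%N.
  apply/eqP; apply: contraT => ng; have [z nz [nz1 zg]] := root_unity_exists charK ng.
  have /(congr1 (fun v : 'rV_2 => v 0 0)) : vec2 z 1 = torus_one K 2.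
    apply: (inj); first by apply: ord2_ind; rewrite !vec2E ?oner_neq0.
    move=> u; rewrite (vE u) tcharE !vec2E => /decomp [k [-> _]].
    by rewrite exp1rz mulr1 mulrC -exprz_exp [z ^ g]zg exp1rz.
  by rewrite vec2E mxE => /eqP; rewrite (negPf nz1).
move=> u; have L01 : L (vec2 0 1) by apply/hc; rewrite c1 dvd1z.
rewrite g1 in Lgh.
have -> : u = u 0 0 *: vec2 (1%N : int) h + (u 0 1 - u 0 0 * h) *: vec2 0 1.
  by apply: row2P; rewrite !mxE /=; ring.
by apply: LD; apply: LM.
Qed.
End IntegerLattice.

(** * Toric parametrisations of a normal surface *)

Section ToricParam.
Variables (K : closedFieldType) (n : nat) (X : pset K n).

(** The characters that extend to regular functions along the parametrisation. *)
Definition weight_monoid (f : 'rV[K]_2 -> 'rV[K]_n) (u : 'rV[int]_2) : Prop :=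
  exists P, forall t, torus t -> ev P (f t) = torus_char u t.

(** The part of a toric structure that does not refer to an action: an open torus
    in X such that each coordinate function is a sum of characters that are
    themselves regular on X. *)
Record toric_param (f : 'rV[K]_2 -> 'rV[K]_n) : Prop := ToricParam {
  tp_in : forall t, torus t -> X (f t);
  tp_open : open_in X (fun x => exists t, torus t /\ x = f t);
  tp_inj : forall s t, torus s -> torus t -> f s = f t -> s = t;
  tp_coords : exists (F : seq 'rV[int]_2) (c : 'I_n -> 'rV[int]_2 -> K),
    (forall u, u \in F -> weight_monoid f u) /\
    forall t i, torus t -> f t 0 i = \sum_(u <- F) c i u * torus_char u t }.

(** The submonoid generated by F, by its universal property. *)
Definition generated (F : seq 'rV[int]_2) (u : 'rV[int]_2) : Prop :=
  forall Q : 'rV[int]_2 -> Prop, Q 0 -> (forall a v, a \in F -> Q v -> Q (a + v)) -> Q u.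

Lemma generated0 F : generated F 0. Proof. by []. Qed.

Lemma generatedD F u v : generated F u -> generated F v -> generated F (u + v).
Proof.
move=> gu gv; apply: (gu (fun u => generated F (u + v))); first by rewrite add0r.
move=> a w aF gw Q Q0 QF; rewrite -addrA; apply: (QF) => //; exact: gw.
Qed.

Lemma generated_in F u : u \in F -> generated F u.
Proof. by move=> uF Q Q0 QF; rewrite -[u]addr0; apply: QF. Qed.

Variable f : 'rV[K]_2 -> 'rV[K]_n.

Lemma weight_monoid0 : weight_monoid f 0.
Proof. by exists 1 => t ht; rewrite tchar0 /ev meval1. Qed.

Lemma weight_monoidD u v : weight_monoid f u -> weight_monoid f v -> weight_monoid f (u + v).
Proof.
by move=> [P hP] [Q hQ]; exists (P * Q) => t ht; rewrite tcharD // -hP // -hQ // /ev mevalM.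
Qed.

Lemma weight_monoidMn u k : weight_monoid f u -> weight_monoid f (u *+ k).
Proof.
move=> hu; elim: k => [|k IH]; first by rewrite mulr0n; apply: weight_monoid0.
by rewrite mulrS; apply: weight_monoidD.
Qed.

Hypotheses (charK : has_pchar0 K) (affX : affine_variety X) (tp : toric_param f).

Lemma tp_dense : dense_in X (fun x => exists t, torus t /\ x = f t).
Proof.
apply: irreducible_dense affX.2 (tp_open tp) _.
by exists (f (torus_one K 2)), (torus_one K 2); split=> //; apply: torus_one_in.
Qed.

(** The coordinates involve finitely many characters, and a polynomial in the
    coordinates only sums of these. *)
Lemma tp_expand_generated : exists F, (forall u, u \in F -> weight_monoid f u) /\
  forall g, pfun g -> laurent (generated F) (fun t => g (f t)).
Proof.
have [F [c [SF h]]] := tp_coords tp; exists F; split=> //; apply: pfun_ind.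
- by move=> g1 g2 e; apply: laurent_ext => t ht; rewrite e.
- by move=> a; apply: laurent_const; apply: generated0.
- move=> i; exists [seq (c i u, u) | u <- F]; split=> [p /mapP[u uF ->]|t ht].
    exact: generated_in.
  by rewrite h // big_map.
- by move=> g1 g2 _ _; apply: laurentD.
- by move=> g1 g2 _ _; apply: laurentM; apply: generatedD.
Qed.

Lemma weight_monoid_fg : exists F, forall u, weight_monoid f u <-> generated F u.
Proof.
have [F [SF h]] := tp_expand_generated; exists F => u; split=> [[P hP]|].
  apply: (laurent_char_inv (K := K)); apply: laurent_ext (h _ (pfun_ev P)) => t ht; exact: hP.
by apply; [apply: weight_monoid0 | move=> a v /SF Sa Sv; apply: weight_monoidD].
Qed.

Lemma tp_expand g : coordinate_ring X g -> laurent (weight_monoid f) (fun t => g (f t)).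
Proof.
move=> [P hP]; have [F [SF h]] := tp_expand_generated.
have := h _ (pfun_ev P) => /(laurent_ext (g := fun t => g (f t))) => H.
apply: laurent_sub (H _) => [u|t ht]; last by rewrite hP //; apply: (tp_in tp).
by apply; [apply: weight_monoid0 | move=> a v /SF Sa Sv; apply: weight_monoidD].
Qed.

(** If t is not separated from 1 by the characters in the weight monoid then f t =
    f 1; so full_sublattice applies to the group that they generate. *)
Lemma weight_monoid_full u : exists v w, [/\ weight_monoid f v, weight_monoid f w & u = v - w].
Proof.
move: u; apply: (@full_sublattice K charK (fun u => exists v w,
   [/\ weight_monoid f v, weight_monoid f w & u = v - w])).
- by exists 0, 0; rewrite subrr; split=> //; apply: weight_monoid0.
- move=> u u' [v [w [hv hw ->]]] [v' [w' [hv' hw' ->]]]; exists (v + w'), (w + v').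
  by split; [apply: weight_monoidD | apply: weight_monoidD | rewrite opprB opprD addrACA].
- move=> t ht h; apply: (tp_inj tp) => //; first exact: torus_one_in.
  have [F [c [SF hc]]] := tp_coords tp; apply/rowP => i; rewrite !hc //; last exact: torus_one_in.
  apply: eq_big_seq => u uF; rewrite tchar_one h //; exists u, 0; rewrite subr0; split=> //; first exact: SF.
  exact: weight_monoid0.
Qed.

(** The quotient of two weights that represents u is a rational function with a
    regular power, so it is regular by normality. *)
Lemma weight_monoid_saturated (norX : normal_variety X) u k :
  (0 < k)%N -> weight_monoid f (u *+ k) -> weight_monoid f u.
Proof.
move=> k0 [P hP]; have [v [w [[V hV] [W hW] eu]]] := weight_monoid_full u.
pose U x := exists t, torus t /\ x = f t.
have [||g [[Q hQ] hg]] := @norX U (fun x => ev V x / ev W x).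
- split; [exact: (tp_open tp) | by exists (f (torus_one K 2)), (torus_one K 2); split=> //; apply: torus_one_in |].
  apply: regularM; first by apply: regular_pfun; apply: pfun_ev.
  apply: regularV; last by apply: regular_pfun; apply: pfun_ev.
  by move=> x [t [ht ->]]; rewrite hW // tchar_neq0.
- exists k, (fun i x => if i == 0%N :> nat then - ev P x else 0); split.
    move=> i; case: eqP => _; last by apply: coordinate_ring_pfun; apply: pfun_const.
    apply: coordinate_ring_pfun; exists (- P) => x; by rewrite /ev mevalN.
  move=> x [t [ht ->]]; rewrite (bigD1 (Ordinal k0)) //= expr0 mulr1 big1 ?addr0.
    by rewrite hV // hW // hP // -tcharB // -eu tcharMn // subrr.
  by move=> i ni; rewrite ifN ?mul0r.
exists Q => t ht; rewrite -hQ; last exact: (tp_in tp).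
by rewrite hg; [rewrite hV // hW // -tcharB // eu | exists t].
Qed.

(** The character u as a function on X: a polynomial representative if u is a
    weight, and otherwise the function on the open orbit extended by 0. *)
Definition chi (u : 'rV[int]_2) (x : 'rV[K]_n) : K :=
  if excluded_middle_informative (weight_monoid f u) is left h
  then ev (proj1_sig (constructive_indefinite_description _ h)) x
  else if excluded_middle_informative (exists t, torus t /\ x = f t) is left h
  then torus_char u (proj1_sig (constructive_indefinite_description _ h)) else 0.

Lemma chi_param u t : torus t -> chi u (f t) = torus_char u t.
Proof.
move=> ht; rewrite /chi; case: excluded_middle_informative => [h|_].
  by case: constructive_indefinite_description => P /= ->.
case: excluded_middle_informative => [h|[]]; last by exists t.
case: constructive_indefinite_description => s /= [hs e]; congr torus_char.
by apply: (tp_inj tp).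
Qed.

Lemma chi_pfun u : weight_monoid f u -> pfun (chi u).
Proof.
move=> hu; rewrite /chi; case: excluded_middle_informative => // h.
exact: pfun_ev.
Qed.

Lemma chi_cr u : weight_monoid f u -> coordinate_ring X (chi u).
Proof. by move=> hu; apply/coordinate_ring_pfun/chi_pfun. Qed.

Lemma tp_eq g h : coordinate_ring X g -> coordinate_ring X h ->
  (forall t, torus t -> g (f t) = h (f t)) -> forall x, X x -> g x = h x.
Proof.
move=> cg ch e; apply: (dense_cr _ tp_dense cg ch) => x [t [ht ->]]; last exact: e.
exact: (tp_in tp).
Qed.

Lemma chi0 x : X x -> chi 0 x = 1.
Proof.
move: x; apply: tp_eq => [||t ht].
- by apply: chi_cr; apply: weight_monoid0.
- by apply: coordinate_ring_pfun; apply: pfun_const.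
- by rewrite chi_param // tchar0.
Qed.

Lemma chiD u v x : weight_monoid f u -> weight_monoid f v -> X x ->
  chi (u + v) x = chi u x * chi v x.
Proof.
move=> hu hv; move: x; apply: tp_eq => [||t ht].
- by apply: chi_cr; apply: weight_monoidD.
- by apply: coordinate_ring_pfun; apply: pfunM; apply: chi_pfun.
- by rewrite !chi_param // tcharD.
Qed.

Lemma chiMn u k x : weight_monoid f u -> X x -> chi (u *+ k) x = chi u x ^+ k.
Proof.
move=> hu Xx; elim: k => [|k IH]; first by rewrite mulr0n expr0 chi0.
by rewrite mulrS chiD // ?IH ?exprS //; apply: weight_monoidMn.
Qed.

Lemma chi_span g : coordinate_ring X g -> exists s (c : 'rV[int]_2 -> K),
  [/\ uniq s, forall u, u \in s -> weight_monoid f u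
    & forall x, X x -> g x = \sum_(u <- s) c u * chi u x].
Proof.
move=> cg; have [s [c [us Ss _ h]]] := laurent_collect (tp_expand cg).
exists s, c; split=> //; apply: (tp_eq cg).
  rewrite /coordinate_ring.
  have : pfun (fun x => \sum_(u <- s) c u * (if u \in s then chi u x else 0)).
    apply: pfun_sum => u; apply: pfunM; first exact: pfun_const.
    by case: (boolP (u \in s)) => [/Ss|_]; [apply: chi_pfun | apply: pfun_const].
  case=> P hP; exists P => x _; rewrite -hP; apply: eq_big_seq => u us'; by rewrite us'.
by move=> t ht; rewrite h //; apply: eq_bigr => u _; rewrite chi_param.
Qed.

Lemma chi_independent (s : seq 'rV[int]_2) (c : 'rV[int]_2 -> K) : uniq s ->
  (forall x, X x -> \sum_(u <- s) c u * chi u x = 0) -> forall u, u \in s -> c u = 0.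
Proof.
move=> us h; apply: (tchar_independent us) => t ht; rewrite -[RHS](h _ (tp_in tp ht)).
by apply: eq_bigr => u _; rewrite chi_param.
Qed.

(** The coordinates of a point are sums of characters of weights. *)
Lemma chi_separate x y : X x -> X y -> (forall u, weight_monoid f u -> chi u x = chi u y) -> x = y.
Proof.
move=> Xx Xy h; apply/rowP => i.
have [s [c [_ Ss e]]] := chi_span (coordinate_ring_pfun X (pfun_coord K i)).
by rewrite !e //; apply: eq_big_seq => u /Ss /h ->.
Qed.

End ToricParam.

Section ToricAction.
Variables (K : closedFieldType) (n : nat) (X : pset K n).
Hypotheses (charK : has_pchar0 K) (affX : affine_variety X).

(** The coordinates of t x0 are Laurent polynomials in t.  A combination of the
    translates of such a coordinate isolates a single character, which is thus
    regular on X. *)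
Lemma toric_structure_param act x0 : toric_structure X act x0 ->
  toric_param X (fun t => act t x0).
Proof.
move=> ts; pose f t := act t x0.
have actX t x : torus t -> X x -> X (act t x).
  move=> ht Xx; have := (act_morph ts).1 (row_mx t x).
  by rewrite row_mxKl row_mxKr; apply; rewrite /prod_var row_mxKl row_mxKr.
have Xx0 := act_base ts.
have fX t : torus t -> X (f t) by move=> ht; apply: actX.
have orbit_dense : dense_in X (orbit_of act x0).
  apply: irreducible_dense affX.2 (act_open ts) _; exists (act (torus_one K 2) x0), (torus_one K 2).
  by split=> //; apply: torus_one_in.
have pr_rl (t : 'rV[K]_2) j : pfun (fun x : 'rV[K]_n => (row_mx t x : 'rV_(2 + n)) 0 j).
  case: (split_ordP j) => i ->.
    by apply: (pfun_ext _ (pfun_const _ (t 0 i))) => x; rewrite row_mxEl.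
  by apply: (pfun_ext _ (pfun_coord K i)) => x; rewrite row_mxEr.
have act_cr t j : torus t -> coordinate_ring X (fun x => act t x 0 j).
  move=> ht; apply: (regular_closed affX.1).
  apply: (regular_ext (f := fun x => act (lsubmx (row_mx t x)) (rsubmx (row_mx t x)) 0 j)).
    by move=> x _; rewrite row_mxKl row_mxKr.
  apply: (regular_comp ((act_morph ts).2 j)) => [x Xx|i].
    by rewrite /prod_var row_mxKl row_mxKr.
  by apply: regular_pfun; apply: pr_rl.
have f_reg j : regular_on (@torus K 2) (fun t => f t 0 j).
  apply: (regular_ext (f := fun t => act (lsubmx (row_mx t x0)) (rsubmx (row_mx t x0)) 0 j)).
    by move=> t _; rewrite row_mxKl row_mxKr.
  apply: (regular_comp ((act_morph ts).2 j)) => [t ht|i].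
    by rewrite /prod_var row_mxKl row_mxKr.
  apply: regular_pfun; case: (split_ordP i) => k ->.
    by apply: (pfun_ext _ (pfun_coord K k)) => t; rewrite row_mxEl.
  by apply: (pfun_ext _ (pfun_const _ (x0 0 k))) => t; rewrite row_mxEr.
have f_laurent j : laurent (fun=> True) (fun t => f t 0 j).
  pose h : {mpoly K[2]} := \prod_i 'X_i.
  have hE t : torus t <-> ev h t != 0.
    rewrite /ev rmorph_prod; split=> [ht|/prodf_neq0 ht i]; last by have := ht i isT; rewrite /= mevalXU.
    by apply/prodf_neq0 => i _; rewrite /= mevalXU.
  have [|k [A hA]] := @regular_on_principal K _ (@affine_space K 2) h (fun t => f t 0 j) (zariski_closed_affine K 2).
    by apply: regular_sub (f_reg j) => t [_ /hE].
  have A_l : laurent (fun=> True) (ev A).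
    move: (ev A) (pfun_ev A); apply: pfun_ind.
    - by move=> g1 g2 e; apply: laurent_ext => t _.
    - by move=> c; apply: laurent_const.
    - move=> i; apply: laurent_ext (@laurent_char K (fun=> True) (\row_k (k == i)%:R) I) => t ht.
      rewrite /torus_char (bigD1 i) //= mxE eqxx expr1z big1 ?mulr1 // => l /negPf nl.
      by rewrite mxE nl expr0z.
    - by move=> g1 g2 _ _; apply: laurentD.
    - by move=> g1 g2 _ _; apply: laurentM.
  have := laurentM _ (@laurent_char K (fun=> True) (\row_i - k%:Z) I) A_l => /(_ (fun _ _ _ _ => I)).
  apply: laurent_ext => t ht; have nh := proj1 (hE t) ht; rewrite -hA // mulrA.
  rewrite (_ : torus_char _ t * _ = 1) ?mul1r //.
  rewrite /torus_char prod_ord2 !mxE -!invr_expz /ev rmorph_prod prod_ord2 /= !mevalXU exprMn -invfM mulVf //.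
  by rewrite mulf_neq0 // expf_neq0.
have inv_act t : torus t -> torus (\row_i (t 0 i)^-1) by move=> ht i; rewrite mxE invr_neq0.
split=> //.
- exact: (act_open ts).
- move=> s t hs ht e; pose r := tmul (\row_i (t 0 i)^-1) s.
  have hr : torus r by apply: torus_tmul => //; apply: inv_act.
  have r0 : act r x0 = x0.
    rewrite (act_mul ts) //; last exact: inv_act.
    rewrite e -(act_mul ts) //; last exact: inv_act.
    rewrite (_ : tmul _ t = torus_one K 2) ?(act_one ts) //.
    by apply/rowP => i; rewrite !mxE mulVf.
  have fix_all x : X x -> act r x = x.
    move=> Xx; apply/rowP => j; move: x Xx.
    apply: (dense_cr _ orbit_dense (act_cr r j hr) (coordinate_ring_pfun X (pfun_coord K j))).
      by move=> x [u [hu ->]]; apply: actX.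
    by move=> x [u [hu ->]]; rewrite -(act_mul ts) // tmulC (act_mul ts) // r0.
  have := act_effective ts hr fix_all => /rowP r1; apply/rowP => i.
  have := r1 i; rewrite !mxE => /(congr1 ( *%R (t 0 i))); rewrite mulrA mulfV // mul1r mulr1 //.
have /fin_all_exists [s /fin_all_exists [c hc]] := fun j => laurent_collect (f_laurent j).
pose F := undup (flatten [seq s j | j <- enum 'I_n]).
have sF j u : u \in s j -> u \in F.
  by move=> us; rewrite mem_undup; apply/flattenP; exists (s j) => //; apply: map_f; rewrite mem_enum.
exists F, (fun j u => if u \in s j then c j u else 0); split.
  move=> u; rewrite mem_undup => /flattenP [_ /mapP [j _ ->] us].
  have [uq _ nc e] := hc j; have [N [g [b [tb h]]]] := tchar_isolate K uq us.
  have /fin_all_exists [P hP] := fun k => act_cr (b k) j (tb k).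
  exists (\sum_k (g k / c j u)%:MP * P k) => t ht.
  have ncu := nc u us; rewrite /ev raddf_sum /=.
  transitivity (\sum_(v <- s j) (\sum_k g k * torus_char v (b k)) / c j u * (c j v * torus_char v t)).
    under [RHS]eq_bigr => v _ do rewrite !mulr_suml.
    rewrite exchange_big /=; apply: eq_bigr => k _; rewrite mevalM mevalC -/(ev _ _) -hP; last exact: fX.
    rewrite -(act_mul ts) // e; last exact: torus_tmul.
    rewrite mulr_sumr; apply: eq_bigr => v _; rewrite tchar_tmul; ring.
  rewrite (bigD1_seq u) //= h // eqxx mul1r mulrA mulVf // mul1r big_seq_cond big1 ?addr0 //.
  by move=> v /andP[vs /negPf nvu]; rewrite h // nvu !mul0r.
move=> t j ht; have [uq _ _ e] := hc j; rewrite e //.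
rewrite [RHS](bigID (fun u => u \in s j)) /= [X in _ + X]big1 ?addr0 => [|u /negPf ->]; last by rewrite mul0r.
rewrite -[RHS]big_filter; transitivity (\sum_(u <- filter (mem (s j)) F) c j u * torus_char u t).
  apply: perm_big; apply: uniq_perm => //; first by rewrite filter_uniq // undup_uniq.
  by move=> u; rewrite mem_filter /=; case: (boolP (u \in s j)) => //= /sF ->.
by apply: eq_big_seq => u; rewrite mem_filter => /andP[/= us _]; rewrite us.
Qed.
End ToricAction.

(** * Toric parametrisations of monoids *)

(** In characteristic 0 a translation invariant space of polynomials contains
    the derivative of each of its members, so it is spanned by powers of X. *)
Lemma translation_invariant_powers (K : closedFieldType) (charK : has_pchar0 K)
    (W : {poly K} -> Prop) :
  (forall p q, W p -> W q -> W (p + q)) -> (forall c p, W p -> W (c *: p)) ->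
  (forall p q b, W p -> (forall x, q.[x] = p.[x + b]) -> W q) ->
  forall p i, W p -> (i < size p)%N -> W 'X^i.
Proof.
move=> WD WZ WT p i Wp.
have W_sum q (I : finType) (F : I -> {poly K}) : W q -> (forall i, W (F i)) -> W (\sum_i F i).
  move=> Wq WF; elim/big_rec: _ => [|j r _ Wr]; last exact: WD.
  by rewrite -(scale0r q); apply: WZ.
have W_deriv q : W q -> (1 < size q)%N -> W q^`().
  move=> Wq sz.
  have ind : independent_on (fun=> True) (fun (j : 'I_(size q)) (b : K) => b ^+ j).
    move=> c hc j; pose r := \poly_(k < size q) (if insub k is Some k then c k else 0 : K).
    suff r0 : r = 0.
      have := congr1 (fun r : {poly K} => r`_j) r0; rewrite coef_poly coef0 ltn_ord.
      by case: insubP => [k _ /val_inj ->|]; rewrite ?(ltn_ord j).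
    apply/eqP; apply: contraT => /closed_nonrootP [x] /negP; case; rewrite rootE horner_poly.
    apply/eqP; rewrite -[RHS](hc x I); apply: eq_bigr => k _.
    by case: insubP => [k' _ /val_inj ->|]; rewrite ?(ltn_ord k).
  have [N [g [b [_ h]]]] := independent_isolate (Ordinal sz) ind.
  have -> : q^`() = \sum_k g k *: \sum_(j < size q) b k ^+ j *: q^`N(j).
    under eq_bigr => k _ do rewrite scaler_sumr.
    rewrite exchange_big /= (bigD1 (Ordinal sz)) //= [X in _ + X]big1 ?addr0.
      under eq_bigr => k _ do rewrite scalerA.
      by rewrite -scaler_suml (h (Ordinal sz)) eqxx scale1r nderivn1.
    move=> j nj; under eq_bigr => k _ do rewrite scalerA.
    by rewrite -scaler_suml (h j) (negPf nj) scale0r.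
  apply: (W_sum q) => // k; apply: WZ; apply: (WT q _ (b k)) => // x.
  rewrite nderiv_taylor; last exact: mulrC.
  rewrite horner_sum; apply: eq_bigr => j _; by rewrite hornerZ mulrC.
have [m le] : exists m, (size p <= m)%N by exists (size p).
elim: m p i Wp le => [|m IH] p i Wp le lt; first by move: (leq_trans lt le).
have lead_nz : lead_coef p != 0 by rewrite lead_coef_eq0 -size_poly_gt0; apply: leq_trans lt.
have low j : (j < (size p).-1)%N -> W 'X^j.
  move=> ltj; have sz : (1 < size p)%N by case: (size p) ltj => [|[]].
  apply: (IH _ _ (W_deriv _ Wp sz)).
    by rewrite -ltnS; apply: leq_trans le; apply: lt_size_deriv; rewrite -size_poly_gt0; apply: leq_trans sz.
  apply: leq_trans ltj _; rewrite leqNgt; apply/negP => lts.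
  have := coef_deriv p (size p).-2; rewrite nth_default; last by rewrite -ltnS prednK //; case: (size p) sz => [|[]].
  rewrite prednK -?lead_coefE; last by case: (size p) sz => [|[]].
  move/esym/eqP; rewrite -mulr_natr mulf_eq0 (negPf lead_nz) /= (proj1 (pcharf0P K) charK).
  by case: (size p) sz => [|[]].
have szp : (0 < size p)%N by apply: leq_trans lt.
move: lt; rewrite -(prednK szp) ltnS leq_eqVlt => /orP[/eqP ->|]; last exact: low.
have -> : 'X^((size p).-1) = (lead_coef p)^-1 *: (p + -1 *: \sum_(j < (size p).-1) p`_j *: 'X^j).
  have aux k : size p = k.+1 -> p - \sum_(j < k) p`_j *: 'X^j = p`_k *: 'X^k.
    by move=> E; rewrite -{1}[p]coefK poly_def E big_ord_recr /= [LHS]addrC addKr.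
  rewrite scaleN1r (aux (size p).-1) ?prednK //.
  by rewrite scalerA -lead_coefE mulVf // scale1r.
apply: (WZ); apply: (WD) => //; apply: (WZ); apply: (W_sum p) => // j; apply: (WZ); exact: low.
Qed.

Section UnitTorus.
Variables (K : closedFieldType) (n : nat) (X : pset K n).
Variables (mu : 'rV[K]_n -> 'rV[K]_n -> 'rV[K]_n) (e : 'rV[K]_n) (r s : nat).
Variables (phi : 'rV[K]_(r + s) -> 'rV[K]_n) (psi : 'rV[K]_n -> 'rV[K]_(r + s)).
Hypotheses (affX : affine_variety X) (mon : comm_monoid X mu e).
Hypothesis iso : isomorphism (@GmGa K r s) (invertibles X mu e) phi psi.

(** The coordinates of psi become polynomials after multiplication by a power of
    the function d that cuts out the units, so their nonvanishing is open. *)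
Lemma torus_image_open :
  open_in X (fun x => exists g : 'rV[K]_(r + s), (forall i, g 0 i != 0) /\ x = phi g).
Proof.
have [d hd] := units_principal affX.1 mon.
have /fin_all_exists [k /fin_all_exists [A hA]] := psi_pull affX iso hd.
apply: (open_ext _ (open_principal X (d * \prod_j A j))) => x.
have evE : ev (d * \prod_j A j) x = ev d x * \prod_j ev (A j) x.
  by rewrite /ev mevalM rmorph_prod.
rewrite evE; split.
  move=> [Xx]; rewrite mulf_eq0 negb_or => /andP[nd /prodf_neq0 nA].
  have ux : invertibles X mu e x by apply/hd.
  exists (psi x); split=> [i|]; last by rewrite (iso_inv_cancel iso).
  have := nA i isT; rewrite -hA // mulf_eq0 negb_or => /andP[]//.
move=> [g [ng ->]]; have Gg : GmGa g by split=> // i; rewrite mxE.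
have ug : invertibles X mu e (phi g) by apply: (iso_morph iso).1.
have nd : ev d (phi g) != 0 by apply/hd => //; case: ug.
split; first by case: ug.
rewrite mulf_neq0 //; apply/prodf_neq0 => j _; rewrite -hA // mulf_neq0 ?expf_neq0 //.
by rewrite (iso_cancel iso).
Qed.
End UnitTorus.

Section Rank2Param.
Variables (K : closedFieldType) (n : nat) (X : pset K n).
Variables (mu : 'rV[K]_n -> 'rV[K]_n -> 'rV[K]_n) (e : 'rV[K]_n).
Variables (phi : 'rV[K]_(2 + 0) -> 'rV[K]_n) (psi : 'rV[K]_n -> 'rV[K]_(2 + 0)).
Hypotheses (affX : affine_variety X) (mon : comm_monoid X mu e).
Hypothesis iso : isomorphism (@GmGa K 2 0) (invertibles X mu e) phi psi.
Hypothesis hom : forall x y, GmGa x -> GmGa y -> phi (GmGa_mul x y) = mu (phi x) (phi y).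

Lemma GmGa20 (t : 'rV[K]_2) : @GmGa K 2 0 t <-> torus t.
Proof.
have E (i : 'I_2) : lshift 0 i = i by apply: val_inj.
by split=> [[h _] i|h]; [have := h i | split=> // i]; rewrite mxE E.
Qed.

Lemma GmGa20_mul (s t : 'rV[K]_2) : @GmGa_mul K 2 0 s t = tmul s t.
Proof.
have E (i : 'I_2) : lshift 0 i = i by apply: val_inj.
apply/rowP => i; rewrite /GmGa_mul mxE; case: splitP => [j ij|[]//].
by have -> : j = i by [apply: val_inj]; rewrite !mxE E.
Qed.

Lemma rank2_toric_structure : toric_structure X (fun t x => mu (phi t) x) e.
Proof.
have ph t : torus t -> invertibles X mu e (phi t) by move=> /GmGa20 ht; apply: (iso_morph iso).1.
have one : phi (torus_one K 2) = e.
  rewrite -(phi1 mon iso hom); congr phi.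
  by apply/rowP => i; rewrite /GmGa_one !mxE; case: splitP => [j ij|[]//]; rewrite mxE.
split.
- split=> [z [ht Xx]|j]; first by apply: (mu_closed mon) => //; case: (ph _ ht).
  apply: (regular_ext (f := fun z => mu (lsubmx (row_mx (phi (lsubmx z)) (rsubmx z)))
     (rsubmx (row_mx (phi (lsubmx z)) (rsubmx z))) 0 j)).
    by move=> z _; rewrite row_mxKl row_mxKr.
  apply: (regular_comp ((mon_morph mon).2 j)) => [z [ht Xx]|i].
    by rewrite /prod_var row_mxKl row_mxKr; split=> //; case: (ph _ ht).
  case: (split_ordP i) => k ->.
    apply: (regular_ext (f := fun z : 'rV_(2 + n) => phi (lsubmx z) 0 k)); first by move=> z _; rewrite row_mxEl.
    apply: (regular_comp ((iso_morph iso).2 k)) => [z [ht _]|l]; first by apply/GmGa20.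
    by apply: regular_pfun; apply: pfun_lsubmx.
  apply: (regular_ext (f := fun z : 'rV_(2 + n) => rsubmx z 0 k)); first by move=> z _; rewrite row_mxEr.
  by apply: regular_pfun; apply: pfun_rsubmx.
- by move=> x Xx; rewrite one (mon_unitl mon).
- move=> s t x hs ht Xx; rewrite -GmGa20_mul hom; try exact/GmGa20.
  by rewrite (mon_assoc mon) //; [case: (ph _ hs) | case: (ph _ ht)].
- move=> t ht h; have Xe := mon_unit mon; have := h e Xe.
  rewrite (mon_unitr mon); last by case: (ph _ ht).
  rewrite -one => /(congr1 psi); rewrite !(iso_cancel iso) //; apply/GmGa20 => //.
  exact: torus_one_in.
- exact: mon_unit mon.
- apply: (open_ext _ (torus_image_open affX mon iso)) => x.
  by split=> -[t [ht ->]]; exists t; split=> //; rewrite (mon_unitr mon) //; case: (ph _ ht).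
Qed.

Lemma rank2_param (charK : has_pchar0 K) : toric_param X phi.
Proof.
have h := toric_structure_param affX rank2_toric_structure.
have ext t : torus t -> mu (phi t) e = phi t.
  move=> ht; rewrite (mon_unitr mon) //.
  by have /GmGa20 /((iso_morph iso).1) [] := ht.
case: h => h1 h2 h3 [F [c [h4 h5]]]; split.
- by move=> t ht; rewrite -ext //; apply: h1.
- by apply: (open_ext _ h2) => x; split=> -[t [ht ->]]; exists t; rewrite ext.
- by move=> s t hs ht; rewrite -(ext s) // -(ext t) //; apply: h3.
exists F, c; split=> [u /h4 [P hP]|t i ht]; last by rewrite -ext // h5.
by exists P => t ht; rewrite -ext // hP.
Qed.
End Rank2Param.

Section Monomials.
Variable K : closedFieldType.

Definition nonneg_vec (u : 'rV[int]_2) := 0 <= u 0 0 /\ 0 <= u 0 1.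

Lemma nat_exprD (x : K) (a b : int) : 0 <= a -> 0 <= b -> x ^ (a + b) = x ^ a * x ^ b.
Proof. by case: a => // a _; case: b => // b _; rewrite -PoszD -!exprnP exprD. Qed.

Lemma torus_charE u (g : 'rV[K]_2) : torus_char u g = g 0 0 ^ u 0 0 * g 0 1 ^ u 0 1.
Proof. by rewrite /torus_char prod_ord2. Qed.

Lemma monomials (f : 'rV[K]_2 -> K) : pfun f -> exists l : seq (K * 'rV[int]_2),
  (forall p, p \in l -> nonneg_vec p.2) /\ forall g, f g = \sum_(p <- l) p.1 * torus_char p.2 g.
Proof.
move: f; apply: pfun_ind.
- by move=> f1 f2 e [l [h1 h2]]; exists l; split=> // g; rewrite -e.
- move=> c; exists [:: (c, 0)]; split=> [p|g]; first by rewrite inE => /eqP ->; split; rewrite mxE.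
  by rewrite big_seq1 tchar0 mulr1.
- move=> i; exists [:: (1, \row_k (k == i)%:R)]; split=> [p|g].
    by rewrite inE => /eqP ->; split; rewrite mxE ler0n.
  rewrite big_seq1 mul1r /torus_char (bigD1 i) //= mxE eqxx expr1z big1 ?mulr1 // => l /negPf nl.
  by rewrite mxE nl expr0z.
- move=> f1 f2 _ _ [l [h1 h2]] [m [h3 h4]]; exists (l ++ m); split=> [p|g].
    by rewrite mem_cat => /orP[/h1|/h3].
  by rewrite big_cat h2 h4.
- move=> f1 f2 _ _ [l [h1 h2]] [m [h3 h4]].
  exists [seq (p.1 * q.1, p.2 + q.2) | p <- l, q <- m]; split=> [p|g].
    case/allpairsP => [[p1 p2]] /= [/h1 [? ?] /h3 [? ?] ->] /=.
    by split; rewrite mxE addr_ge0.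
  rewrite h2 h4 big_allpairs_dep mulr_suml big_seq [RHS]big_seq; apply: eq_bigr => p /h1 [p0 p1].
  rewrite mulr_sumr big_seq [RHS]big_seq; apply: eq_bigr => q /h3 [q0 q1] /=.
  by rewrite !torus_charE !mxE !nat_exprD //; ring.
Qed.
End Monomials.

Section Rank1Param.
Variables (K : closedFieldType) (n : nat) (X : pset K n).
Variables (mu : 'rV[K]_n -> 'rV[K]_n -> 'rV[K]_n) (e : 'rV[K]_n).
Variables (phi : 'rV[K]_(1 + 1) -> 'rV[K]_n) (psi : 'rV[K]_n -> 'rV[K]_(1 + 1)).
Hypotheses (charK : has_pchar0 K) (affX : affine_variety X) (mon : comm_monoid X mu e).
Hypothesis iso : isomorphism (@GmGa K 1 1) (invertibles X mu e) phi psi.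
Hypothesis hom : forall x y, GmGa x -> GmGa y -> phi (GmGa_mul x y) = mu (phi x) (phi y).

Lemma lshift11 (i : 'I_1) : lshift 1 i = 0 :> 'I_2.
Proof. by apply: val_inj; rewrite ord1. Qed.

Lemma rshift11 (i : 'I_1) : rshift 1 i = 1 :> 'I_2.
Proof. by apply: val_inj; rewrite ord1. Qed.

Lemma GmGa11 (g : 'rV[K]_2) : @GmGa K 1 1 g <-> g 0 0 != 0.
Proof.
split=> [[h _]|h]; first by have := h 0; rewrite mxE lshift11.
by split=> // i; rewrite mxE lshift11.
Qed.

Lemma GmGa11_mul (g h : 'rV[K]_2) : @GmGa_mul K 1 1 g h = vec2 (g 0 0 * h 0 0) (g 0 1 + h 0 1).
Proof.
rewrite /GmGa_mul; apply: row2P; rewrite ?vec2E.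
  by rewrite mxE; case: splitP => i ii //; rewrite !mxE lshift11.
rewrite mxE; case: splitP => i ii; last by rewrite !mxE rshift11.
by have := ltn_ord i; rewrite -ii.
Qed.

Definition pulled_back (F : 'rV[K]_2 -> K) : Prop :=
  exists P, forall g : 'rV[K]_2, g 0 0 != 0 -> ev P (phi g) = F g.

Lemma pulled_back_ext F G : (forall g : 'rV[K]_2, g 0 0 != 0 -> F g = G g) -> pulled_back F -> pulled_back G.
Proof. by move=> h [P hP]; exists P => g ng; rewrite hP ?h. Qed.

Lemma pulled_backD F G : pulled_back F -> pulled_back G -> pulled_back (fun g => F g + G g).
Proof. by move=> [P hP] [Q hQ]; exists (P + Q) => g ng; rewrite /ev mevalD -!/(ev _ _) hP ?hQ. Qed.

Lemma pulled_backZ c F : pulled_back F -> pulled_back (fun g => c * F g).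
Proof. by move=> [P hP]; exists (c%:MP * P) => g ng; rewrite /ev mevalM mevalC -/(ev _ _) hP. Qed.

Lemma pulled_back_sum (I : finType) (F : I -> 'rV[K]_2 -> K) :
  (forall i, pulled_back (F i)) -> pulled_back (fun g => \sum_i F i g).
Proof.
move=> h; have /fin_all_exists [P hP] := h.
exists (\sum_i P i) => g ng; rewrite /ev raddf_sum; apply: eq_bigr => i _; exact: hP.
Qed.

Lemma phi_inX (g : 'rV[K]_2) : g 0 0 != 0 -> X (phi g).
Proof. by move=> /GmGa11 ng; case: ((iso_morph iso).1 _ ng). Qed.

Lemma pulled_back_translate F (h : 'rV[K]_2) : h 0 0 != 0 -> pulled_back F ->
  pulled_back (fun g => F (@GmGa_mul K 1 1 h g)).
Proof.
move=> nh [P hP]; have Xh := phi_inX nh.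
have [Q hQ] : coordinate_ring X (fun x => ev P (mu (phi h) x)).
  apply: (coordinate_ring_comp (Y := X) (f := ev P)).
  - by apply: coordinate_ring_pfun; apply: pfun_ev.
  - by move=> x Xx; apply: (mu_closed mon).
  - by move=> j; apply: (mu_cr_r affX.1 mon).
exists Q => g ng; rewrite -hQ; last exact: phi_inX.
rewrite -hom; try exact/GmGa11; apply: hP.
by rewrite GmGa11_mul vec2E mulf_neq0.
Qed.

Lemma expand11 P : exists l : seq (K * 'rV[int]_2), (forall p, p \in l -> 0 <= p.2 0 1) /\
  forall g : 'rV[K]_2, g 0 0 != 0 -> ev P (phi g) = \sum_(p <- l) p.1 * torus_char p.2 g.
Proof.
have [k [A hA]] := phi_pull iso P.
have [l [h1 h2]] := monomials (pfun_ev A).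
exists [seq (p.1, vec2 (p.2 0 0 - k%:Z) (p.2 0 1)) | p : K * 'rV[int]_2 <- l]; split=> [p /mapP [q /h1 [_ h] ->]|g ng].
  by rewrite vec2E.
have cE : ev (@torus_coords K 1 1) g = g 0 0 by rewrite /ev /torus_coords big_ord1 mevalXU lshift11.
have := hA g (proj2 (GmGa11 g) ng); rewrite cE h2 big_map => h.
apply: (mulfI (expf_neq0 k ng)); rewrite h mulr_sumr; apply: eq_bigr => p _ /=.
have E : g 0 0 ^ p.2 0 0 = g 0 0 ^+ k * g 0 0 ^ (p.2 0 0 - k%:Z).
  by rewrite exprnP -expfzDr // addrC subrK.
by rewrite !torus_charE !vec2E E; ring.
Qed.

(** The torus in the unit group isolates the powers of the first coordinate,
    and its additive part the powers of the second one. *)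
Lemma pulled_back_char P (s : seq 'rV[int]_2) (c : 'rV[int]_2 -> K) : uniq s ->
  (forall u, u \in s -> 0 <= u 0 1) -> (forall u, u \in s -> c u != 0) ->
  (forall g : 'rV[K]_2, g 0 0 != 0 -> ev P (phi g) = \sum_(u <- s) c u * torus_char u g) ->
  forall u, u \in s -> pulled_back (torus_char u).
Proof.
move=> us s0 nc hP u ius.
pose ks := undup [seq vec2 (v 0 0) 0 | v : 'rV[int]_2 <- s].
have uks (v : 'rV[int]_2) : v \in s -> vec2 (v 0 0) 0 \in ks.
  by move=> vs; rewrite mem_undup; apply: (map_f (fun v : 'rV[int]_2 => vec2 (v 0 0) 0)).
have [N [ga [b [tb hb]]]] := tchar_isolate K (undup_uniq _) (uks u ius).
pose q := \sum_(v <- s | v 0 0 == u 0 0) c v *: 'X^(absz (v 0 1)).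
pose W (p : {poly K}) := pulled_back (fun g => g 0 0 ^ u 0 0 * p.[g 0 1]).
have Wq : W q.
  have : pulled_back (fun g => \sum_k ga k * \sum_(v <- s) c v * torus_char v (@GmGa_mul K 1 1 (vec2 (b k 0 0) 0) g)).
    apply: pulled_back_sum => k; apply: pulled_backZ.
    apply: (@pulled_back_translate (fun g => \sum_(v <- s) c v * torus_char v g)); last by exists P.
    by rewrite vec2E tb.
  apply: pulled_back_ext => g ng.
  under eq_bigr => k _ do rewrite mulr_sumr.
  rewrite exchange_big /= /q horner_sum mulr_sumr [RHS]big_mkcond /= big_seq [RHS]big_seq.
  apply: eq_bigr => v vs; have := hb _ (uks v vs).
  have -> : (vec2 (v 0 0) 0 == vec2 (u 0 0) 0) = (v 0 0 == u 0 0).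
    by apply/eqP/eqP => [/(congr1 (fun w : 'rV_2 => w 0 0))|->//]; rewrite !vec2E.
  move=> E; transitivity (c v * torus_char v g * \sum_k ga k * torus_char (vec2 (v 0 0) 0) (b k)).
    rewrite mulr_sumr; apply: eq_bigr => k _; rewrite !torus_charE GmGa11_mul !vec2E expfzMl expr0z add0r; ring.
  rewrite E; case: eqP => [ev0|_]; last by rewrite mulr0.
  rewrite mulr1 hornerZ hornerXn torus_charE ev0; have := s0 v vs.
  by case: (v 0 1) => // m _ /=; rewrite -exprnP; ring.
have jq : (absz (u 0%R 1%R) < size q)%N.
  rewrite ltnNge; apply/negP => le; have := nth_default 0 le; rewrite coef_sum.
  rewrite big_mkcond (bigD1_seq u) //= eqxx coefZ coefXn eqxx mulr1 big_seq_cond big1 ?addr0; first by move/eqP; rewrite (negPf (nc u ius)).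
  move=> v /andP[vs nvu]; case: (eqVneq (v 0 0) (u 0 0)) => // ev0.
  rewrite coefZ coefXn; case: eqP => [e1|]; last by rewrite mulr0.
  case/negP: nvu; apply/eqP; apply: row2P => //.
  have := s0 v vs; have := s0 u ius; move: e1; case: (v 0 1) => // m; by case: (u 0 1) => // k /= ->.
have : W 'X^(absz (u 0 1)).
  apply: (@translation_invariant_powers K charK W) Wq jq.
  - move=> p1 p2 h1 h2; apply: pulled_back_ext (pulled_backD h1 h2) => g _; by rewrite hornerD mulrDr.
  - move=> a p1 h1; apply: pulled_back_ext (pulled_backZ a h1) => g _; by rewrite hornerZ; ring.
  - move=> p1 p2 a h1 h12; have n1 : (vec2 1 a : 'rV[K]_2) 0 0 != 0 by rewrite vec2E oner_neq0.
    apply: pulled_back_ext (pulled_back_translate n1 h1) => g _.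
    by rewrite GmGa11_mul !vec2E mul1r h12 addrC.
apply: pulled_back_ext => g _; rewrite hornerXn torus_charE; have := s0 u ius.
by case: (u 0 1).
Qed.

Lemma rank1_expand P : exists (s : seq 'rV[int]_2) (c : 'rV[int]_2 -> K), [/\ uniq s,
  forall u, u \in s -> 0 <= u 0 1, forall u, u \in s -> pulled_back (torus_char u)
  & forall g : 'rV[K]_2, g 0 0 != 0 -> ev P (phi g) = \sum_(u <- s) c u * torus_char u g].
Proof.
have [l [h1 h2]] := expand11 P.
have [s [c [us sl nc eG]]] := collect_terms l.
have s0 u : u \in s -> 0 <= u 0 1 by move=> /sl [p /h1 ? <-].
have eP (g : 'rV[K]_2) : g 0 0 != 0 -> ev P (phi g) = \sum_(u <- s) c u * torus_char u g.
  by move=> ng; rewrite h2 // (eG (fun u => torus_char u g)).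
by exists s, c; split=> //; apply: (pulled_back_char us s0 nc eP).
Qed.

Lemma torus_GmGa11 (t : 'rV[K]_2) : torus t -> t 0 0 != 0. Proof. by apply. Qed.

Lemma rank1_weight u : weight_monoid phi u -> 0 <= u 0 1 /\ pulled_back (torus_char u).
Proof.
move=> [P hP]; have [s [c [us s0 pb e1]]] := rank1_expand P.
suff ius : u \in s by split; [apply: s0 | apply: pb].
apply: (@laurent_char_inv K (fun v => v \in s)).
exists [seq (c v, v) | v <- s]; split=> [p /mapP [v vs ->]//|t ht].
by rewrite big_map -hP // e1.
Qed.

Lemma rank1_param : toric_param X phi.
Proof.
split.
- by move=> t ht; apply: phi_inX.
- by apply: (open_ext _ (torus_image_open affX mon iso)).
- move=> s t hs ht /(congr1 psi); rewrite !(iso_cancel iso) //; apply/GmGa11; exact: torus_GmGa11.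
have cr_i i := rank1_expand 'X_i.
have /fin_all_exists [s /fin_all_exists [c hc]] := cr_i.
pose F := undup (flatten [seq s j | j <- enum 'I_n]).
have sF j u : u \in s j -> u \in F.
  by move=> us; rewrite mem_undup; apply/flattenP; exists (s j) => //; apply: map_f; rewrite mem_enum.
exists F, (fun j u => if u \in s j then c j u else 0); split.
  move=> u; rewrite mem_undup => /flattenP [_ /mapP [j _ ->] us].
  have [_ _ pb _] := hc j; have [P hP] := pb u us.
  by exists P => t ht; apply: hP.
move=> t j ht; have [uq _ _ e1] := hc j.
have -> : phi t 0 j = ev 'X_j (phi t) by rewrite /ev mevalXU.
rewrite e1 //.
rewrite [RHS](bigID (fun u => u \in s j)) /= [X in _ + X]big1 ?addr0 => [|u /negPf ->]; last by rewrite mul0r.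
rewrite -[RHS]big_filter; transitivity (\sum_(u <- filter (mem (s j)) F) c j u * torus_char u t).
  apply: perm_big; apply: uniq_perm => //; first by rewrite filter_uniq // undup_uniq.
  by move=> u; rewrite mem_filter /=; case: (boolP (u \in s j)) => //= /sF ->.
by apply: eq_big_seq => u; rewrite mem_filter => /andP[/= us _]; rewrite us.
Qed.

Lemma rank1_chi u (g : 'rV[K]_2) : weight_monoid phi u -> g 0 0 != 0 -> chi phi u (phi g) = torus_char u g.
Proof.
move=> wu ng; have [_ [P hP]] := rank1_weight wu.
rewrite -hP //; apply: (tp_eq affX rank1_param (g := chi phi u) (h := ev P)).
- exact: chi_cr.
- by apply: coordinate_ring_pfun; apply: pfun_ev.
- by move=> t ht; rewrite (chi_param rank1_param) // hP.
- exact: phi_inX.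
Qed.

(** The derivative of t^k x^j in x is a multiple of t^k x^(j-1). *)
Lemma rank1_down u : weight_monoid phi u -> 0 < u 0 1 -> weight_monoid phi (u + vec2 0 (-1)).
Proof.
move=> wu u1; have [_ pb] := rank1_weight wu.
pose W (p : {poly K}) := pulled_back (fun g => g 0 0 ^ u 0 0 * p.[g 0 1]).
have [m em] : exists m : nat, u 0 1 = m.+1 by move: u1; case: (u 0 1) => // -[//|m] _; exists m.
have Wu : W 'X^(m.+1).
  by apply: pulled_back_ext pb => g _; rewrite hornerXn torus_charE em.
have [||||P hP] := @translation_invariant_powers K charK W _ _ _ _ m Wu.
- move=> p1 p2 h1 h2; apply: pulled_back_ext (pulled_backD h1 h2) => g _; by rewrite hornerD mulrDr.
- move=> a p1 h1; apply: pulled_back_ext (pulled_backZ a h1) => g _; by rewrite hornerZ; ring.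
- move=> p1 p2 a h1 h12; have n1 : (vec2 1 a : 'rV[K]_2) 0 0 != 0 by rewrite vec2E oner_neq0.
  apply: pulled_back_ext (pulled_back_translate n1 h1) => g _.
  by rewrite GmGa11_mul !vec2E mul1r h12 addrC.
- by rewrite size_polyXn.
exists P => t ht; rewrite hP // hornerXn torus_charE !mxE /= addr0 em.
by rewrite (_ : (m.+1 : int) - 1 = m) // -addn1 PoszD addrK.
Qed.
End Rank1Param.

Section Rank0Param.
Variables (K : closedFieldType) (n : nat) (X : pset K n).
Variables (mu : 'rV[K]_n -> 'rV[K]_n -> 'rV[K]_n) (e : 'rV[K]_n).
Variables (phi : 'rV[K]_(0 + 2) -> 'rV[K]_n) (psi : 'rV[K]_n -> 'rV[K]_(0 + 2)).
Hypotheses (affX : affine_variety X) (mon : comm_monoid X mu e).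
Hypothesis iso : isomorphism (@GmGa K 0 2) (invertibles X mu e) phi psi.

Lemma pfun_line m (f : 'rV[K]_m -> K) g : pfun f -> exists p : {poly K}, forall l, f (l *: g) = p.[l].
Proof.
move: f; apply: pfun_ind.
- by move=> f1 f2 e1 [p hp]; exists p => l; rewrite -e1.
- by move=> c; exists c%:P => l; rewrite hornerC.
- by move=> i; exists (g 0 i *: 'X) => l; rewrite mxE hornerZ hornerX mulrC.
- by move=> f1 f2 _ _ [p hp] [q hq]; exists (p + q) => l; rewrite hornerD hp hq.
- by move=> f1 f2 _ _ [p hp] [q hq]; exists (p * q) => l; rewrite hornerM hp hq.
Qed.

(** Along each line through 0 the polynomial has no root. *)
Lemma nonvanishing_const m (f : 'rV[K]_m -> K) g : pfun f -> (forall x, f x != 0) -> f g = f 0.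
Proof.
move=> pf nz; have [p hp] := pfun_line g pf.
have sz : size p == 1%N.
  apply: contraT => /closed_rootP [x]; rewrite /root -hp => h; by have := nz (x *: g); rewrite h.
move/size_poly1P: sz => [c _ ec].
by have := hp 1; have := hp 0; rewrite scale1r scale0r ec !hornerC => -> ->.
Qed.

Lemma GmGa02 (g : 'rV[K]_2) : @GmGa K 0 2 g. Proof. by split=> // -[]. Qed.

Lemma phi_pfun j : pfun (fun g : 'rV[K]_2 => phi g 0 j).
Proof.
have [|P hP] := @regular_closed _ _ (@affine_space K 2) (fun g => phi g 0 j) (zariski_closed_affine K 2).
  by apply: (regular_sub (U := @GmGa K 0 2)) ((iso_morph iso).2 j) => g _; apply: GmGa02.
by exists P => g; apply: hP.
Qed.

(** A function vanishing exactly outside the unit group pulls back to a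
    nowhere vanishing polynomial on the affine plane, hence is constant. *)
Lemma rank0_units x : X x -> invertibles X mu e x.
Proof.
move=> Xx; have [d hd] := units_principal affX.1 mon.
have ph g : invertibles X mu e (phi g) by apply: (iso_morph iso).1; apply: GmGa02.
have const g : ev d (phi g) = ev d (phi 0).
  apply: (@nonvanishing_const _ (fun g => ev d (phi g))).
    exact: pfun_comp (pfun_ev d) phi_pfun.
  by move=> h; apply/hd => //; case: (ph h).
apply/hd => //; have e0 : ev (d - (ev d (phi 0))%:MP) x = 0.
  apply: (units_dense affX mon) Xx => y uy; rewrite /ev mevalB mevalC -/(ev d y).
  by rewrite -(iso_inv_cancel iso uy) const subrr.
move: e0; rewrite /ev mevalB mevalC => /eqP; rewrite subr_eq0 => /eqP; rewrite -/(ev d x) => ->.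
by apply/hd => //; case: (ph 0).
Qed.

Lemma psi_cr j : coordinate_ring X (fun x => psi x 0 j).
Proof.
apply: (regular_closed affX.1); apply: regular_sub ((iso_inv_morph iso).2 j) => x Xx.
exact: rank0_units.
Qed.

Lemma rank0_iso : isomorphism (@affine_space K 2) X phi psi.
Proof.
split.
- split=> [g _|j]; first by case: ((iso_morph iso).1 g (GmGa02 g)).
  by apply: regular_pfun; apply: phi_pfun.
- by split=> // j; apply: regular_cr; apply: psi_cr.
- by move=> g _; rewrite (iso_cancel iso) //; apply: GmGa02.
- by move=> x Xx; rewrite (iso_inv_cancel iso) //; apply: rank0_units.
Qed.

Lemma rank0_monomial u : nonneg_vec u -> exists P, forall g : 'rV[K]_2, ev P (phi g) = torus_char u g.
Proof.
move=> [u0 u1]; have [P0 h0] := psi_cr 0; have [P1 h1] := psi_cr 1.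
have phX g : X (phi g) by case: ((iso_morph iso).1 g (GmGa02 g)).
exists (P0 ^+ absz (u 0 0) * P1 ^+ absz (u 0 1)) => g.
rewrite /ev mevalM !rmorphXn /= -/(ev P0 _) -/(ev P1 _) -h0 // -h1 // (iso_cancel iso); last exact: GmGa02.
by rewrite torus_charE; move: u0 u1; case: (u 0 0) => // a _; case: (u 0 1).
Qed.

Lemma rank0_weight u : weight_monoid phi u <-> nonneg_vec u.
Proof.
split=> [[P hP]|/rank0_monomial [P hP]]; last by exists P.
apply: (laurent_char_inv (K := K)).
have [l [h1 h2]] := monomials (pfun_comp (pfun_ev P) phi_pfun).
by exists l; split=> // t ht; rewrite -hP // h2.
Qed.

Lemma rank0_param : toric_param X phi.
Proof.
split.
- by move=> t _; case: ((iso_morph iso).1 t (GmGa02 t)).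
- by apply: (open_ext _ (torus_image_open affX mon iso)).
- by move=> s t _ _ /(congr1 psi); rewrite !(iso_cancel iso) //; apply: GmGa02.
have /fin_all_exists [l /all_and2 [h1 h2]] := fun j => monomials (phi_pfun j).
have /fin_all_exists [s /fin_all_exists [c hc]] := fun j => collect_terms (l j).
pose F := undup (flatten [seq s j | j <- enum 'I_n]).
have sF j u : u \in s j -> u \in F.
  by move=> us; rewrite mem_undup; apply/flattenP; exists (s j) => //; apply: map_f; rewrite mem_enum.
exists F, (fun j u => if u \in s j then c j u else 0); split.
  move=> u; rewrite mem_undup => /flattenP [_ /mapP [j _ ->] us].
  have [_ sl _ _] := hc j; have [p pl <-] := sl u us.
  by apply/rank0_weight; apply: h1 pl.
move=> t j ht; have [uq _ _ e1] := hc j.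
rewrite h2 (e1 (fun u => torus_char u t)).
rewrite [RHS](bigID (fun u => u \in s j)) /= [X in _ + X]big1 ?addr0 => [|u /negPf ->]; last by rewrite mul0r.
rewrite -[RHS]big_filter; transitivity (\sum_(u <- filter (mem (s j)) F) c j u * torus_char u t).
  apply: perm_big; apply: uniq_perm => //; first by rewrite filter_uniq // undup_uniq.
  by move=> u; rewrite mem_filter /=; case: (boolP (u \in s j)) => //= /sF ->.
by apply: eq_big_seq => u; rewrite mem_filter => /andP[/= us _]; rewrite us.
Qed.
End Rank0Param.

(** * Morphisms defined by characters *)

Section CharacterMaps.
Variables (K : closedFieldType) (n : nat) (X : pset K n).
Hypotheses (charK : has_pchar0 K) (affX : affine_variety X).

(** A map into X is built by prescribing the values v u of the characters: f t is
    char_map F c (fun u => torus_char u t) for the coefficients c of f. *)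
Definition char_map (F : seq 'rV[int]_2) (c : 'I_n -> 'rV[int]_2 -> K)
    (v : 'rV[int]_2 -> K) : 'rV[K]_n := \row_i \sum_(u <- F) c i u * v u.

(** A polynomial map sends the closure of D into that of the image of D. *)
Lemma closed_dense_map m (Y D : pset K m) (g : 'rV[K]_m -> 'rV[K]_n) :
  dense_in Y D -> (forall j, pfun (fun y => g y 0 j)) ->
  (forall y, D y -> X (g y)) -> forall y, Y y -> X (g y).
Proof.
move=> dD pg gD y Yy; have [S hS] := affX.1; apply/hS => P SP.
have [Q hQ] := pfun_comp (pfun_ev P) pg; rewrite hQ; apply: (dD Q) Yy => z Dz.
by rewrite -hQ; apply: (proj1 (hS _) (gD z Dz)).
Qed.

(** The torus acts by multiplying each character u by torus_char u s. *)
Lemma param_toric f : toric_param X f -> toric X.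
Proof.
move=> tp; have [F [c [wF hf]]] := tp_coords tp.
pose act t x := char_map F c (fun u => torus_char u t * (if u \in F then chi f u x else 0)).
have act_f s t : torus s -> torus t -> act s (f t) = f (tmul s t).
  move=> hs ht; apply/rowP => i; rewrite mxE hf; last exact: torus_tmul.
  by apply: eq_big_seq => u uF; rewrite uF (chi_param tp) // tchar_tmul.
have pact t j : pfun (fun x => act t x 0 j).
  apply: (pfun_ext (f := fun x => \sum_(u <- F) c j u * (torus_char u t * (if u \in F then chi f u x else 0)))).
    by move=> x; rewrite mxE.
  apply: pfun_sum => u; apply: pfunM; first exact: pfun_const.
  apply: pfunM; first exact: pfun_const.
  by case: (boolP (u \in F)) => [/wF|_]; [apply: chi_pfun | apply: pfun_const].
have dD := tp_dense affX tp.
have actX t x : torus t -> X x -> X (act t x).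
  move=> ht; apply: (closed_dense_map dD (pact t)) => y [s [hs ->]].
  by rewrite act_f //; apply: (tp_in tp); apply: torus_tmul.
have act_eq (g h : 'rV[K]_n -> 'rV[K]_n) : (forall j, pfun (fun x => g x 0 j)) -> (forall j, pfun (fun x => h x 0 j)) ->
    (forall t, torus t -> g (f t) = h (f t)) -> forall x, X x -> g x = h x.
  move=> pg ph e x Xx; apply/rowP => j; move: x Xx.
  apply: (tp_eq affX tp); [exact: coordinate_ring_pfun | exact: coordinate_ring_pfun |].
  by move=> t ht; rewrite e.
have comp s t j : pfun (fun x => act s (act t x) 0 j).
  exact: (pfun_comp (pact s j) (pact t)).
have f1 : f (torus_one K 2) = act (torus_one K 2) (f (torus_one K 2)).
  by rewrite act_f ?tmul1 //; apply: torus_one_in.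
exists act, (f (torus_one K 2)); split.
- split=> [z [ht Xx]|j]; first exact: actX.
  apply: (regular_ext (f := fun z : 'rV_(2 + n) => \sum_(u <- F) c j u * (torus_char u (lsubmx z) *
    (if u \in F then chi f u (rsubmx z) else 0)))); first by move=> z _; rewrite mxE.
  apply: regular_sum => u; apply: regularM; first by apply: regular_pfun; apply: pfun_const.
  apply: regularM; last first.
    apply: regular_pfun; case: (boolP (u \in F)) => [/wF|_]; last exact: pfun_const.
    by move=> wu; apply: (pfun_comp (chi_pfun wu)) => k; apply: pfun_rsubmx.
  apply: (regular_ext (f := fun z : 'rV_(2 + n) => \prod_i lsubmx z 0 i ^ u 0 i)) => //.
  apply: regular_prod => i; apply: regularXz; first by move=> z [ht _].
  by apply: regular_pfun; apply: pfun_lsubmx.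
- apply: act_eq => //; first by move=> j; apply: pfun_coord.
  by move=> t ht; rewrite act_f ?tmul1 //; apply: torus_one_in.
- move=> s t x hs ht; move: x; apply: act_eq => //.
  move=> r hr; rewrite !act_f //; try exact: torus_tmul.
  by congr f; apply/rowP => i; rewrite !mxE mulrA.
- move=> t ht h; have X1 : X (f (torus_one K 2)) by apply: (tp_in tp); apply: torus_one_in.
  have := h _ X1; rewrite act_f //; last exact: torus_one_in.
  by rewrite tmulC tmul1 => /(tp_inj tp); apply => //; apply: torus_one_in.
- by apply: (tp_in tp); apply: torus_one_in.
- apply: (open_ext _ (tp_open tp)) => x; split=> -[t [ht ->]]; exists t; split=> //;
  by rewrite act_f //; [rewrite tmulC tmul1 | apply: torus_one_in].
Qed.

(** A homomorphism from the lattice to the multiplicative group is the evaluation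
    at a point of the torus. *)
Lemma torus_char_hom (h : 'rV[int]_2 -> K) :
  (forall u v, h (u + v) = h u * h v) -> (forall u, h u != 0) ->
  forall u, torus_char u (vec2 (h (vec2 1 0)) (h (vec2 0 1))) = h u.
Proof.
move=> hD hn u; have h0 : h 0 = 1 by apply: (mulfI (hn 0)); rewrite -hD addr0 mulr1.
have hN v : h (- v) = (h v)^-1 by apply: (mulfI (hn v)); rewrite -hD subrr h0 divff.
have hMn v k : h (v *+ k) = h v ^+ k.
  by elim: k => [|k IH]; rewrite ?mulr0n ?h0 // mulrS hD IH exprS.
have pow v (k : int) : h v ^ k = h (v *~ k).
  case: k => k; first by rewrite -exprnP -hMn.
  by rewrite NegzE -invr_expz -exprnP -hMn -hN.
rewrite torus_charE !vec2E !pow -hD; congr h.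
by apply: row2P; rewrite !mxE -!scaler_int !mxE /= ?mulr1 ?mulr0 ?addr0 ?add0r ?intz.
Qed.

(** On the torus the map sends t to the point whose coordinates are the characters
    th (1, 0) and th (0, 1) of t; it is polynomial because it acts on characters
    by th, and by density it maps X to X. *)
Lemma param_map f1 f2 (th : 'rV[int]_2 -> 'rV[int]_2) :
  toric_param X f1 -> toric_param X f2 ->
  {morph th : u v / u + v} -> 
  (forall u, weight_monoid f1 u -> weight_monoid f2 (th u)) ->
  exists G : 'rV[K]_n -> 'rV[K]_n, [/\ forall j, pfun (fun x => G x 0 j), forall x, X x -> X (G x)
    & forall u x, weight_monoid f1 u -> X x -> chi f1 u (G x) = chi f2 (th u) x].
Proof.
move=> tp1 tp2 thD w12; have [F [c [wF hf]]] := tp_coords tp1.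
pose G x := char_map F c (fun u => if u \in F then chi f2 (th u) x else 0).
have pG j : pfun (fun x => G x 0 j).
  apply: (pfun_ext (f := fun x => \sum_(u <- F) c j u * (if u \in F then chi f2 (th u) x else 0))).
    by move=> x; rewrite mxE.
  apply: pfun_sum => u; apply: pfunM; first exact: pfun_const.
  by case: (boolP (u \in F)) => [/wF/w12|_]; [apply: chi_pfun | apply: pfun_const].
have thE (t : 'rV[K]_2) u : torus t -> torus_char u (vec2 (torus_char (th (vec2 1 0)) t) (torus_char (th (vec2 0 1)) t))
    = torus_char (th u) t.
  move=> ht; rewrite (@torus_char_hom (fun u => torus_char (th u) t)) // => [v w|v].
    by rewrite thD tcharD.
  exact: tchar_neq0.
pose tau (t : 'rV[K]_2) := vec2 (torus_char (th (vec2 1 0)) t) (torus_char (th (vec2 0 1)) t).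
have tauT t : torus t -> torus (tau t).
  by move=> ht; apply: ord2_ind; rewrite !vec2E tchar_neq0.
have Gf t : torus t -> G (f2 t) = f1 (tau t).
  move=> ht; apply/rowP => i; rewrite mxE hf; last exact: tauT.
  by apply: eq_big_seq => u uF; rewrite uF (chi_param tp2) // thE.
have GX x : X x -> X (G x).
  apply: (closed_dense_map (tp_dense affX tp2) pG) => y [t [ht ->]].
  by rewrite Gf //; apply: (tp_in tp1); apply: tauT.
exists G; split=> // u x wu; move: x; apply: (tp_eq affX tp2).
- by apply: coordinate_ring_pfun; apply: (pfun_comp (chi_pfun wu)).
- by apply: chi_cr; apply: w12.
- by move=> t ht; rewrite Gf // (chi_param tp1) ?(chi_param tp2) ?thE //; apply: tauT.
Qed.

Lemma param_iso f1 f2 (th th' : 'rV[int]_2 -> 'rV[int]_2) :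
  toric_param X f1 -> toric_param X f2 ->
  {morph th : u v / u + v} -> cancel th th' -> cancel th' th ->
  (forall u, weight_monoid f1 u <-> weight_monoid f2 (th u)) ->
  exists G G' : 'rV[K]_n -> 'rV[K]_n, isomorphism X X G G' /\
    forall u x, weight_monoid f1 u -> X x -> chi f1 u (G x) = chi f2 (th u) x.
Proof.
move=> tp1 tp2 thD thK th'K w12.
have th'D : {morph th' : u v / u + v}.
  by move=> u v; apply: (can_inj thK); rewrite thD !th'K.
have w21 v : weight_monoid f2 v -> weight_monoid f1 (th' v) by move=> wv; apply/w12; rewrite th'K.
have [|G [pG GX hG]] := @param_map f1 f2 th tp1 tp2 thD; first by move=> u /w12.
have [|G' [pG' GX' hG']] := @param_map f2 f1 th' tp2 tp1 th'D; first exact: w21.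
exists G, G'; split=> //; split.
- by split=> // j; apply: regular_pfun.
- by split=> // j; apply: regular_pfun.
- move=> x Xx; apply: (chi_separate affX tp2) => //; first by apply: GX'; apply: GX.
  move=> v wv; rewrite hG' ?hG ?th'K //; [exact: w21 | exact: GX].
- move=> x Xx; apply: (chi_separate affX tp1) => //; first by apply: GX; apply: GX'.
  by move=> u wu; rewrite hG ?hG' ?thK //; [apply/w12 | apply: GX'].
Qed.
End CharacterMaps.

(** * Saturated submonoids of the plane lattice *)

Definition det2 (u v : 'rV[int]_2) : int := u 0 0 * v 0 1 - u 0 1 * v 0 0.

Definition primitive (p : 'rV[int]_2) := coprimez (p 0 0) (p 0 1).

Inductive cone_type (S : 'rV[int]_2 -> Prop) : Prop :=
| WholePlane of forall u, S u
| HalfPlane p of primitive p & forall u, S u <-> 0 <= pairing p u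
| Pointed p q of primitive p & primitive q & 0 < det2 p q &
    forall u, S u <-> 0 <= pairing p u /\ 0 <= pairing q u.

Section ConeType.
Variables (S : 'rV[int]_2 -> Prop).
Hypotheses (S0 : S 0) (SD : forall u v, S u -> S v -> S (u + v)).
Hypothesis Ssat : forall u k, (0 < k)%N -> S (u *+ k) -> S u.

Lemma cone_scale (k : int) u : 0 <= k -> S u -> S (k *: u).
Proof.
case: k => // k _ Su; have -> : (k : int) *: u = u *+ k by rewrite -scaler_nat natz.
by elim: k => [|k IH]; rewrite ?mulr0n ?mulrS //; apply: SD.
Qed.

Lemma cone_unscale (k : int) u : 0 < k -> S (k *: u) -> S u.
Proof.
case: k => // k k0; have -> : (k : int) *: u = u *+ k by rewrite -scaler_nat natz.
exact: Ssat.
Qed.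

Lemma det2_cramer a b u : det2 a b *: u = det2 u b *: a + det2 a u *: b.
Proof. by apply: row2P; rewrite !mxE /det2; ring. Qed.

Lemma det2_plucker a b u v : det2 a b * det2 u v = det2 u b * det2 a v + det2 a u * det2 b v.
Proof. by rewrite /det2; ring. Qed.

Lemma det2_aa a : det2 a a = 0. Proof. by rewrite /det2; ring. Qed.

Lemma det2Nl a b : det2 (- a) b = - det2 a b. Proof. by rewrite /det2 !mxE; ring. Qed.

Lemma det2C a b : det2 b a = - det2 a b. Proof. by rewrite /det2; ring. Qed.

Lemma det2Dr a b c : det2 a (b + c) = det2 a b + det2 a c.
Proof. by rewrite /det2 !mxE; ring. Qed.

Lemma det2Dl a b c : det2 (b + c) a = det2 b a + det2 c a.
Proof. by rewrite /det2 !mxE; ring. Qed.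

(** The cone spanned by a finite subset G of S has one of three shapes, described
    by extreme elements of S. *)
Inductive cone_over (G : seq 'rV[int]_2) : Prop :=
| OverAll of forall u, S u
| OverHalf a c of S a & S (- a) & S c & 0 < det2 a c & forall g, g \in G -> 0 <= det2 a g
| OverPointed a b of S a & S b & 0 < det2 a b &
    forall g, g \in G -> 0 <= det2 a g /\ 0 <= det2 g b.

Lemma cone_combine (d x y : int) u a b : 0 < d -> d *: u = x *: a + y *: b ->
  S (x *: a) -> S (y *: b) -> S u.
Proof. by move=> d0 e Sa Sb; apply: (cone_unscale d0); rewrite e; apply: SD. Qed.

Lemma cone_signed (x : int) a : S a -> S (- a) -> S (x *: a).
Proof.
move=> Sa SNa; case: (leP 0 x) => x0; first exact: cone_scale.
have -> : x *: a = (- x) *: (- a) by rewrite scalerN scaleNr opprK.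
by apply: cone_scale => //; rewrite oppr_ge0 ltW.
Qed.

Lemma cone_all a b : S a -> S (- a) -> S b -> S (- b) -> 0 < det2 a b -> forall u, S u.
Proof.
move=> Sa SNa Sb SNb d0 u.
by apply: (cone_combine d0 (det2_cramer a b u)); apply: cone_signed.
Qed.

Lemma cone_opp (d x y : int) a b g : 0 < d -> x < 0 -> y <= 0 -> S b -> S g ->
  d *: g = x *: a + y *: b -> S (- a).
Proof.
move=> d0 x0 y0 Sb Sg e.
apply: (@cone_unscale (- x)); first by rewrite oppr_gt0.
have -> : (- x) *: (- a) = d *: g + (- y) *: b.
  by rewrite e scalerN scaleNr opprK scaleNr addrK.
by apply: SD; apply: cone_scale => //; rewrite ?oppr_ge0 // ltW.
Qed.

(** A new vector g lies in the cone, enlarges it on one side, or is opposite to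
    part of it; the signs of det2 a g and det2 g b tell which. *)
Lemma cone_over_cons g G : S g -> cone_over G -> cone_over (g :: G).
Proof.
move=> Sg [all|a c Sa SNa Sc d0 hG|a b Sa Sb d0 hG]; first exact: OverAll.
  case: (leP 0 (det2 a g)) => hg.
    by apply: (OverHalf Sa SNa Sc d0) => h; rewrite inE => /orP[/eqP ->|/hG].
  apply: OverAll; apply: (cone_all Sa SNa Sc _ d0).
  apply: (@cone_unscale (- det2 a g)); first by rewrite oppr_gt0.
  have -> : (- det2 a g) *: (- c) = det2 a c *: g + (- det2 g c) *: a.
    by rewrite det2_cramer !scaleNr !scalerN opprK addrAC subrr add0r.
  by apply: SD; [apply: cone_scale => //; apply: ltW | apply: cone_signed].
have cr := det2_cramer a b g.
case: (ltgtP (det2 g b) 0) => x0; case: (ltgtP (det2 a g) 0) => y0.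
- apply: OverAll; apply: (cone_all Sa _ Sb _ d0).
    by apply: (cone_opp d0 x0 (ltW y0) Sb Sg cr).
  by apply: (cone_opp d0 y0 (ltW x0) Sa Sg); rewrite cr addrC.
- apply: (OverPointed Sa Sg y0) => h; rewrite inE => /orP[/eqP ->|/hG [h1 h2]].
    by rewrite det2_aa; split=> //; apply: ltW.
  have hb : 0 <= det2 b g by rewrite det2C oppr_ge0 ltW.
  by split=> //; rewrite -(pmulr_rge0 _ d0) det2_plucker addr_ge0 // mulr_ge0 // ltW.
- apply: (OverHalf Sa _ Sb d0).
    by apply: (cone_opp d0 x0 _ Sb Sg cr); rewrite y0.
  by move=> h; rewrite inE => /orP[/eqP ->|/hG []//]; rewrite y0.
- apply: (OverPointed Sg Sb x0) => h; rewrite inE => /orP[/eqP ->|/hG [h1 h2]].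
    by rewrite det2_aa; split=> //; apply: ltW.
  split=> //; rewrite -(pmulr_rge0 _ d0).
  have -> : det2 a b * det2 g h = det2 g b * det2 a h + (- det2 a g) * det2 h b.
    by rewrite /det2; ring.
  by rewrite addr_ge0 // mulr_ge0 // ?oppr_ge0 // ltW.
- apply: (OverPointed Sa Sb d0) => h; rewrite inE => /orP[/eqP ->|/hG //].
  by split; apply: ltW.
- apply: (OverPointed Sa Sb d0) => h; rewrite inE => /orP[/eqP ->|/hG //].
  by rewrite y0; split=> //; apply: ltW.
- have d0' : 0 < det2 (- b) a by rewrite det2Nl -det2C.
  apply: (OverHalf _ _ Sa d0').
  + by apply: (@cone_opp _ _ (det2 g b) _ _ _ d0 y0 _ Sa Sg); [rewrite x0 | rewrite cr addrC].
  + by rewrite opprK.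
  + by move=> h; rewrite inE det2Nl -det2C => /orP[/eqP ->|/hG []//]; rewrite x0.
- apply: (OverPointed Sa Sb d0) => h; rewrite inE => /orP[/eqP ->|/hG //].
  by rewrite x0; split=> //; apply: ltW.
- apply: (OverPointed Sa Sb d0) => h; rewrite inE => /orP[/eqP ->|/hG //].
  by rewrite x0 y0.
Qed.

Lemma primitive_part (a : 'rV[int]_2) : a != 0 -> exists2 g : int, 0 < g &
  exists2 p, primitive p & a = g *: p.
Proof.
move=> na; pose g := gcdz (a 0 0) (a 0 1).
have g0 : g != 0.
  rewrite gcdz_eq0; apply: contraNN na => /andP[/eqP h0 /eqP h1].
  by apply/eqP/row2P; rewrite !mxE.
have gp : 0 < g by rewrite lt_def g0.
exists g => //; exists (vec2 (divz (a 0 0) g) (divz (a 0 1) g)).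
  rewrite /primitive !vec2E /coprimez; apply/eqP/(mulfI g0).
  have -> : g * gcdz (divz (a 0 0) g) (divz (a 0 1) g) = gcdz (g * (divz (a 0 0) g)) (g * (divz (a 0 1) g)).
    by rewrite -mulz_gcdr gtz0_abs.
  by rewrite ![g * _]mulrC !divzK ?dvdz_gcdl ?dvdz_gcdr // mul1r.
by apply: row2P; rewrite !mxE /= mulrC divzK // ?dvdz_gcdl ?dvdz_gcdr.
Qed.

Lemma det2Zl g a b : det2 (g *: a) b = g * det2 a b. Proof. by rewrite /det2 !mxE; ring. Qed.
Lemma det2Zr g a b : det2 a (g *: b) = g * det2 a b. Proof. by rewrite /det2 !mxE; ring. Qed.

(** Two independent elements of S start the construction of the cone over the
    generators; saturation makes S the set of all lattice points of this cone. *)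
Theorem cone_typeP F : (forall u, S u <-> generated F u) ->
  (forall u, exists v w, [/\ S v, S w & u = v - w]) -> cone_type S.
Proof.
move=> SF full.
have [a [b [Sa Sb d0]]] : exists a b, [/\ S a, S b & 0 < det2 a b].
  suff [a [b [Sa Sb nd]]] : exists a b, [/\ S a, S b & det2 a b != 0].
    case: (ltgtP 0 (det2 a b)) => [lt|gt|e]; last by rewrite -e eqxx in nd.
      by exists a, b.
    by exists b, a; rewrite det2C oppr_gt0.
  have [v [w [Sv Sw e1]]] := full (vec2 1 0); have [v' [w' [Sv' Sw' e2]]] := full (vec2 0 1).
  have D : det2 (v - w) (v' - w') = 1 by rewrite -e1 -e2 /det2 !mxE.
  have exp : det2 v v' - det2 v w' - det2 w v' + det2 w w' = 1 by rewrite -D /det2 !mxE; ring.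
  case: (eqVneq (det2 v v') 0) => [z1|n]; last by exists v, v'.
  case: (eqVneq (det2 v w') 0) => [z2|n]; last by exists v, w'.
  case: (eqVneq (det2 w v') 0) => [z3|n]; last by exists w, v'.
  case: (eqVneq (det2 w w') 0) => [z4|n]; last by exists w, w'.
  by move: exp; rewrite z1 z2 z3 z4.
(* The cone spanned by a and b is the starting point. *)
have over : forall G, (forall g, g \in G -> S g) -> cone_over G.
  elim=> [_|g G IH hG]; first by apply: (OverPointed Sa Sb d0).
  apply: cone_over_cons; first by apply: hG; rewrite mem_head.
  by apply: IH => h hh; apply: hG; rewrite inE hh orbT.
have nz_l x y : 0 < det2 x y -> x != 0.
  by apply: contraTneq => ->; rewrite /det2 !mxE !mul0r subrr ltxx.
have nz_r x y : 0 < det2 x y -> y != 0.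
  by apply: contraTneq => ->; rewrite /det2 !mxE !mulr0 subrr ltxx.
case: (over F); first by move=> g gF; apply/SF; apply: generated_in.
- exact: WholePlane.
- move=> {d0}a' c Sa' SNa' Sc d0 hF.
  have [g g0 [p pp ea]] := primitive_part (nz_l _ _ d0).
  apply: (@HalfPlane S (vec2 (- p 0 1) (p 0 0))).
    by rewrite /primitive !vec2E coprimez_sym coprimezN.
  have pE u : pairing (vec2 (- p 0 1) (p 0 0)) u = det2 p u by rewrite pairingE !vec2E /det2; ring.
  have aE u : (0 <= det2 p u) = (0 <= det2 a' u) by rewrite ea det2Zl pmulr_rge0.
  move=> u; rewrite pE aE; split=> [/SF gu|hu].
    apply: (gu (fun u => 0 <= det2 a' u)); first by rewrite /det2 !mxE !mulr0 subrr.
    by move=> x y /hF hx hy; rewrite det2Dr addr_ge0.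
  apply: (cone_combine d0 (det2_cramer a' c u)); first exact: cone_signed.
  exact: cone_scale.
- move=> {d0}a' b' Sa' Sb' d0 hF.
  have [g g0 [p pp ea]] := primitive_part (nz_l _ _ d0).
  have [h h0 [q qp eb]] := primitive_part (nz_r _ _ d0).
  apply: (@Pointed S (vec2 (q 0 1) (- q 0 0)) (vec2 (- p 0 1) (p 0 0))).
  + by rewrite /primitive !vec2E coprimezN coprimez_sym.
  + by rewrite /primitive !vec2E coprimez_sym coprimezN.
  + move: d0; rewrite ea eb det2Zl det2Zr !pmulr_rgt0 //.
    have -> : det2 (vec2 (q 0 1) (- q 0 0)) (vec2 (- p 0 1) (p 0 0)) = det2 p q by rewrite /det2 !vec2E; ring.
    by [].
  have pE u : pairing (vec2 (- p 0 1) (p 0 0)) u = det2 p u by rewrite pairingE !vec2E /det2; ring.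
  have qE u : pairing (vec2 (q 0 1) (- q 0 0)) u = det2 u q by rewrite pairingE !vec2E /det2; ring.
  have aE u : (0 <= det2 p u) = (0 <= det2 a' u) by rewrite ea det2Zl pmulr_rge0.
  have bE u : (0 <= det2 u q) = (0 <= det2 u b') by rewrite eb det2Zr pmulr_rge0.
  move=> u; rewrite pE qE aE bE; split=> [/SF gu|[h1 h2]].
    apply: (gu (fun u => 0 <= det2 u b' /\ 0 <= det2 a' u)); first by rewrite /det2 !mxE !mulr0 !mul0r subrr.
    by move=> x y /hF [x1 x2] [y1 y2]; rewrite det2Dr det2Dl; split; apply: addr_ge0.
  by apply: (cone_combine d0 (det2_cramer a' b' u)); apply: cone_scale.
Qed.
End ConeType.

(** * Coefficients of regular functions *)

Section Coefficients.
Variables (K : closedFieldType) (n : nat) (X : pset K n) (f : 'rV[K]_2 -> 'rV[K]_n).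
Hypotheses (affX : affine_variety X) (tp : toric_param X f).
Notation S := (weight_monoid f).

Lemma coef_exists g : exists sc : seq 'rV[int]_2 * ('rV[int]_2 -> K), coordinate_ring X g ->
  [/\ uniq sc.1, forall u, u \in sc.1 -> S u, forall u, u \notin sc.1 -> sc.2 u = 0
    & forall x, X x -> g x = \sum_(u <- sc.1) sc.2 u * chi f u x].
Proof.
case: (classic (coordinate_ring X g)) => [cg|no]; last by exists ([::], fun=> 0).
have [s [c [us Ss e]]] := chi_span affX tp cg.
exists (s, fun u => if u \in s then c u else 0) => _; split=> //= [u /negPf ->//|x Xx].
by rewrite e //; apply: eq_big_seq => u ->.
Qed.

Definition expansion g := proj1_sig (constructive_indefinite_description _ (coef_exists g)).
Definition supp g := (expansion g).1.
Definition coef g := (expansion g).2.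

Lemma coefP g : coordinate_ring X g ->
  [/\ uniq (supp g), forall u, u \in supp g -> S u, forall u, u \notin supp g -> coef g u = 0
    & forall x, X x -> g x = \sum_(u <- supp g) coef g u * chi f u x].
Proof. exact: (proj2_sig (constructive_indefinite_description _ (coef_exists g))). Qed.

Definition list_fun (l : seq (K * 'rV[int]_2)) (x : 'rV[K]_n) := \sum_(p <- l) p.1 * chi f p.2 x.

Definition in_weights (l : seq (K * 'rV[int]_2)) := forall p, p \in l -> S p.2.

Lemma list_fun_cr l : in_weights l -> coordinate_ring X (list_fun l).
Proof.
move=> hl; apply: coordinate_ring_pfun.
apply: (pfun_ext (f := fun x => \sum_(p <- l) p.1 * (if p \in l then chi f p.2 x else 0))).
  by move=> x; apply: eq_big_seq => p ->.
apply: pfun_sum => p; apply: pfunM; first exact: pfun_const.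
by case: (boolP (p \in l)) => [/hl|_]; [apply: chi_pfun | apply: pfun_const].
Qed.

(** Characters are independent, so the coefficients do not depend on the list. *)
Lemma coef_unique g l : in_weights l -> (forall x, X x -> g x = list_fun l x) ->
  forall u, coef g u = \sum_(p <- l | p.2 == u) p.1.
Proof.
move=> hl e u.
have cg : coordinate_ring X g.
  by apply: coordinate_ring_ext (list_fun_cr hl) => x Xx; rewrite e.
have [us Ss c0 eg] := coefP cg.
pose l' := l ++ [seq (- coef g v, v) | v <- supp g].
have [s [c [us' sl nc hG]]] := collect_terms l'.
have s_nil : s = [::].
  case: s us' sl nc hG => // v s us' sl nc hG.
  have cv0 : c v = 0.
    apply: (chi_independent tp us') (mem_head _ _) => x Xx.
    rewrite -(hG (fun u => chi f u x)) big_cat /= -/(list_fun l x) -e // big_map eg // -big_split.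
    by apply: big1 => w _ /=; rewrite mulNr addrN.
  by have := nc v (mem_head _ _); rewrite cv0 eqxx.
have := hG (fun v => (v == u)%:R); rewrite s_nil big_nil big_cat big_map /= => /eqP.
rewrite addr_eq0 => /eqP H.
have -> : \sum_(p <- l | p.2 == u) p.1 = \sum_(p <- l) p.1 * (p.2 == u)%:R.
  by rewrite [LHS]big_mkcond; apply: eq_bigr => p _; case: eqP; rewrite ?mulr1 ?mulr0.
rewrite H -sumrN; case: (boolP (u \in supp g)) => [ius|nus].
  rewrite (bigD1_seq u) //= eqxx mulr1 opprK big1 ?addr0 // => v /negPf ->.
  by rewrite mulr0 oppr0.
rewrite (c0 _ nus) big_seq big1 // => v vs; case: eqP => [ev0|_]; last by rewrite mulr0 oppr0.
by rewrite -ev0 vs in nus.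
Qed.

Lemma coef_list g : coordinate_ring X g -> exists l, [/\ in_weights l, (forall x, X x -> g x = list_fun l x)
   & forall p, p \in l -> p.1 = coef g p.2].
Proof.
move=> cg; have [us Ss c0 eg] := coefP cg; exists [seq (coef g v, v) | v <- supp g]; split.
- by move=> p /mapP [v /Ss Sv ->].
- by move=> x Xx; rewrite eg // /list_fun big_map.
- by move=> p /mapP [v _ ->].
Qed.

Lemma coef_ext g h : (forall x, X x -> g x = h x) -> coordinate_ring X h -> coef g =1 coef h.
Proof.
move=> e ch u; have [l [hl el _]] := coef_list ch.
by rewrite (coef_unique hl el) (coef_unique hl) // => x Xx; rewrite e ?el.
Qed.

Lemma coef_supp g u : coordinate_ring X g -> coef g u != 0 -> S u /\ u \in supp g.
Proof.
move=> cg; have [us Ss c0 eg] := coefP cg.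
case: (boolP (u \in supp g)) => [ius _|/c0 ->]; last by rewrite eqxx.
by split=> //; apply: Ss.
Qed.

Lemma coef_eq0 g : coordinate_ring X g -> (forall u, coef g u = 0) -> forall x, X x -> g x = 0.
Proof.
move=> cg z x Xx; have [_ _ _ ->] := coefP cg => //.
by apply: big1 => u _; rewrite z mul0r.
Qed.

Lemma coef_chi u w : S u -> coef (chi f u) w = (w == u)%:R.
Proof.
move=> Su; rewrite (@coef_unique _ [:: (1, u)]).
- by rewrite big_cons big_nil /= eq_sym; case: eqP; rewrite ?addr0.
- by move=> p; rewrite inE => /eqP ->.
- by move=> x Xx; rewrite /list_fun big_seq1 mul1r.
Qed.

Lemma coef_chi0 w : coef (fun=> 1) w = (w == 0)%:R.
Proof.
rewrite -(coef_chi w (weight_monoid0 f)); apply: coef_ext; last exact/chi_cr/weight_monoid0.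
by move=> x Xx; rewrite (chi0 affX tp).
Qed.

Lemma coefD g h u : coordinate_ring X g -> coordinate_ring X h ->
  coef (fun x => g x + h x) u = coef g u + coef h u.
Proof.
move=> cg ch; have [l [hl el _]] := coef_list cg; have [m [hm em _]] := coef_list ch.
rewrite (coef_unique hl el) (coef_unique hm em) (@coef_unique _ (l ++ m)) ?big_cat //.
- by move=> p; rewrite mem_cat => /orP[/hl|/hm].
- by move=> x Xx; rewrite el // em // /list_fun big_cat.
Qed.

Lemma coefZ a g u : coordinate_ring X g -> coef (fun x => a * g x) u = a * coef g u.
Proof.
move=> cg; have [l [hl el _]] := coef_list cg.
rewrite (coef_unique hl el) (@coef_unique _ [seq (a * p.1, p.2) | p <- l]) ?big_map ?mulr_sumr //.
- by move=> p /mapP [q /hl Sq ->].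
- by move=> x Xx; rewrite el // /list_fun big_map mulr_sumr; apply: eq_bigr => p _; rewrite mulrA.
Qed.

Lemma cr_D g h : coordinate_ring X g -> coordinate_ring X h -> coordinate_ring X (fun x => g x + h x).
Proof. by move=> [P hP] [Q hQ]; exists (P + Q) => x Xx; rewrite /ev mevalD hP ?hQ. Qed.

Lemma cr_M g h : coordinate_ring X g -> coordinate_ring X h -> coordinate_ring X (fun x => g x * h x).
Proof. by move=> [P hP] [Q hQ]; exists (P * Q) => x Xx; rewrite /ev mevalM hP ?hQ. Qed.

Lemma cr_Z a g : coordinate_ring X g -> coordinate_ring X (fun x => a * g x).
Proof. by move=> cg; apply: cr_M cg; apply/coordinate_ring_pfun/pfun_const. Qed.

Lemma cr_sum (T : Type) (r : seq T) (g : T -> 'rV[K]_n -> K) : (forall i, coordinate_ring X (g i)) ->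
  coordinate_ring X (fun x => \sum_(i <- r) g i x).
Proof.
move=> cg; elim: r => [|i r IH].
  by apply: coordinate_ring_ext (coordinate_ring_pfun X (pfun_const n 0)) => x _; rewrite big_nil.
by apply: coordinate_ring_ext (cr_D (cg i) IH) => x _; rewrite big_cons.
Qed.

Lemma coef_sum (T : Type) (r : seq T) (a : T -> K) (g : T -> 'rV[K]_n -> K) u :
  (forall i, coordinate_ring X (g i)) ->
  coef (fun x => \sum_(i <- r) a i * g i x) u = \sum_(i <- r) a i * coef (g i) u.
Proof.
move=> cg; elim: r => [|i r IH].
  rewrite big_nil (@coef_unique _ [::]) ?big_nil // => x _.
  by rewrite /list_fun !big_nil.
rewrite big_cons -IH -coefZ // -coefD; [|exact: cr_Z|by apply: cr_sum => j; apply: cr_Z].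
apply: coef_ext; first by move=> x Xx; rewrite big_cons.
by apply: cr_D; [apply: cr_Z | apply: cr_sum => j; apply: cr_Z].
Qed.

Lemma list_funM l m : in_weights l -> in_weights m ->
  in_weights [seq (p.1 * q.1, p.2 + q.2) | p <- l, q <- m] /\
  forall x, X x -> list_fun l x * list_fun m x = list_fun [seq (p.1 * q.1, p.2 + q.2) | p <- l, q <- m] x.
Proof.
move=> hl hm; split.
  move=> p /allpairsP [[p1 p2]] /= [/hl h1 /hm h2 ->]; exact: weight_monoidD.
move=> x Xx; rewrite /list_fun big_allpairs_dep mulr_suml big_seq [RHS]big_seq; apply: eq_bigr => p pl.
rewrite mulr_sumr big_seq [RHS]big_seq; apply: eq_bigr => q qm /=.
rewrite (chiD affX tp) //; [exact: mulrACA | exact: hl | exact: hm].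
Qed.

Lemma coef_mul_supp g h w : coordinate_ring X g -> coordinate_ring X h ->
  coef (fun x => g x * h x) w != 0 -> exists a b, [/\ w = a + b, coef g a != 0 & coef h b != 0].
Proof.
move=> cg ch; have [l [hl el lc]] := coef_list cg; have [m [hm em mc]] := coef_list ch.
have [hlm elm] := list_funM hl hm.
rewrite (coef_unique hlm) => [nz|x Xx]; last by rewrite el // em // elm.
apply: NNPP => no; case/negP: nz; apply/eqP; rewrite big_seq_cond big1 // => p.
case/andP => /allpairsP [[p1 p2]] /= [pl pm ->] /= /eqP ew.
apply/eqP; apply: contraT; rewrite mulf_eq0 negb_or => /andP[n1 n2]; case: no.
by exists p1.2, p2.2; rewrite -lc // -mc.
Qed.

Lemma coef_chiM u g w : S u -> coordinate_ring X g ->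
  coef (fun x => chi f u x * g x) (u + w) = coef g w.
Proof.
move=> Su cg; have [l [hl el _]] := coef_list cg.
rewrite (coef_unique hl el) (@coef_unique _ [seq (p.1, u + p.2) | p <- l]).
- by rewrite big_map; apply: eq_bigl => p /=; rewrite (inj_eq (addrI u)).
- by move=> p /mapP [q /hl Sq ->]; apply: weight_monoidD.
- move=> x Xx; rewrite el // /list_fun big_map mulr_sumr big_seq [RHS]big_seq; apply: eq_bigr => p /hl Sp /=.
  by rewrite (chiD affX tp) // mulrCA.
Qed.

(** The derivation of K[X] multiplying each character u by c u. *)
Definition euler (c : 'rV[int]_2 -> K) g (x : 'rV[K]_n) :=
  \sum_(u <- supp g) c u * coef g u * chi f u x.

Lemma euler_cr c g : coordinate_ring X g -> coordinate_ring X (euler c g).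
Proof.
move=> cg; have [us Ss c0 eg] := coefP cg.
apply: (@coordinate_ring_ext _ _ _ (list_fun [seq (c u * coef g u, u) | u <- supp g])).
  by move=> x Xx; rewrite /list_fun big_map.
by apply: list_fun_cr => p /mapP [u /Ss Su ->].
Qed.

Lemma coef_euler c g u : coordinate_ring X g -> coef (euler c g) u = c u * coef g u.
Proof.
move=> cg; have [us Ss c0 eg] := coefP cg.
rewrite (@coef_unique _ [seq (c u * coef g u, u) | u <- supp g]).
- rewrite big_map /=; case: (boolP (u \in supp g)) => [ius|nus].
    by rewrite big_mkcond (bigD1_seq u) //= eqxx big1 ?addr0 // => v /negPf ->.
  rewrite c0 // mulr0 big_seq_cond big1 // => v /andP[vs /eqP ev0].
  by rewrite -ev0 vs in nus.
- by move=> p /mapP [v /Ss Sv ->].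
- by move=> x Xx; rewrite /list_fun big_map.
Qed.

Lemma coef_inj g h : coordinate_ring X g -> coordinate_ring X h -> coef g =1 coef h ->
  forall x, X x -> g x = h x.
Proof.
move=> cg ch e x Xx; apply/eqP; rewrite -subr_eq0; apply/eqP; rewrite -mulN1r.
apply: (coef_eq0 (g := fun x => g x + -1 * h x)) => // [|u]; first by apply: cr_D => //; apply: cr_Z.
by rewrite coefD ?coefZ ?e ?mulN1r ?subrr //; apply: cr_Z.
Qed.

Lemma euler_list c g l : in_weights l -> (forall x, X x -> g x = list_fun l x) ->
  forall x, X x -> euler c g x = list_fun [seq (c p.2 * p.1, p.2) | p <- l] x.
Proof.
move=> hl e; have hl' : in_weights [seq (c p.2 * p.1, p.2) | p <- l] by move=> p /mapP [q /hl Sq ->].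
have cg : coordinate_ring X g by apply: coordinate_ring_ext (list_fun_cr hl) => x Xx; rewrite e.
apply: coef_inj; [exact: euler_cr | exact: list_fun_cr | move=> u].
rewrite coef_euler // (coef_unique hl e) (coef_unique hl') // big_map mulr_sumr.
by apply: eq_bigr => p /eqP ->.
Qed.

(** The Leibniz rule holds because c is additive. *)
Lemma eulerM c g h : {morph c : u v / u + v} -> coordinate_ring X g -> coordinate_ring X h ->
  forall x, X x -> euler c (fun x => g x * h x) x = g x * euler c h x + h x * euler c g x.
Proof.
move=> cD cg ch x Xx; have [l [hl el _]] := coef_list cg; have [m [hm em _]] := coef_list ch.
have [hlm elm] := list_funM hl hm.
have egh y : X y -> g y * h y = list_fun [seq (p.1 * q.1, p.2 + q.2) | p <- l, q <- m] y.
  by move=> Xy; rewrite el // em // elm.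
rewrite (euler_list c hlm egh) // (euler_list c hl el) // (euler_list c hm em) // el // em //.
rewrite /list_fun !big_map big_allpairs_dep /= mulr_suml [X in _ + X]mulr_sumr -big_split /=.
rewrite big_seq [RHS]big_seq; apply: eq_bigr => p pl.
rewrite mulr_sumr mulr_suml -big_split /= big_seq [RHS]big_seq; apply: eq_bigr => q qm /=.
rewrite (chiD affX tp) //; [rewrite cD; ring | exact: hl | exact: hm].
Qed.

End Coefficients.

(** * Uniqueness of the toric structure: units *)

Section LatticeFacts.

Definition rot (p : 'rV[int]_2) : 'rV[int]_2 := vec2 (- p 0 1) (p 0 0).

Lemma pairing_rot (p q : 'rV[int]_2) : pairing q (rot p) = det2 p q.
Proof. by rewrite pairingE !vec2E /det2; ring. Qed.

Lemma pairing_rot0 (p : 'rV[int]_2) : pairing p (rot p) = 0.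
Proof. by rewrite pairing_rot det2_aa. Qed.

Lemma pairingZr (p u : 'rV[int]_2) (k : int) : pairing p (k *: u) = k * pairing p u.
Proof. by rewrite !pairingE !mxE; ring. Qed.

Lemma pairing0r (p : 'rV[int]_2) : pairing p 0 = 0.
Proof. by rewrite pairingE !mxE !mulr0 addr0. Qed.

Lemma primitive_bezout (p : 'rV[int]_2) : primitive p -> exists a, pairing p a = 1.
Proof.
case/coprimezP => -[x y] /= h; exists (vec2 x y); rewrite pairingE !vec2E -h; ring.
Qed.

Lemma primitive_kernel (p u : 'rV[int]_2) : primitive p -> pairing p u = 0 -> exists k : int, u = k *: rot p.
Proof.
move=> /primitive_bezout [a]; rewrite !pairingE => ha hu.
exists (a 0 0 * u 0 1 - a 0 1 * u 0 0); apply: row2P; rewrite !mxE /=.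
  rewrite -[LHS]mul1r -ha; apply/eqP; rewrite -subr_eq0; apply/eqP.
  by transitivity (a 0 0 * (p 0 0 * u 0 0 + p 0 1 * u 0 1)); [ring | rewrite hu mulr0].
rewrite -[LHS]mul1r -ha; apply/eqP; rewrite -subr_eq0; apply/eqP.
by transitivity (a 0 1 * (p 0 0 * u 0 0 + p 0 1 * u 0 1)); [ring | rewrite hu mulr0].
Qed.

Lemma primitive_neq0 (p : 'rV[int]_2) : primitive p -> p != 0.
Proof.
move=> /primitive_bezout [a]; apply: contra_eq_neq => ->.
by rewrite pairingE !mxE !mul0r addr0 eq_sym oner_eq0.
Qed.

Lemma pointed_coords (p q u : 'rV[int]_2) : det2 p q *: u = pairing q u *: rot p - pairing p u *: rot q.
Proof. by apply: row2P; rewrite !pairingE !mxE /= /det2; ring. Qed.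

Lemma pairing_inj (p q u v : 'rV[int]_2) : 0 < det2 p q ->
  pairing p u = pairing p v -> pairing q u = pairing q v -> u = v.
Proof.
move=> d0 hp hq; have nd : det2 p q != 0 by rewrite gt_eqF.
have E : det2 p q *: u = det2 p q *: v by rewrite !pointed_coords hp hq.
apply: row2P; apply: (mulfI nd).
  by have := congr1 (fun m : 'rV_2 => m 0 0) E; rewrite !mxE.
by have := congr1 (fun m : 'rV_2 => m 0 1) E; rewrite !mxE.
Qed.
End LatticeFacts.

Section UnitConst.
Variables (K : closedFieldType) (n : nat) (X : pset K n).
Hypotheses (affX : affine_variety X).

Lemma one_param1 p : one_param p (1 : K) = torus_one K 2.
Proof. by apply/rowP => i; rewrite !mxE exp1rz. Qed.

(** P Q = 1 holds as polynomials, as it holds at infinitely many points. *)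
Lemma invertible_poly_const (P Q : {poly K}) : (forall l, l != 0 -> P.[l] * Q.[l] = 1) ->
  forall l, P.[l] = P.[1].
Proof.
move=> h; have PQ : P * Q = 1.
  apply/eqP; rewrite -subr_eq0; apply: contraT => /nonroot_avoid [x nx].
  by rewrite rootE !hornerE h // subrr eqxx.
have nP : P != 0 by apply/eqP => P0; move/eqP: PQ; rewrite P0 mul0r eq_sym oner_eq0.
have nQ : Q != 0 by apply/eqP => P0; move/eqP: PQ; rewrite P0 mulr0 eq_sym oner_eq0.
have := congr1 (fun r : {poly K} => size r) PQ; rewrite size_mul // size_poly1 => sz.
have : (size P <= 1)%N.
  by move: sz nP nQ; rewrite -!size_poly_gt0; case: (size P) => // a; case: (size Q) => // b; lia.
by move/size1_polyC => -> l; rewrite !hornerC.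
Qed.

Lemma tp_one_param_poly f p g t : toric_param X f -> (forall u, weight_monoid f u -> 0 <= pairing p u) ->
  coordinate_ring X g -> torus t ->
  exists P : {poly K}, forall l, l != 0 -> g (f (tmul (one_param p l) t)) = P.[l].
Proof.
move=> tp hp cg ht; have [s [c [us Ss e]]] := chi_span affX tp cg.
exists (\sum_(u <- s) (c u * torus_char u t) *: 'X^(absz (pairing p u))) => l nl.
have hl : torus (tmul (one_param p l) t) by apply: torus_tmul => //; apply: one_param_torus.
rewrite e; last exact: (tp_in tp).
rewrite horner_sum; apply: eq_big_seq => u /Ss Su.
rewrite (chi_param tp) // tchar_tmul tchar_one_param // hornerZ hornerXn.
have := hp u Su; case: (pairing p u) => // k _; rewrite -exprnP /=; ring.
Qed.

(** Invertible regular functions are constant along one-parameter subgroups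
    that have a limit in X. *)
Lemma unit_const f p g h t l : toric_param X f -> (forall u, weight_monoid f u -> 0 <= pairing p u) ->
  coordinate_ring X g -> coordinate_ring X h -> (forall x, X x -> g x * h x = 1) ->
  torus t -> l != 0 -> g (f (tmul (one_param p l) t)) = g (f t).
Proof.
move=> tp hp cg ch gh ht nl.
have [P hP] := tp_one_param_poly tp hp cg ht; have [Q hQ] := tp_one_param_poly tp hp ch ht.
have PQ k : k != 0 -> P.[k] * Q.[k] = 1.
  move=> nk; rewrite -hP // -hQ // gh //; apply: (tp_in tp); apply: torus_tmul => //.
  exact: one_param_torus.
have e1 : g (f t) = P.[1] by rewrite -hP ?oner_neq0 // one_param1 tmul1.
by rewrite e1 hP // (invertible_poly_const PQ).
Qed.

Lemma chi_unit f u : toric_param X f -> weight_monoid f u -> weight_monoid f (- u) ->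
  forall x, X x -> chi f u x * chi f (- u) x = 1.
Proof. by move=> tp wu wNu x Xx; rewrite -(chiD affX tp) // subrr (chi0 affX tp). Qed.

Variables (f1 f2 : 'rV[K]_2 -> 'rV[K]_n).
Hypotheses (tp1 : toric_param X f1) (tp2 : toric_param X f2).

(** If every character of the first torus is a weight, every function
    is a combination of units, so it is constant along the one-parameter
    subgroup p of the second torus; but functions separate points. *)
Lemma torus_not_bounded p : (forall u, weight_monoid f1 u) -> p != 0 ->
  ~ (forall u, weight_monoid f2 u -> 0 <= pairing p u).
Proof.
move=> all np hp.
have [i ni] : exists i, p 0 i != 0.
  apply/existsP; apply: contraNT np; rewrite negb_exists => /forallP z.
  by apply/eqP/rowP => i; rewrite [RHS]mxE; apply/eqP; rewrite -[_ == _]negbK.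
have [l nl hl] := power_avoid1 K ni.
have T1 := torus_one_in K; have ol := one_param_torus p nl.
have e : f2 (tmul (one_param p l) (torus_one K 2)) = f2 (torus_one K 2).
  apply: (chi_separate affX tp1); try by apply: (tp_in tp2) => //; apply: torus_tmul.
  move=> u wu; apply: (unit_const tp2 hp (chi_cr X wu) (chi_cr X (all (- u)))) => //.
  exact: chi_unit.
have := tp_inj tp2 (torus_tmul ol T1) T1 e; rewrite tmulC tmul1 => /rowP /(_ i).
by rewrite !mxE => /eqP; rewrite (negPf hl).
Qed.

(** A unit is constant along the one-parameter subgroups p and q, which span the
    second torus up to isogeny, so it is constant on X. *)
Lemma pointed_no_units p q w : 0 < det2 p q ->
  (forall u, weight_monoid f2 u -> 0 <= pairing p u) ->
  (forall u, weight_monoid f2 u -> 0 <= pairing q u) ->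
  weight_monoid f1 w -> weight_monoid f1 (- w) -> w = 0.
Proof.
move=> d0 hp hq Sw SNw; have T1 := torus_one_in K.
have [s [c [us Ss nc e]]] := laurent_collect (tp_expand tp2 (chi_cr X Sw)).
have inv r : (forall u, weight_monoid f2 u -> 0 <= pairing r u) -> forall u, u \in s -> pairing r u = 0.
  move=> hr u ius; apply/eqP; apply: contraT => nz; have [l nl hl] := power_avoid1 K nz.
  have : c u * (l ^ pairing r u - 1) = 0.
    apply: (tchar_independent us (c := fun u => c u * (l ^ pairing r u - 1))) ius => t ht.
    have := unit_const tp2 hr (chi_cr X Sw) (chi_cr X SNw) (chi_unit tp1 Sw SNw) ht nl.
    rewrite !e //; last by apply: torus_tmul => //; apply: one_param_torus.
    move/eqP; rewrite -subr_eq0 -sumrB => /eqP H; rewrite -[RHS]H; apply: eq_bigr => v _.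
    by rewrite tchar_tmul tchar_one_param //; ring.
  by move/eqP; rewrite mulf_eq0 (negPf (nc u ius)) subr_eq0 (negPf hl).
have s0 u : u \in s -> u = 0.
  move=> ius; apply: (pairing_inj d0); rewrite pairing0r; [exact: (inv p hp) | exact: (inv q hq)].
have const t : torus t -> chi f1 w (f2 t) = chi f1 w (f2 (torus_one K 2)).
  by move=> ht; rewrite !e //; apply: eq_big_seq => u /s0 ->; rewrite !tchar0.
have constX x : X x -> chi f1 w x = chi f1 w (f2 (torus_one K 2)).
  move: x; apply: (tp_eq affX tp2) => //; first exact: chi_cr.
  by apply: coordinate_ring_pfun; apply: pfun_const.
apply/eqP; apply: contraT => nw; have [t ht] := tchar_separate K nw.
have Xf := tp_in tp1; rewrite tchar0 -(tchar_one K w) -!(chi_param tp1) //.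
by rewrite (constX _ (Xf _ ht)) (constX _ (Xf _ T1)) eqxx.
Qed.
End UnitConst.

(** * Uniqueness of the toric structure: pointed cones *)

Section HomogeneousDegree.
Variables (K : closedFieldType) (charK : has_pchar0 K).

Lemma natr_neq0 (k : nat) : (k%:R == 0 :> K) = (k == 0)%N.
Proof. exact: (proj1 (pcharf0P K) charK). Qed.

Lemma intr_inj0 (a b : int) : a%:~R = b%:~R :> K -> a = b.
Proof.
have z (k : int) : k%:~R = 0 :> K -> k = 0.
  case: k => k /eqP; first by rewrite natr_neq0 => /eqP ->.
  by rewrite NegzE rmorphN oppr_eq0 natr_neq0.
by move=> e; apply/eqP; rewrite -subr_eq0; apply/eqP/z; rewrite rmorphB /= e subrr.
Qed.

Variables (p q w w' : 'rV[int]_2) (S : 'rV[int]_2 -> Prop).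
Hypotheses (SE : forall u, S u <-> 0 <= pairing p u /\ 0 <= pairing q u).
Hypotheses (pw : pairing p w = 0) (qw : 0 < pairing q w).
Hypotheses (qw' : pairing q w' = 0) (pw' : 0 < pairing p w').
Hypothesis ker : forall u, pairing p u = 0 -> exists k : int, u = k *: w.
Hypothesis bez : exists a, pairing p a = 1.
Hypothesis gen : forall u, S u -> exists D A B : nat, (0 < D)%N /\ u *+ D = w *+ A + w' *+ B.

(** Since w + e is not a weight, dl w = 0.  So dl b is not 0 for a weight b with
    p(b) = 1, hence b + e is a weight and p(e) = -1.  If q(e) were negative too,
    dl would vanish at both generators w and w' of the rays. *)
Lemma homogeneous_degree_neg (dl : 'rV[int]_2 -> K) e :
  (forall u v, S u -> S v -> dl (u + v) = dl u + dl v) ->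
  (forall u, S u -> dl u != 0 -> S (u + e)) ->
  (exists2 u, S u & dl u != 0) -> pairing p e < 0 -> pairing p e = -1 /\ 0 <= pairing q e.
Proof.
move=> dlD dlS [u Su nu] pe.
have S0 : S 0 by apply/SE; rewrite !pairing0r.
have SD a b : S a -> S b -> S (a + b).
  by move=> /SE [? ?] /SE [? ?]; apply/SE; rewrite !pairingDr; split; apply: addr_ge0.
have SMn a k : S a -> S (a *+ k) by move=> Sa; elim: k => [|k IH]; rewrite ?mulr0n ?mulrS //; apply: SD.
have dl0 : dl 0 = 0 by apply: (addrI (dl 0)); rewrite -dlD // !addr0.
have dlMn a k : S a -> dl (a *+ k) = dl a *+ k.
  move=> Sa; elim: k => [|k IH]; first by rewrite !mulr0n.
  by rewrite !mulrS dlD ?IH //; apply: SMn.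
have Sw : S w by apply/SE; rewrite pw (ltW qw).
have Sw' : S w' by apply/SE; rewrite qw' (ltW pw').
(* w + e is negative on p, so it is not a weight. *)
have dw : dl w = 0.
  apply/eqP; apply: contraT => /(dlS w Sw) /SE [].
  by rewrite pairingDr pw add0r leNgt pe.
have [a pa] := bez.
have [N hN] : exists N : nat, 0 <= pairing q a + pairing q w *+ N.
  exists (absz (pairing q a)); move: qw; clear; case: (pairing q w) => // -[//|k] _.
  rewrite -mulr_natr natz; case: (pairing q a) => m; first by lia.
  by rewrite NegzE /=; nia.
pose b := a + w *+ N.
have pb : pairing p b = 1 by rewrite /b pairingDr pairingMnr pw mul0rn addr0.
have Sb : S b by apply/SE; rewrite pb; split=> //; rewrite /b pairingDr pairingMnr.
have [pu qu] := proj1 (SE u) Su.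
have [m em] : exists m : nat, pairing p u = m by move: pu; case: (pairing p u) => // m _; exists m.
have [k ek] : exists k : int, u - b *+ m = k *: w.
  by apply: ker; rewrite pairingBr pairingMnr pb em -mulr_natr mul1r natz subrr.
have db : dl u = dl b *+ m.
  have wk (j : nat) : (j : int) *: w = w *+ j by rewrite -scaler_nat natz.
  case: k ek => k; rewrite ?NegzE ?scaleNr wk => ek.
    have -> : u = b *+ m + w *+ k by rewrite -ek addrC subrK.
    by rewrite dlD ?dlMn // ?dw ?mul0rn ?addr0 //; apply: SMn.
  have e1 : u + w *+ k.+1 = b *+ m.
    by move/eqP: ek; rewrite subr_eq addrC => /eqP ->; rewrite subrK.
  by rewrite -dlMn // -e1 dlD ?dlMn // ?dw ?mul0rn ?addr0 //; apply: SMn.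
have nb : dl b != 0 by apply: contraNneq nu => b0; rewrite db b0 mul0rn.
have pe1 : pairing p e = -1.
  have /SE [] := dlS b Sb nb; rewrite pairingDr pb => h _.
  by move: h pe; case: (pairing p e) => // -[//|j]; rewrite NegzE; clear; lia.
split=> //; rewrite leNgt; apply/negP => qe.
have dw' : dl w' = 0.
  apply/eqP; apply: contraT => /(dlS w' Sw') /SE [] _.
  by rewrite pairingDr qw' add0r leNgt qe.
have [D [A [B [D0 eD]]]] := gen Su.
have : dl u *+ D = 0 by rewrite -dlMn // eD dlD ?dlMn ?dw ?dw' ?mul0rn ?addr0 //; apply: SMn.
by move/eqP; rewrite -mulr_natr mulf_eq0 (negPf nu) natr_neq0 -[D == _]negbK -lt0n D0.
Qed.
End HomogeneousDegree.

Section PointedDegree.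
Variables (K : closedFieldType) (charK : has_pchar0 K).
Variables (p q : 'rV[int]_2) (S : 'rV[int]_2 -> Prop).
Hypotheses (pp : primitive p) (pq : primitive q) (d0 : 0 < det2 p q).
Hypotheses (SE : forall u, S u <-> 0 <= pairing p u /\ 0 <= pairing q u).

Lemma pairing_nrot : pairing p (- rot q) = det2 p q.
Proof. by rewrite pairingNr pairing_rot det2C opprK. Qed.

Lemma pointed_gen u : S u -> exists D A B : nat, (0 < D)%N /\ u *+ D = rot p *+ A + (- rot q) *+ B.
Proof.
move=> /SE []; have := pointed_coords p q u; move: d0.
case: (det2 p q) => // D D0; case: (pairing q u) => // A; case: (pairing p u) => // B h _ _.
exists D, A, B; split; first by [].
have sc (k : nat) (v : 'rV[int]_2) : (k : int) *: v = v *+ k by rewrite -scaler_nat natz.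
by rewrite -!sc scalerN.
Qed.

Lemma homogeneous_degree (dl : 'rV[int]_2 -> K) e :
  (forall u v, S u -> S v -> dl (u + v) = dl u + dl v) ->
  (forall u, S u -> dl u != 0 -> S (u + e)) ->
  (exists2 u, S u & dl u != 0) ->
  S e \/ (pairing p e = -1 /\ 0 <= pairing q e) \/ (pairing q e = -1 /\ 0 <= pairing p e).
Proof.
move=> dlD dlS ex.
case: (boolP (pairing p e < 0)) => pe.
  right; left; apply: (@homogeneous_degree_neg K charK p q (rot p) (- rot q) S SE _ _ _ _ _ _ _ dl) => //.
  - exact: pairing_rot0.
  - by rewrite pairing_rot.
  - by rewrite pairingNr pairing_rot0 oppr0.
  - by rewrite pairing_nrot.
  - by move=> u; apply: primitive_kernel.
  - exact: primitive_bezout.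
  - exact: pointed_gen.
case: (boolP (pairing q e < 0)) => qe; last by left; apply/SE; rewrite !leNgt.
right; right; apply: (@homogeneous_degree_neg K charK q p (- rot q) (rot p) S _ _ _ _ _ _ _ _ dl) => //.
- by move=> u; rewrite SE; split=> -[].
- by rewrite pairingNr pairing_rot0 oppr0.
- by rewrite pairing_nrot.
- exact: pairing_rot0.
- by rewrite pairing_rot.
- move=> u /(primitive_kernel pq) [k ->]; exists (- k).
  by rewrite scalerN scaleNr opprK.
- exact: primitive_bezout.
- by move=> u /pointed_gen [D [A [B [D1 e1]]]]; exists D, B, A; rewrite addrC.
Qed.

(** If q(e) = 0 then e is a multiple of rot q, on which p is a multiple of
    det2 p q, so p(e) is not - 1. *)
Lemma root_level e : 1 < det2 p q ->
  (pairing p e = -1 /\ 0 <= pairing q e) \/ (pairing q e = -1 /\ 0 <= pairing p e) ->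
  0 <= pairing p e + pairing q e.
Proof.
have no (d k : int) : 1 < d -> k * d = -1 -> False.
  by move=> d1 /(congr1 absz); rewrite abszM /= => /eqP; rewrite muln_eq1 => /andP[_ /eqP]; lia.
move=> d1 [[pe qe]|[qe pe]]; rewrite ?pe ?qe.
  case: (eqVneq (pairing q e) 0) => [z|nz]; last by have : 0 < pairing q e by [rewrite lt_def nz]; clear; lia.
  have [k ek] := primitive_kernel pq z.
  case: (@no _ (- k) d1); rewrite -pe ek pairingZr -[rot q]opprK pairingNr pairing_nrot; ring.
case: (eqVneq (pairing p e) 0) => [z|nz]; last by have : 0 < pairing p e by [rewrite lt_def nz]; clear; lia.
have [k ek] := primitive_kernel pp z.
by case: (@no _ k d1); rewrite -qe ek pairingZr pairing_rot.
Qed.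
End PointedDegree.

Section EulerTransfer.
Variables (K : closedFieldType) (n : nat) (X : pset K n).
Hypotheses (charK : has_pchar0 K) (affX : affine_variety X).
Variables (f1 f2 : 'rV[K]_2 -> 'rV[K]_n).
Hypotheses (tp1 : toric_param X f1) (tp2 : toric_param X f2).
Notation S1 := (weight_monoid f1).
Notation S2 := (weight_monoid f2).
Notation coef1 := (coef affX tp1).
Notation coef2 := (coef affX tp2).
Variables (p1 q1 : 'rV[int]_2).
Hypotheses (pp1 : primitive p1) (pq1 : primitive q1) (d1 : 0 < det2 p1 q1).
Hypotheses (SE1 : forall u, S1 u <-> 0 <= pairing p1 u /\ 0 <= pairing q1 u).

Definition cochar (p u : 'rV[int]_2) : K := (pairing p u)%:~R.

Lemma cocharD p : {morph cochar p : u v / u + v}.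
Proof. by move=> u v; rewrite /cochar pairingDr rmorphD. Qed.

(** The component of degree e, in the grading by the first torus, of the derivation
    E p = euler (cochar p) given by the cocharacter p of the second torus. *)
Definition component p u e := coef1 (euler affX tp2 (cochar p) (chi f1 u)) (u + e).

Lemma euler_ext p g h : coordinate_ring X g -> coordinate_ring X h -> (forall x, X x -> g x = h x) ->
  forall x, X x -> euler affX tp2 (cochar p) g x = euler affX tp2 (cochar p) h x.
Proof.
move=> cg ch e; apply: (@coef_inj K n X f2 affX tp2); [exact: euler_cr | exact: euler_cr | move=> u].
by rewrite !coef_euler // (coef_ext affX tp2 e).
Qed.

Lemma component_add p e u v : S1 u -> S1 v -> component p (u + v) e = component p u e + component p v e.
Proof.
move=> Su Sv; have cu := chi_cr X Su; have cv := chi_cr X Sv; rewrite /component.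
have Eu := euler_cr affX tp2 (cochar p) cu; have Ev := euler_cr affX tp2 (cochar p) cv.
rewrite (coef_ext affX tp1 (h := fun x => chi f1 u x * euler affX tp2 (cochar p) (chi f1 v) x +
   chi f1 v x * euler affX tp2 (cochar p) (chi f1 u) x)).
- rewrite coefD; [|exact: cr_M|exact: cr_M].
  rewrite -{1}addrA coef_chiM // [u + v]addrC -addrA coef_chiM //; exact: addrC.
- move=> x Xx; rewrite -(eulerM affX tp2 (cocharD p) cu cv Xx).
  apply: euler_ext => //; [exact/chi_cr/weight_monoidD | exact: cr_M | move=> y Xy].
  by rewrite (chiD affX tp1).
- by apply: cr_D; apply: cr_M.
Qed.

Lemma component_supp p e u : S1 u -> component p u e != 0 -> S1 (u + e).
Proof.
move=> Su nz; have cu := euler_cr affX tp2 (cochar p) (chi_cr X Su).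
by have [] := coef_supp cu nz.
Qed.

(** The component of degree e is a homogeneous derivation, so homogeneous_degree
    applies. *)
Lemma component_degree p u e : S1 u -> component p u e != 0 ->
  S1 e \/ (pairing p1 e = -1 /\ 0 <= pairing q1 e) \/ (pairing q1 e = -1 /\ 0 <= pairing p1 e).
Proof.
move=> Su nz; apply: (homogeneous_degree charK pp1 pq1 d1 SE1 (dl := fun u => component p u e)).
- by move=> v w; apply: component_add.
- by move=> v; apply: component_supp.
- by exists u.
Qed.

Definition level (u : 'rV[int]_2) : int := pairing p1 u + pairing q1 u.

Lemma component_level p u e : 1 < det2 p1 q1 -> S1 u -> component p u e != 0 -> 0 <= level e.
Proof.
move=> d2 Su /(component_degree Su) [/SE1 [? ?]|h]; first exact: addr_ge0.
exact: root_level h.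
Qed.

(** The eigenvector equation E p (chi v) = p(v) chi v, in coordinates. *)
Lemma eigen_expand p v m : S2 v ->
  cochar p v * coef1 (chi f2 v) m =
  \sum_(u <- supp affX tp1 (chi f2 v)) coef1 (chi f2 v) u * component p u (m - u).
Proof.
move=> Sv; have cv := chi_cr X Sv; rewrite -(coefZ affX tp1) //.
have [us Ss c0 e] := @coefP K n X f1 affX tp1 _ cv.
set s := supp _ _ _ in us Ss c0 e *.
pose g u := if u \in s then chi f1 u else (fun=> 0).
have cg u : coordinate_ring X (g u).
  rewrite /g; case: (boolP (u \in s)) => [/Ss Su|_]; first exact: chi_cr.
  by apply/coordinate_ring_pfun/pfun_const.
rewrite (coef_ext affX tp1 (h := fun x => \sum_(u <- s) coef1 (chi f2 v) u * euler affX tp2 (cochar p) (g u) x)).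
- rewrite coef_sum; last by move=> u; apply: euler_cr.
  by apply: eq_big_seq => u ius; rewrite /component /g ius addrC subrK.
- apply: (@coef_inj K n X f2 affX tp2).
  + exact: cr_Z.
  + by apply: cr_sum => u; apply: cr_Z; apply: euler_cr.
  move=> w; rewrite coefZ // coef_sum; last by move=> u; apply: euler_cr.
  have e2 x : X x -> chi f2 v x = \sum_(u <- s) coef1 (chi f2 v) u * g u x.
    by move=> Xx; rewrite e //; apply: eq_big_seq => u ius; rewrite /g ius.
  rewrite (coef_ext affX tp2 e2); last by apply: cr_sum => u; apply: cr_Z.
  rewrite coef_sum // mulr_sumr.
  have ew : cochar p v * (w == v)%:R = cochar p w * (w == v)%:R :> K.
    by case: eqP => [->|]; rewrite ?mulr0.
  have c2 : \sum_(u <- s) coef1 (chi f2 v) u * coef2 (g u) w = (w == v)%:R.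
    rewrite -coef_sum // -(coef_chi affX tp2 w Sv); apply: coef_ext => // x Xx; by rewrite -e2.
  rewrite -mulr_sumr c2 ew -c2 mulr_sumr; apply: eq_bigr => u _.
  by rewrite coef_euler // mulrCA.
- by apply: cr_sum => u; apply: cr_Z; apply: euler_cr.
Qed.

(** If p1 and q1 are not a basis then E p has no component of negative level, so it
    preserves the ideal spanned by the nonzero weights of the first system, and
    acts by 0 on the quotient; as chi v is an eigenvector of E p with a nonzero
    eigenvalue, it lies in this ideal. *)
Lemma vertex_coef v : 1 < det2 p1 q1 -> S2 v -> (exists p : 'rV[int]_2, pairing p v != 0) ->
  coef1 (chi f2 v) 0 = 0.
Proof.
move=> d2 Sv [p npv]; have := eigen_expand p 0 Sv.
rewrite big_seq big1 => [/eqP|u ius].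
  rewrite mulf_eq0 => /orP[/eqP h|/eqP //]; case/negP: npv; apply/eqP.
  by apply: (intr_inj0 charK); rewrite -/(cochar p v) h.
have [_ Ss _ _] := @coefP K n X f1 affX tp1 _ (chi_cr X Sv); have Su := Ss u ius.
case: (eqVneq (component p u (0 - u)) 0) => [->|nz]; first by rewrite mulr0.
have := component_level d2 Su nz; rewrite sub0r /level !pairingNr => h.
have [h1 h2] := proj1 (SE1 u) Su.
have u0 : u = 0.
  by apply: (pairing_inj d1); rewrite pairing0r; move: h h1 h2; clear; lia.
have := component_add p 0 (weight_monoid0 f1) (weight_monoid0 f1); rewrite addr0 => /eqP.
rewrite -{1}[component p 0 0]addr0 (inj_eq (addrI _)) => /eqP E0.
by rewrite u0 oppr0 -E0 mulr0.
Qed.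
End EulerTransfer.

(** By param_iso such an isomorphism of weight monoids is induced by an automorphism
    of X. *)
Definition toric_equiv (K : closedFieldType) n (f1 f2 : 'rV[K]_2 -> 'rV[K]_n) : Prop :=
  exists th th' : 'rV[int]_2 -> 'rV[int]_2,
    [/\ {morph th : u v / u + v}, cancel th th', cancel th' th
      & forall u, weight_monoid f1 u <-> weight_monoid f2 (th u)].

Lemma toric_equiv_sym (K : closedFieldType) n (f1 f2 : 'rV[K]_2 -> 'rV[K]_n) :
  toric_equiv f1 f2 -> toric_equiv f2 f1.
Proof.
move=> [th [th' [thD thK th'K h]]]; exists th', th; split=> //.
  by move=> u v; apply: (can_inj thK); rewrite thD !th'K.
by move=> u; rewrite h th'K.
Qed.

Lemma toric_equiv_rel (K : closedFieldType) n (f1 f2 : 'rV[K]_2 -> 'rV[K]_n)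
    (R : 'rV[int]_2 -> 'rV[int]_2 -> Prop) :
  (forall u, exists v, R u v) -> (forall v, exists u, R u v) ->
  (forall u v u' v', R u v -> R u' v' -> R (u + u') (v + v')) ->
  (forall u v v', R u v -> R u v' -> v = v') -> (forall u u' v, R u v -> R u' v -> u = u') ->
  (forall u v, R u v -> (weight_monoid f1 u <-> weight_monoid f2 v)) -> toric_equiv f1 f2.
Proof.
move=> tot onto RD fct inj RS.
pose th u := proj1_sig (constructive_indefinite_description _ (tot u)).
pose th' v := proj1_sig (constructive_indefinite_description _ (onto v)).
have thP u : R u (th u) := proj2_sig (constructive_indefinite_description _ (tot u)).
have th'P v : R (th' v) v := proj2_sig (constructive_indefinite_description _ (onto v)).
exists th, th'; split.
- by move=> u v; apply: fct (thP _) _; apply: RD.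
- by move=> u; apply: inj (th'P _) (thP u).
- by move=> v; apply: fct (thP _) (th'P v).
- by move=> u; apply: RS.
Qed.

Section Asymmetric.
Variables (K : closedFieldType) (n : nat) (X : pset K n).
Hypotheses (charK : has_pchar0 K) (affX : affine_variety X).
Variables (f1 f2 : 'rV[K]_2 -> 'rV[K]_n).
Hypotheses (tp1 : toric_param X f1) (tp2 : toric_param X f2).
Notation S1 := (weight_monoid f1).
Notation S2 := (weight_monoid f2).
Notation coef1 := (coef affX tp1).
Notation coef2 := (coef affX tp2).
Variables (p1 q1 p2 q2 : 'rV[int]_2).
Hypotheses (pp1 : primitive p1) (pq1 : primitive q1) (d1 : 0 < det2 p1 q1).
Hypotheses (SE1 : forall u, S1 u <-> 0 <= pairing p1 u /\ 0 <= pairing q1 u).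
Hypotheses (d2 : 0 < det2 p2 q2).
Hypotheses (SE2 : forall u, S2 u <-> 0 <= pairing p2 u /\ 0 <= pairing q2 u).

Section NoSymmetricRoot.
Hypotheses (d1_gt1 : 1 < det2 p1 q1).
Hypothesis noV : forall e, ~ (pairing p1 e = -1 /\ pairing q1 e = 1).

(** A degree of level 0 would be 0 or a root with opposite values on p1 and q1. *)
Lemma component_pos p u e : S1 u -> component affX tp1 tp2 p u e != 0 -> e = 0 \/ 0 < level p1 q1 e.
Proof.
move=> Su nz.
case: (component_degree charK pp1 pq1 d1 SE1 Su nz) => [/SE1 [h1 h2]|h].
  case: (eqVneq (level p1 q1 e) 0) => [z|nl]; last by right; rewrite lt_def nl addr_ge0.
  left; apply: (pairing_inj d1); rewrite pairing0r; move: z h1 h2; rewrite /level; clear; lia.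
right; rewrite lt_def (root_level pp1 pq1 d1 d1_gt1 h) andbT; apply/eqP => z.
case: h => [[h1 h2]|[h1 h2]].
  by apply: (@noV e); split=> //; move: z; rewrite /level h1; clear; lia.
apply: (@noV (- e)); rewrite !pairingNr h1; split; last by [].
by move: z; rewrite /level h1; clear; lia.
Qed.

(** The component of E p of degree 0 multiplies each chi u by an additive function
    of u, determined by its values on the two rays of the cone. *)
Definition diagonal p (u : 'rV[int]_2) : K :=
  ((pairing q1 u)%:~R * component affX tp1 tp2 p (rot p1) 0 +
   (pairing p1 u)%:~R * component affX tp1 tp2 p (- rot q1) 0) / (det2 p1 q1)%:~R.

Lemma rot_in1 : S1 (rot p1).
Proof. by apply/SE1; rewrite pairing_rot0 pairing_rot; split=> //; apply: ltW. Qed.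

Lemma nrot_in1 : S1 (- rot q1).
Proof. by apply/SE1; rewrite pairing_nrot pairingNr pairing_rot0 oppr0; split=> //; apply: ltW. Qed.

Lemma diagonalD p u v : diagonal p (u + v) = diagonal p u + diagonal p v.
Proof. by rewrite /diagonal !pairingDr !rmorphD /= -mulrDl; congr (_ / _); ring. Qed.

Lemma diagonalN p u : diagonal p (- u) = - diagonal p u.
Proof. by rewrite /diagonal !pairingNr !rmorphN /= -mulNr; congr (_ / _); ring. Qed.

Lemma diagonalZ p (k : int) u : diagonal p (k *: u) = k%:~R * diagonal p u.
Proof. by rewrite /diagonal !pairingZr !rmorphM /= mulrA; congr (_ / _); ring. Qed.

Lemma diagonalE p u : S1 u -> component affX tp1 tp2 p u 0 = diagonal p u.
Proof.
move=> Su; have [pu qu] := proj1 (SE1 u) Su.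
have nd : (det2 p1 q1)%:~R != 0 :> K.
  by apply/eqP => /(intr_inj0 charK (b := 0)) z; move: d1; rewrite z ltxx.
pose dl v := component affX tp1 tp2 p v 0.
have S0 : S1 0 := weight_monoid0 f1.
have dlD v w : S1 v -> S1 w -> dl (v + w) = dl v + dl w by apply: component_add.
have dl0 : dl 0 = 0 by apply: (addrI (dl 0)); rewrite -dlD // !addr0.
have dlMn a k : S1 a -> dl (a *+ k) = dl a *+ k.
  move=> Sa; elim: k => [|k IH]; first by rewrite !mulr0n.
  by rewrite !mulrS dlD ?IH //; apply: weight_monoidMn.
apply: (mulIf nd); rewrite /diagonal divfK // -/(dl u) -/(dl (rot p1)) -/(dl (- rot q1)).
have nat_of (k : int) : 0 <= k -> exists m : nat, k = m by case: k => // m _; exists m.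
have [D eD] := nat_of _ (ltW d1); have [A eA] := nat_of _ qu; have [B eB] := nat_of _ pu.
have := pointed_coords p1 q1 u; rewrite eD eA eB.
have sc (k : nat) (v : 'rV[int]_2) : (k : int) *: v = v *+ k by rewrite -scaler_nat natz.
rewrite -scalerN !sc => e.
rewrite -!pmulrn mulr_natr !mulr_natl -!dlMn //; try exact: rot_in1; try exact: nrot_in1.
rewrite e dlD //; apply: weight_monoidMn; [exact: rot_in1 | exact: nrot_in1].
Qed.

(** The terms of lowest level in the expansion of the second character v; they may
    not be unique. *)
Definition lowest v m := coef1 (chi f2 v) m != 0 /\
  forall u, coef1 (chi f2 v) u != 0 -> level p1 q1 m <= level p1 q1 u.

Lemma level_ge0 u : S1 u -> 0 <= level p1 q1 u.
Proof. by move=> /SE1 [h1 h2]; apply: addr_ge0. Qed.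

Lemma coef1_in v u : S2 v -> coef1 (chi f2 v) u != 0 -> S1 u.
Proof. by move=> Sv nz; have [] := coef_supp (chi_cr X Sv) nz. Qed.

Lemma lowest_exists v : S2 v -> exists m, lowest v m.
Proof.
move=> Sv; have cv := chi_cr X Sv.
have [u nu] : exists u, coef1 (chi f2 v) u != 0.
  apply: NNPP => no; have T1 := torus_one_in K.
  have : chi f2 v (f2 (torus_one K 2)) = 0.
    apply: (coef_eq0 cv (affX := affX) (tp := tp1)); last exact: (tp_in tp2).
    by move=> u; apply/eqP; apply: contraT => nz; case: no; exists u.
  by rewrite (chi_param tp2) // tchar_one => /eqP; rewrite oner_eq0.
have [|k [m [nm em]] min] := @nat_least (fun k => exists u, coef1 (chi f2 v) u != 0 /\ absz (level p1 q1 u) = k) (absz (level p1 q1 u)).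
  by exists u.
exists m; split=> // w nw; have := min _ (ex_intro _ w (conj nw erefl)).
have := level_ge0 (coef1_in Sv nm); have := level_ge0 (coef1_in Sv nw); move: em; clear; lia.
Qed.

(** E p maps chi v to cochar p v times itself, and components of positive level do
    not contribute to the lowest terms. *)
Lemma lowest_eigen p v m : S2 v -> lowest v m -> diagonal p m = cochar K p v.
Proof.
move=> Sv [nm low]; have Sm := coef1_in Sv nm.
have [us Ss c0 _] := @coefP K n X f1 affX tp1 _ (chi_cr X Sv).
have ms : m \in supp affX tp1 (chi f2 v) by have [] := coef_supp (chi_cr X Sv) nm.
have := eigen_expand affX tp1 tp2 p m Sv; rewrite (bigD1_seq m) //= subrr diagonalE //.
rewrite big_seq_cond big1 ?addr0 => [e|u /andP[ius um]].
  by apply: (mulfI nm); rewrite -e mulrC.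
case: (eqVneq (coef1 (chi f2 v) u) 0) => [->|nu]; first by rewrite mul0r.
case: (eqVneq (component affX tp1 tp2 p u (m - u)) 0) => [->|nc]; first by rewrite mulr0.
case: (component_pos (Ss u ius) nc) => [/eqP|].
  by rewrite subr_eq0 eq_sym (negPf um).
by have := low u nu; rewrite /level !pairingBr; clear; lia.
Qed.

(** m is matched with v if the two derivations E p2 and E q2 have the same
    eigenvalues on both, up to terms of positive level. *)
Definition matched (u v : 'rV[int]_2) := diagonal p2 u = cochar K p2 v /\ diagonal q2 u = cochar K q2 v.

Lemma lowest_matched v m : S2 v -> lowest v m -> S1 m /\ matched m v.
Proof. by move=> Sv lm; split; [apply: coef1_in lm.1 | split; apply: lowest_eigen]. Qed.

Lemma matched_fun u v v' : matched u v -> matched u v' -> v = v'.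
Proof.
move=> [h1 h2] [h3 h4]; apply: (pairing_inj d2); apply: (intr_inj0 charK).
  by rewrite -[LHS]h1 -[RHS]h3.
by rewrite -[LHS]h2 -[RHS]h4.
Qed.

(** The lowest terms of the characters on the two rays of the second cone have
    linearly independent eigenvalues, so they form a basis of the first lattice
    over the rationals on which diagonal is injective. *)
Lemma diagonal_inj u : diagonal p2 u = 0 -> diagonal q2 u = 0 -> u = 0.
Proof.
move=> u1 u2.
have Sv1 : S2 (rot p2) by apply/SE2; rewrite pairing_rot0 pairing_rot; split=> //; apply: ltW.
have Sv2 : S2 (- rot q2) by apply/SE2; rewrite pairing_nrot pairingNr pairing_rot0 oppr0; split=> //; apply: ltW.
have [m1 lm1] := lowest_exists Sv1; have [m2 lm2] := lowest_exists Sv2.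
have [Sm1 [a1 b1]] := lowest_matched Sv1 lm1; have [Sm2 [a2 b2]] := lowest_matched Sv2 lm2.
rewrite /cochar ?pairing_rot0 ?pairing_rot ?pairing_nrot ?pairingNr ?det2_aa ?oppr0 ?mulr0z /= in a1 b1 a2 b2.
have nd : (det2 p2 q2)%:~R != 0 :> K.
  by apply/eqP => /(intr_inj0 charK (b := 0)) z; move: d2; rewrite z ltxx.
have zero (x y : int) : x%:~R * (det2 p2 q2)%:~R = y%:~R * 0 :> K -> x = 0.
  rewrite mulr0 => /eqP; rewrite mulf_eq0 (negPf nd) orbF => /eqP h; exact: (intr_inj0 charK (b := 0)).
have prop p : det2 m1 m2 = 0 -> pairing p m1 = 0 /\ pairing p m2 = 0.
  move=> D0; have e : pairing p m2 *: m1 = pairing p m1 *: m2.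
    apply/eqP; rewrite -subr_eq0; apply/eqP.
    transitivity (- det2 m1 m2 *: rot p); last by rewrite D0 oppr0 scale0r.
    by apply: row2P; rewrite !pairingE !mxE /= /det2; ring.
  have e1 := congr1 (diagonal p2) e; have e2 := congr1 (diagonal q2) e.
  rewrite !diagonalZ a1 a2 in e1; rewrite !diagonalZ b1 b2 in e2.
  split; [exact: (zero _ _ (esym e1)) | exact: (zero _ _ e2)].
(* If m1 and m2 were proportional, so would be their eigenvalues (0, D) and (D, 0). *)
have D0 : det2 m1 m2 != 0.
  apply/eqP => D0; have [h1 h2] := prop p1 D0; have [h3 h4] := prop q1 D0.
  have m10 : m1 = 0 by apply: (pairing_inj d1); rewrite pairing0r.
  by move: b1; rewrite m10 /diagonal !pairing0r !mul0r addr0 mul0r => /esym/eqP; rewrite (negPf nd).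
have e := det2_cramer m1 m2 u.
have e1 := congr1 (diagonal p2) e; have e2 := congr1 (diagonal q2) e.
rewrite diagonalD !diagonalZ a1 a2 u1 !mulr0 add0r in e1.
rewrite diagonalD !diagonalZ b1 b2 u2 !mulr0 addr0 in e2.
have h1 : det2 m1 u = 0 by apply: (zero _ 0); rewrite -e1 mulr0.
have h2 : det2 u m2 = 0 by apply: (zero _ 0); rewrite -e2 mulr0.
rewrite h1 h2 !scale0r addr0 in e.
apply: row2P; apply: (mulfI D0); rewrite !mxE mulr0.
  by have := congr1 (fun m : 'rV_2 => m 0 0) e; rewrite !mxE.
by have := congr1 (fun m : 'rV_2 => m 0 1) e; rewrite !mxE.
Qed.

Lemma matched_inj u u' v : matched u v -> matched u' v -> u = u'.
Proof.
move=> [h1 h2] [h3 h4]; apply/eqP; rewrite -subr_eq0; apply/eqP/diagonal_inj.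
  by rewrite diagonalD diagonalN h1 h3 subrr.
by rewrite diagonalD diagonalN h2 h4 subrr.
Qed.

Lemma matchedD u v u' v' : matched u v -> matched u' v' -> matched (u + u') (v + v').
Proof. by move=> [h1 h2] [h3 h4]; split; rewrite diagonalD cocharD ?h1 ?h2 ?h3 ?h4. Qed.

Lemma matchedB u v u' v' : matched u v -> matched u' v' -> matched (u - u') (v - v').
Proof.
move=> h [h3 h4]; apply: matchedD => //.
by split; rewrite diagonalN /cochar pairingNr rmorphN /= ?h3 ?h4.
Qed.

Lemma lowest_unique v v' m : S2 v -> S2 v' -> lowest v m -> lowest v' m -> v = v'.
Proof.
move=> Sv Sv' /(lowest_matched Sv) [_ h] /(lowest_matched Sv') [_ h']; exact: matched_fun h h'.
Qed.

(** The lowest of all lowest terms of the second characters in the expansion of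
    chi u occurs for one of these characters only, as matched is a function; it
    does not cancel, so it is u. *)
Lemma matched_total u : S1 u -> exists2 v, S2 v & matched u v.
Proof.
move=> Su; have cu := chi_cr X Su.
have [us Ss c0 e] := @coefP K n X f2 affX tp2 _ cu.
set s := supp _ _ _ in us Ss c0 e; set c := coef2 _ in c0 e.
have [v1 [nv1 v1s]] : exists v, c v != 0 /\ v \in s.
  apply: NNPP => no; have T1 := torus_one_in K.
  have : chi f1 u (f1 (torus_one K 2)) = 0.
    rewrite e; last exact: (tp_in tp1).
    rewrite big_seq big1 // => v vs; case: (eqVneq (c v) 0) => [->|nz]; first by rewrite mul0r.
    by case: no; exists v.
  by rewrite (chi_param tp1) // tchar_one => /eqP; rewrite oner_eq0.
have [m1 lm1] := lowest_exists (Ss v1 v1s).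
pose P k := exists v m, [/\ v \in s, c v != 0, lowest v m & absz (level p1 q1 m) = k].
have [|k [v0 [m0 [v0s nv0 lm0 ek]]] min] := @nat_least P (absz (level p1 q1 m1)).
  by exists v1, m1.
have Sv0 := Ss v0 v0s; have [Sm0 mm0] := lowest_matched Sv0 lm0.
have others v : v \in s -> v != v0 -> c v * coef1 (chi f2 v) m0 = 0.
  move=> vs nv; case: (eqVneq (c v) 0) => [->|ncv]; first by rewrite mul0r.
  case: (eqVneq (coef1 (chi f2 v) m0) 0) => [->|ncm]; first by rewrite mulr0.
  have [m lm] := lowest_exists (Ss v vs).
  have [Sm _] := lowest_matched (Ss v vs) lm.
  have h1 := min _ (ex_intro _ v (ex_intro _ m (And4 vs ncv lm erefl))).
  have h2 := lm.2 m0 ncm; have h3 := level_ge0 Sm; have h4 := level_ge0 Sm0.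
  have lm0' : lowest v m0.
    split=> // w nw; have h5 := lm.2 w nw; move: h1 h2 h3 h4 h5 ek; clear; lia.
  by case/negP: nv; apply/eqP; apply: (lowest_unique (Ss v vs) Sv0 lm0' lm0).
pose g v := if v \in s then chi f2 v else (fun=> 0).
have cg v : coordinate_ring X (g v).
  rewrite /g; case: (boolP (v \in s)) => [/Ss Sv|_]; first exact: chi_cr.
  by apply/coordinate_ring_pfun/pfun_const.
have : coef1 (chi f1 u) m0 = c v0 * coef1 (chi f2 v0) m0.
  rewrite (@coef_ext K n X f1 affX tp1 _ (fun x => \sum_(v <- s) c v * g v x)).
  - rewrite coef_sum // (bigD1_seq v0) //= {1}/g v0s big_seq_cond big1 ?addr0 // => v /andP[vs nv].
    by rewrite /g vs others.
  - by move=> x Xx; rewrite e //; apply: eq_big_seq => v vs; rewrite /g vs.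
  - by apply: cr_sum => v; apply: cr_Z.
rewrite coef_chi //; case: eqP => [<- _|_ /esym/eqP]; first by exists v0.
by rewrite mulf_eq0 (negPf nv0) (negPf lm0.1).
Qed.

(** matched is an additive bijection: it is total by matched_total and onto because
    each second character has a lowest term. *)
Lemma toric_equiv_nosym : toric_equiv f1 f2.
Proof.
apply: (@toric_equiv_rel K n f1 f2 matched).
- move=> u; have [a [b [Sa Sb ->]]] := weight_monoid_full charK tp1 u.
  have [v _ hv] := matched_total Sa; have [w _ hw] := matched_total Sb.
  by exists (v - w); apply: matchedB.
- move=> v; have [a [b [Sa Sb ->]]] := weight_monoid_full charK tp2 v.
  have [m /(lowest_matched Sa) [_ hm]] := lowest_exists Sa.
  have [m' /(lowest_matched Sb) [_ hm']] := lowest_exists Sb.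
  by exists (m - m'); apply: matchedB.
- exact: matchedD.
- exact: matched_fun.
- exact: matched_inj.
- move=> u v uv; split=> [Su|Sv].
    by have [w Sw hw] := matched_total Su; rewrite (matched_fun uv hw).
  have [m /(lowest_matched Sv) [Sm hm]] := lowest_exists Sv.
  by rewrite (matched_inj uv hm).
Qed.
End NoSymmetricRoot.
End Asymmetric.

(** ** Cones with a symmetric root *)

(** If some e has values -1 and 1 on the two rays then the level of every
    weight is divisible by d = det2 p q, and there are d + 1 weights of level
    d: the surface is the cone over the rational normal curve of degree d. *)

Section SymmetricRoot.
Variables (p q e : 'rV[int]_2) (S : 'rV[int]_2 -> Prop).
Hypotheses (pp : primitive p) (pq : primitive q) (d0 : 0 < det2 p q).
Hypotheses (SE : forall u, S u <-> 0 <= pairing p u /\ 0 <= pairing q u).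
Hypotheses (pe : pairing p e = -1) (qe : pairing q e = 1).

Lemma level_dvd u : exists k : int, level p q u = k * det2 p q.
Proof.
have [|k ek] := @primitive_kernel p (u + pairing p u *: e) pp.
  by rewrite pairingDr pairingZr pe mulrN1 addrN.
exists k; have := congr1 (pairing q) ek.
by rewrite pairingDr !pairingZr qe mulr1 pairing_rot /level addrC => ->.
Qed.

Definition base_weight (j : nat) : 'rV[int]_2 := - rot q + (j : int) *: e.

Lemma pairing_base j : pairing p (base_weight j) = det2 p q - j%:Z /\ pairing q (base_weight j) = j%:Z.
Proof.
rewrite /base_weight !pairingDr !pairingZr pe qe pairing_nrot pairingNr pairing_rot0 oppr0 add0r mulr1.
by rewrite mulrN1.
Qed.

Lemma level_base j : level p q (base_weight j) = det2 p q.
Proof. by have [h1 h2] := pairing_base j; rewrite /level h1 h2 subrK. Qed.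

Lemma base_in j : j%:Z <= det2 p q -> S (base_weight j).
Proof. by move=> h; have [h1 h2] := pairing_base j; apply/SE; rewrite h1 h2 subr_ge0. Qed.

Lemma base_inj j k : base_weight j = base_weight k -> j = k.
Proof.
move=> h; have [_ h1] := pairing_base j; have [_ h2] := pairing_base k.
by apply/eqP; rewrite -eqz_nat -h1 -h2 h.
Qed.

Lemma level_large u : S u -> u != 0 -> det2 p q <= level p q u.
Proof.
move=> /SE [h1 h2] nu; have [k ek] := level_dvd u.
have pos : 0 < level p q u.
  rewrite lt_def addr_ge0 // andbT; apply: contraNN nu => /eqP z; apply/eqP.
  by apply: (pairing_inj d0); rewrite pairing0r; move: z h1 h2; rewrite /level; clear; lia.
by move: pos; rewrite ek pmulr_lgt0 // => k0; rewrite -{1}[det2 p q]mul1r ler_pM2r //.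
Qed.

Lemma weight_cases u : S u ->
  [\/ u = 0, exists2 j : nat, j%:Z <= det2 p q & u = base_weight j
   | exists a b, [/\ S a, S b, a != 0, b != 0 & u = a + b]].
Proof.
move=> Su; have [h1 h2] := proj1 (SE u) Su; have [k ek] := level_dvd u.
case: (eqVneq u 0) => [->|nu]; first by constructor 1.
have big := level_large Su nu.
have nat_of (m : int) : 0 <= m -> exists j : nat, m = j by case: m => // j _; exists j.
have [b eb] := nat_of _ h2; have [D eD] := nat_of _ (ltW d0).
case: (eqVneq (level p q u) (det2 p q)) => [el|nl].
  constructor 2; exists b; first by move: el h1; rewrite /level eb; clear; lia.
  have [g1 g2] := pairing_base b; apply: (pairing_inj d0); rewrite ?g1 ?g2 //.
  by rewrite -el /level eb addrK.
have big2 : 2 * det2 p q <= level p q u.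
  have k1 : 1 < k.
    rewrite -(ltr_pM2r d0) mul1r -ek lt_def nl big //.
  rewrite ek ler_pM2r //; move: k1; clear; lia.
pose j := minn b D.
have jD : (j%:Z <= det2 p q) by rewrite eD lez_nat geq_minr.
have [g1 g2] := pairing_base j.
have nzb i : base_weight i != 0.
  apply/eqP => z; have := level_base i; rewrite z /level !pairing0r addr0 => z'.
  by move: d0; rewrite -z' ltxx.
constructor 3; exists (base_weight j), (u - base_weight j); split=> //.
- exact: base_in.
- apply/SE; rewrite !pairingBr g1 g2 eb; move: big2 h1; rewrite /level eb eD /j; clear.
  by split; lia.
- apply/eqP => z; have := congr1 (level p q) z.
  rewrite /level !pairingBr !pairing0r addr0 => z'.
  have : level p q u = det2 p q.
    by rewrite -(level_base j) /level; move: z'; clear; lia.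
  by move/eqP; rewrite (negPf nl).
- by rewrite addrC subrK.
Qed.
End SymmetricRoot.

Section Count.
Variables (K : closedFieldType) (n : nat) (X : pset K n).
Hypotheses (charK : has_pchar0 K) (affX : affine_variety X).
Variables (f1 f2 : 'rV[K]_2 -> 'rV[K]_n).
Hypotheses (tp1 : toric_param X f1) (tp2 : toric_param X f2).
Notation S1 := (weight_monoid f1).
Notation S2 := (weight_monoid f2).
Notation coef1 := (coef affX tp1).
Notation coef2 := (coef affX tp2).
Variables (p1 q1 e1 p2 q2 e2 : 'rV[int]_2).
Hypotheses (pp1 : primitive p1) (pq1 : primitive q1) (d1 : 0 < det2 p1 q1).
Hypotheses (SE1 : forall u, S1 u <-> 0 <= pairing p1 u /\ 0 <= pairing q1 u).
Hypotheses (pe1 : pairing p1 e1 = -1) (qe1 : pairing q1 e1 = 1).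
Hypotheses (pp2 : primitive p2) (pq2 : primitive q2) (d2 : 0 < det2 p2 q2).
Hypotheses (SE2 : forall u, S2 u <-> 0 <= pairing p2 u /\ 0 <= pairing q2 u).
Hypotheses (pe2 : pairing p2 e2 = -1) (qe2 : pairing q2 e2 = 1).
Hypothesis aug12 : forall v, S2 v -> v != 0 -> coef1 (chi f2 v) 0 = 0.
Hypothesis aug21 : forall u, S1 u -> u != 0 -> coef2 (chi f1 u) 0 = 0.

(** The d + 1 weights of level d are a basis of the maximal ideal of the vertex
    modulo its square, d = det2 p q.  If the second cone had fewer of them, a
    combination g of the first ones would have no coefficient at the second ones,
    so it would be a combination of products of two functions that vanish at the
    vertex; all these have level at least 2 d for the first cone. *)
Lemma vertex_dim_le : det2 p1 q1 <= det2 p2 q2.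
Proof.
have nat_of (m : int) : 0 <= m -> exists j : nat, m = j by case: m => // j _; exists j.
have [D1 eD1] := nat_of _ (ltW d1); have [D2 eD2] := nat_of _ (ltW d2).
rewrite leNgt; apply/negP; rewrite eD1 eD2 ltz_nat => lt.
pose u j := base_weight q1 e1 j; pose v j := base_weight q2 e2 j.
have Su (j : 'I_D1.+1) : S1 (u j).
  by apply: (base_in SE1 pe1 qe1); rewrite eD1 lez_nat -ltnS.
have nu (j : 'I_D1.+1) : u j != 0.
  apply/eqP => z; have := level_base pe1 qe1 j; rewrite -/(u j) z /level !pairing0r addr0 => z'.
  by move: d1; rewrite -z' ltxx.
pose M : 'M[K]_(D1.+1, D2.+1) := \matrix_(j, i) coef2 (chi f1 (u j)) (v i).
have [r nr rM] := @tall_dependent K _ _ M lt.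
pose g x := \sum_(j <- enum 'I_D1.+1) r 0 j * chi f1 (u j) x.
have cu j : coordinate_ring X (chi f1 (u (j : 'I_D1.+1))) by apply: chi_cr.
have cg : coordinate_ring X g by apply: cr_sum => j; apply: cr_Z.
have g_v (i : 'I_D2.+1) : coef2 g (v i) = 0.
  rewrite coef_sum // big_enum /=; have := congr1 (fun m : 'rV_D2.+1 => m 0 i) rM.
  rewrite !mxE => H; rewrite -[RHS]H; apply: eq_bigr => j _; by rewrite !mxE.
have g_0 : coef2 g 0 = 0.
  by rewrite coef_sum // big1 // => j _; rewrite aug21 ?mulr0.
have coef1_g (j : 'I_D1.+1) : coef1 g (u j) = r 0 j.
  rewrite coef_sum // big_enum /= (bigD1 j) //= coef_chi // eqxx mulr1 big1 ?addr0 // => k nk.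
  rewrite coef_chi //; case: eqP => [h|]; last by rewrite mulr0.
  by case/negP: nk; apply/eqP/val_inj/esym; apply: (base_inj pe1 qe1 h).
have [us Ss c0 eg] := @coefP K n X f2 affX tp2 _ cg.
pose h w := if w \in supp affX tp2 g then chi f2 w else (fun=> 0).
have ch w : coordinate_ring X (h w).
  rewrite /h; case: (boolP (w \in _)) => [/Ss Sw|_]; first exact: chi_cr.
  by apply/coordinate_ring_pfun/pfun_const.
case/negP: nr; apply/eqP/rowP => j; rewrite [RHS]mxE -coef1_g.
rewrite (@coef_ext K n X f1 affX tp1 _ (fun x => \sum_(w <- supp affX tp2 g) coef2 g w * h w x)).
- rewrite coef_sum // big_seq big1 // => w ws; rewrite /h ws.
  case: (eqVneq (coef2 g w) 0) => [->|nw]; first by rewrite mul0r.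
  have Sw := Ss w ws; case: (weight_cases pp2 d2 SE2 pe2 qe2 Sw).
  + by move=> w0; case/negP: nw; rewrite w0 g_0.
  + move=> [i hi ew]; have ltj : (i < D2.+1)%N by rewrite ltnS -lez_nat -eD2.
    by case/negP: nw; rewrite ew -/(v i) (g_v (Ordinal ltj)).
  move=> [a [b [Sa Sb na nb ew]]]; rewrite (_ : coef1 _ _ = 0) ?mulr0 //.
  apply/eqP; apply: contraT => nc.
  have ca := chi_cr X Sa; have cb := chi_cr X Sb.
  have : coef1 (fun x => chi f2 a x * chi f2 b x) (u j) != 0.
    rewrite -(@coef_ext K n X f1 affX tp1 (chi f2 w)) //; last exact: cr_M.
    by move=> x Xx; rewrite ew (chiD affX tp2).
  case/(coef_mul_supp ca cb) => a' [b' [eu na' nb']].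
  have [Sa' _] := coef_supp ca na'; have [Sb' _] := coef_supp cb nb'.
  have za : a' != 0 by apply: contraNneq na' => ->; rewrite aug12.
  have zb : b' != 0 by apply: contraNneq nb' => ->; rewrite aug12.
  have h1 := level_large pp1 d1 SE1 pe1 qe1 Sa' za.
  have h2 := level_large pp1 d1 SE1 pe1 qe1 Sb' zb.
  have := level_base pe1 qe1 j; rewrite -/(u j) eu => h3; move: d1 h1 h2 h3.
  by rewrite /level !pairingDr; clear; lia.
- by move=> x Xx; rewrite eg //; apply: eq_big_seq => w ws; rewrite /h ws.
- by apply: cr_sum => w; apply: cr_Z.
Qed.
End Count.

Section Uniqueness.
Variables (K : closedFieldType) (n : nat) (X : pset K n).
Hypotheses (charK : has_pchar0 K) (affX : affine_variety X) (norX : normal_variety X).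

Lemma weight_cone_type f : toric_param X f -> cone_type (weight_monoid f).
Proof.
move=> tp; have [F hF] := weight_monoid_fg tp.
apply: (cone_typeP _ _ _ hF (weight_monoid_full charK tp)); first exact: weight_monoid0.
- by move=> u v; apply: weight_monoidD.
- by move=> u k; apply: (weight_monoid_saturated charK tp norX).
Qed.

(** Each half-plane is that of vectors with a nonnegative coordinate in a suitable
    basis of the lattice. *)
Lemma toric_equiv_half f1 f2 p1 p2 : primitive p1 -> primitive p2 ->
  (forall u, weight_monoid f1 u <-> 0 <= pairing p1 u) ->
  (forall u, @weight_monoid K n f2 u <-> 0 <= pairing p2 u) -> @toric_equiv K n f1 f2.
Proof.
move=> /primitive_bezout [a1 h1] /primitive_bezout [a2 h2] S1 S2.
have coords p a u : pairing p a = 1 -> u = pairing p u *: a + det2 a u *: rot p.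
  rewrite pairingE => h; apply: row2P; rewrite !pairingE !mxE /= /det2.
    by rewrite -[LHS]mul1r -h; ring.
  by rewrite -[LHS]mul1r -h; ring.
have det_rot p a : det2 a (rot p) = pairing p a by rewrite pairingE /det2 !vec2E; ring.
have det_lin p a x y : pairing p a = 1 -> det2 a (x *: a + y *: rot p) = y.
  by move=> h; rewrite det2Dr !det2Zr det2_aa det_rot h mulr0 add0r mulr1.
have pair_lin p a x y : pairing p a = 1 -> pairing p (x *: a + y *: rot p) = x.
  by move=> h; rewrite pairingDr !pairingZr h pairing_rot0 mulr0 addr0 mulr1.
pose R u v := pairing p1 u = pairing p2 v /\ det2 a1 u = det2 a2 v.
apply: (@toric_equiv_rel K n f1 f2 R).
- move=> u; exists (pairing p1 u *: a2 + det2 a1 u *: rot p2).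
  by rewrite /R pair_lin // det_lin.
- move=> v; exists (pairing p2 v *: a1 + det2 a2 v *: rot p1).
  by rewrite /R pair_lin // det_lin.
- by move=> u v u' v' [e1 e2] [e3 e4]; rewrite /R !pairingDr !det2Dr e1 e2 e3 e4.
- by move=> u v v' [e1 e2] [e3 e4]; rewrite (coords p2 a2 v) // (coords p2 a2 v') // -e1 -e2 -e3 -e4.
- by move=> u u' v [e1 e2] [e3 e4]; rewrite (coords p1 a1 u) // (coords p1 a1 u') // e1 e2 e3 e4.
- by move=> u v [e1 _]; rewrite S1 S2 e1.
Qed.

(** Either one of the cones has no root with opposite values on its two rays, or
    both are determined up to isomorphism by det2 p q. *)
Lemma toric_equiv_pointed f1 f2 p1 q1 p2 q2 : toric_param X f1 -> toric_param X f2 ->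
  primitive p1 -> primitive q1 -> 0 < det2 p1 q1 ->
  (forall u, weight_monoid f1 u <-> 0 <= pairing p1 u /\ 0 <= pairing q1 u) ->
  primitive p2 -> primitive q2 -> 0 < det2 p2 q2 ->
  (forall u, weight_monoid f2 u <-> 0 <= pairing p2 u /\ 0 <= pairing q2 u) -> toric_equiv f1 f2.
Proof.
move=> tp1 tp2 pp1 pq1 d1 SE1 pp2 pq2 d2 SE2.
have regular_sym p q : primitive p -> primitive q -> 0 < det2 p q ->
    (1 < det2 p q) \/ exists e, pairing p e = -1 /\ pairing q e = 1.
  move=> pp pq d0; case: (ltP 1 (det2 p q)) => h; [by left | right].
  have e1 : det2 p q = 1 by move: d0 h; clear; lia.
  exists (rot p + rot q); rewrite !pairingDr !pairing_rot !det2_aa e1 det2C e1.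
  by rewrite addr0 add0r.
have sym_or (p q : 'rV[int]_2) : (exists e : 'rV[int]_2, pairing p e = -1 /\ pairing q e = 1) \/ ~ (exists e : 'rV[int]_2, pairing p e = -1 /\ pairing q e = 1).
  exact: classic.
case: (sym_or p1 q1) => [[e1 [pe1 qe1]]|no1]; last first.
  case: (regular_sym p1 q1 pp1 pq1 d1) => // gt1.
  apply: (toric_equiv_nosym charK affX tp1 tp2 pp1 pq1 d1 SE1 d2 SE2 gt1) => e he.
  by apply: no1; exists e.
case: (sym_or p2 q2) => [[e2 [pe2 qe2]]|no2]; last first.
  case: (regular_sym p2 q2 pp2 pq2 d2) => // gt1; apply: toric_equiv_sym.
  apply: (toric_equiv_nosym charK affX tp2 tp1 pp2 pq2 d2 SE2 d1 SE1 gt1) => e he.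
  by apply: no2; exists e.
have nz v : v != 0 :> 'rV[int]_2 -> exists p : 'rV[int]_2, pairing p v != 0.
  move=> nv; case: (eqVneq (v 0 0) 0) => [z0|n0].
    case: (eqVneq (v 0 1) 0) => [z1|n1].
      by case/negP: nv; apply/eqP/row2P; rewrite !mxE.
    by exists (vec2 0 1); rewrite pairingE !vec2E mul0r add0r mul1r.
  by exists (vec2 1 0); rewrite pairingE !vec2E mul1r mul0r addr0.
(* One of the two inclusions of maximal ideals implies the other. *)
have swap g1 g2 (t1 : toric_param X g1) (t2 : toric_param X g2) :
    (forall v, weight_monoid g2 v -> v != 0 -> coef affX t1 (chi g2 v) 0 = 0) ->
    (forall u, weight_monoid g1 u -> u != 0 -> coef affX t2 (chi g1 u) 0 = 0).
  move=> aug u Su nu; have cu := chi_cr X Su.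
  have [us Ss c0 eu] := @coefP K n X g2 affX t2 _ cu.
  set s := supp _ _ _ in us Ss c0 eu; set c := coef affX t2 _ in c0 eu *.
  pose h w := if w \in s then chi g2 w else (fun=> 0).
  have ch w : coordinate_ring X (h w).
    rewrite /h; case: (boolP (w \in _)) => [/Ss Sw|_]; first exact: chi_cr.
    by apply/coordinate_ring_pfun/pfun_const.
  case: (boolP (0 \in s)) => [s0|/c0 //].
  have : coef affX t1 (chi g1 u) 0 = c 0.
    rewrite (@coef_ext K n X g1 affX t1 _ (fun x => \sum_(w <- s) c w * h w x)).
    - rewrite coef_sum // (bigD1_seq 0) //= big_seq_cond big1 ?addr0.
        rewrite /h s0 (@coef_ext K n X g1 affX t1 _ (fun=> 1)) ?coef_chi0 ?eqxx ?mulr1 //.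
          by move=> x Xx; rewrite (chi0 affX t2).
        by apply/coordinate_ring_pfun/pfun_const.
      by move=> w /andP[ws nw]; rewrite /h ws aug ?mulr0 //; apply: Ss.
    - by move=> x Xx; rewrite eu //; apply: eq_big_seq => w ws; rewrite /h ws.
    - by apply: cr_sum => w; apply: cr_Z.
  by rewrite coef_chi // eq_sym (negPf nu) => <-.
have dd : det2 p1 q1 = det2 p2 q2.
  case: (ltP 1 (det2 p1 q1)) => h1.
    have aug12 v : weight_monoid f2 v -> v != 0 -> coef affX tp1 (chi f2 v) 0 = 0.
      by move=> Sv /nz; apply: (vertex_coef charK affX tp1 tp2 pp1 pq1 d1 SE1 h1 Sv).
    have aug21 := swap _ _ tp1 tp2 aug12.
    apply/le_anti; apply/andP; split.
      exact: (vertex_dim_le pp1 d1 SE1 pe1 qe1 pp2 d2 SE2 pe2 qe2 aug12 aug21).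
    exact: (vertex_dim_le pp2 d2 SE2 pe2 qe2 pp1 d1 SE1 pe1 qe1 aug21 aug12).
  case: (ltP 1 (det2 p2 q2)) => h2; last by move: d1 d2 h1 h2; clear; lia.
  have aug21 v : weight_monoid f1 v -> v != 0 -> coef affX tp2 (chi f1 v) 0 = 0.
    by move=> Sv /nz; apply: (vertex_coef charK affX tp2 tp1 pp2 pq2 d2 SE2 h2 Sv).
  have aug12 := swap _ _ tp2 tp1 aug21.
  apply/le_anti; apply/andP; split.
    exact: (vertex_dim_le pp1 d1 SE1 pe1 qe1 pp2 d2 SE2 pe2 qe2 aug12 aug21).
  exact: (vertex_dim_le pp2 d2 SE2 pe2 qe2 pp1 d1 SE1 pe1 qe1 aug21 aug12).
have solve p q e (k b : int) : pairing p e = -1 -> pairing q e = 1 ->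
    pairing p (k *: - rot q + b *: e) = k * det2 p q - b /\ pairing q (k *: - rot q + b *: e) = b.
  move=> pe qe; rewrite !pairingDr !pairingZr pe qe pairing_nrot pairingNr pairing_rot0 oppr0.
  by rewrite mulr0 add0r mulr1 mulrN1.
pose R u v := pairing p1 u = pairing p2 v /\ pairing q1 u = pairing q2 v.
apply: (@toric_equiv_rel K n f1 f2 R).
- move=> u; have [k ek] := level_dvd pp1 pe1 qe1 u.
  exists (k *: - rot q2 + pairing q1 u *: e2); have [g1 g2] := solve p2 q2 e2 k (pairing q1 u) pe2 qe2.
  by rewrite /R g1 g2 -dd -ek /level addrK.
- move=> v; have [k ek] := level_dvd pp2 pe2 qe2 v.
  exists (k *: - rot q1 + pairing q2 v *: e1); have [g1 g2] := solve p1 q1 e1 k (pairing q2 v) pe1 qe1.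
  by rewrite /R g1 g2 dd -ek /level addrK.
- by move=> u v u' v' [h1 h2] [h3 h4]; rewrite /R !pairingDr h1 h2 h3 h4.
- by move=> u v v' [h1 h2] [h3 h4]; apply: (pairing_inj d2); rewrite -?h1 -?h2.
- by move=> u u' v [h1 h2] [h3 h4]; apply: (pairing_inj d1); rewrite ?h1 ?h2.
- by move=> u v [h1 h2]; rewrite SE1 SE2 h1 h2.
Qed.

Lemma rot_neq0 p : primitive p -> rot p != 0.
Proof.
move=> pp; apply: contraNneq (primitive_neq0 pp) => z; apply/eqP.
have z0 := congr1 (fun v : 'rV_2 => v 0 0) z; have z1 := congr1 (fun v : 'rV_2 => v 0 1) z.
rewrite !mxE /= in z0 z1; apply: row2P; rewrite !mxE //.
by apply: oppr_inj; rewrite z0 oppr0.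
Qed.

(** Units distinguish the types of cones: all characters are units for the plane,
    some but not all for a half-plane, and only 0 for a pointed cone. *)
Theorem toric_unique f1 f2 : toric_param X f1 -> toric_param X f2 -> toric_equiv f1 f2.
Proof.
move=> tp1 tp2.
have half_pointed g1 g2 p p' q' : toric_param X g1 -> toric_param X g2 -> primitive p ->
    (forall u, weight_monoid g1 u <-> 0 <= pairing p u) -> 0 < det2 p' q' ->
    (forall u, weight_monoid g2 u <-> 0 <= pairing p' u /\ 0 <= pairing q' u) -> False.
  move=> t1 t2 pp S1 d0 S2; have := rot_neq0 pp; rewrite (pointed_no_units affX t1 t2 d0 (w := rot p)) ?eqxx //.
  - by move=> u /S2 [].
  - by move=> u /S2 [].
  - by apply/S1; rewrite pairing_rot0.
  - by apply/S1; rewrite pairingNr pairing_rot0 oppr0.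
case: (weight_cone_type tp1) => [all1|p1 pp1 S1|p1 q1 pp1 pq1 d1 S1];
case: (weight_cone_type tp2) => [all2|p2 pp2 S2|p2 q2 pp2 pq2 d2 S2].
- by exists id, id; split.
- by case: (torus_not_bounded affX tp1 tp2 all1 (primitive_neq0 pp2)) => u /S2.
- by case: (torus_not_bounded affX tp1 tp2 all1 (primitive_neq0 pp2)) => u /S2 [].
- by case: (torus_not_bounded affX tp2 tp1 all2 (primitive_neq0 pp1)) => u /S1.
- exact: toric_equiv_half S1 S2.
- by case: (half_pointed _ _ _ _ _ tp1 tp2 pp1 S1 d2 S2).
- by case: (torus_not_bounded affX tp2 tp1 all2 (primitive_neq0 pp1)) => u /S1 [].
- by case: (half_pointed _ _ _ _ _ tp2 tp1 pp2 S2 d1 S1).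
- exact: (toric_equiv_pointed tp1 tp2 pp1 pq1 d1 S1 pp2 pq2 d2 S2).
Qed.
End Uniqueness.

(** * Demazure roots and weight monoids *)

Definition inequalities (ps : seq 'rV[int]_2) : cone :=
  fun v => forall p, p \in ps -> 0 <= pairing (to_rat p) v.

(** A Demazure root d of the ray p, seen on the monoid S of the weights: one
    can subtract multiples of - d from a weight as long as it stays nonnegative
    on p, and S contains a nonzero weight of the line orthogonal to p. *)
Record root_data (S : 'rV[int]_2 -> Prop) (p d : 'rV[int]_2) : Prop := RootData {
  rd_primitive : primitive p;
  rd_root : pairing p d = -1;
  rd_pos : forall u, S u -> 0 <= pairing p u;
  rd_facet : exists f, [/\ S f, f != 0 & pairing p f = 0];
  rd_down : forall u, S u -> 0 < pairing p u -> S (u + d) }.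

Section RationalPairing.

Lemma pairing_to_rat p u : pairing (to_rat p) (to_rat u) = (pairing p u)%:~R.
Proof. by rewrite !pairingE !mxE rmorphD !rmorphM. Qed.

Lemma qpairingC (u v : 'rV[rat]_2) : pairing u v = pairing v u.
Proof. by rewrite !pairingE mulrC [X in _ + X]mulrC. Qed.

Lemma qpairingZr c (u v : 'rV[rat]_2) : pairing u (c *: v) = c * pairing u v.
Proof. by rewrite !pairingE !mxE; ring. Qed.

Lemma qpairingZl c (u v : 'rV[rat]_2) : pairing (c *: u) v = c * pairing u v.
Proof. by rewrite !pairingE !mxE; ring. Qed.

Lemma to_rat_integral (v : 'rV[rat]_2) : exists (D : int) (w : 'rV[int]_2),
  0 < D /\ to_rat w = D%:~R *: v.
Proof.
exists (denq (v 0 0) * denq (v 0 1)), (vec2 (numq (v 0 0) * denq (v 0 1)) (numq (v 0 1) * denq (v 0 0))).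
have h0 := numqE (v 0 0); have h1 := numqE (v 0 1).
split; first by rewrite mulr_gt0 ?denq_gt0.
by apply: row2P; rewrite !mxE /= !rmorphM /= !numqE; ring.
Qed.

End RationalPairing.

Section RationalCone.
Variables (ps : seq 'rV[int]_2) (S : 'rV[int]_2 -> Prop).
Hypothesis SE : forall u, S u <-> forall p, p \in ps -> 0 <= pairing p u.
Hypothesis full : forall u, exists v w, [/\ S v, S w & u = v - w].
Notation omega := (inequalities ps).

Lemma inequalitiesE u : omega (to_rat u) <-> S u.
Proof.
rewrite SE; split=> h p /h; by rewrite pairing_to_rat ler0z.
Qed.

Lemma dual_to_rat p : dual_cone omega (to_rat p) <-> forall u, S u -> 0 <= pairing p u.
Proof.
split=> h u.
  by move/inequalitiesE/h; rewrite pairing_to_rat ler0z.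
move=> ou; have [D [w [D0 ew]]] := to_rat_integral u.
have Sw : S w.
  by apply/inequalitiesE => q /ou qu; rewrite ew qpairingZr mulr_ge0 ?ler0z // ltW.
have := h w Sw; rewrite -(ler0z rat) -pairing_to_rat ew qpairingZr pmulr_rge0 //.
by rewrite ltr0z.
Qed.

Lemma bidual m : (forall v, dual_cone omega v -> 0 <= pairing v (to_rat m)) -> S m.
Proof. by move=> h; apply/inequalitiesE => p hp; apply: h => u; apply. Qed.

Lemma positive_weight p : primitive p -> (forall u, S u -> 0 <= pairing p u) ->
  exists2 u, S u & 0 < pairing p u.
Proof.
move=> /primitive_bezout [a ha] pos; have [v [w [Sv Sw e]]] := full a.
exists v => //; have := pos w Sw; move: ha; rewrite e pairingBr; clear; lia.
Qed.

(** The face cut out by f is the ray of p: its points are orthogonal to f, so they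
    are multiples of p, and nonnegative ones because p is positive somewhere on
    S. *)
Lemma ray_generatorI p f : primitive p -> (forall u, S u -> 0 <= pairing p u) ->
  S f -> f != 0 -> pairing p f = 0 -> ray_generator (dual_cone omega) p.
Proof.
move=> pp pos Sf nf pf; split=> //; exists (fun v => exists c : rat, 0 <= c /\ v = c *: to_rat p).
split=> //; exists (to_rat f); split.
  by move=> v sv; rewrite qpairingC; apply: sv; apply/inequalitiesE.
have sp : dual_cone omega (to_rat p) by apply/dual_to_rat.
move=> v; split=> [[c [c0 ->]]|[sv vf]].
  split=> [u ou|]; first by rewrite qpairingZl mulr_ge0 ?sp.
  by rewrite qpairingZl pairing_to_rat pf mulr0.
have [u Su pu] := positive_weight pp pos.
have [k ek] := primitive_kernel pp pf.
have k0 : k != 0 by apply: contraNneq nf => k0; rewrite ek k0 scale0r.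
have vr : v 0 1 * (p 0 0)%:~R = v 0 0 * (p 0 1)%:~R.
  have : k%:~R * (v 0 1 * (p 0 0)%:~R - v 0 0 * (p 0 1)%:~R) = 0 :> rat.
    by rewrite -vf ek pairingE !mxE /= !rmorphM rmorphN /=; ring.
  by move/eqP; rewrite mulf_eq0 intr_eq0 (negPf k0) /= subr_eq0 => /eqP.
have nu : pairing (to_rat p) (to_rat u) != 0 by rewrite pairing_to_rat intr_eq0 gt_eqF.
exists (pairing v (to_rat u) / pairing (to_rat p) (to_rat u)); split.
  apply: divr_ge0; first by apply: sv; apply/inequalitiesE.
  by rewrite pairing_to_rat ler0z ltW.
have pE : pairing (to_rat p) (to_rat u) = (p 0 0)%:~R * (u 0 0)%:~R + (p 0 1)%:~R * (u 0 1)%:~R.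
  by rewrite pairingE !mxE.
have vE : pairing v (to_rat u) = v 0 0 * (u 0 0)%:~R + v 0 1 * (u 0 1)%:~R.
  by rewrite pairingE !mxE.
apply: row2P; rewrite !mxE mulrAC; apply: (canRL (mulfK nu)); rewrite pE vE mulrDl.
  by rewrite [X in _ = _ + X]mulrAC vr; ring.
by rewrite [X in _ = X + _]mulrAC -vr; ring.
Qed.

Lemma ray_generatorE p : ray_generator (dual_cone omega) p ->
  [/\ primitive p, forall u, S u -> 0 <= pairing p u
    & exists f, [/\ S f, f != 0 & pairing p f = 0]].
Proof.
move=> [pp [tau [[m [sm htau]] ray]]].
have [sp pm] : dual_cone omega (to_rat p) /\ pairing (to_rat p) m = 0.
  by apply/htau/ray; exists 1; rewrite scale1r.
split=> //; first exact/dual_to_rat.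
case: (eqVneq m 0) => [m0|nm].
  (* The dual cone is then the ray itself, so that omega is a half-plane. *)
  exists (rot p); split; [|exact: rot_neq0|exact: pairing_rot0].
  apply: bidual => v sv; have /ray [c [_ ->]] : tau v.
    by apply/htau; split=> //; rewrite m0 pairingE !mxE !mulr0 addr0.
  by rewrite qpairingZl pairing_to_rat pairing_rot0 mulr0.
have [D [w [D0 ew]]] := to_rat_integral m.
have D0' : 0 < D%:~R :> rat by rewrite ltr0z.
exists w; split.
- by apply: bidual => v sv; rewrite ew qpairingZr pmulr_rge0 // qpairingC; apply: sm.
- apply: contraNneq nm => w0; have : D%:~R *: m = 0 by rewrite -ew w0; apply: row2P; rewrite !mxE.
  by move/eqP; rewrite scaler_eq0 gt_eqF.
- by apply/eqP; rewrite -(intr_eq0 rat) -pairing_to_rat ew qpairingZr pm mulr0.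
Qed.

Hypothesis rays : forall p, p \in ps -> ray_generator (dual_cone omega) p.

(** Adding d lowers p by 1 and does not lower the other inequalities of S. *)
Lemma demazure_rootE p d : demazure_root (dual_cone omega) p d -> root_data S p d.
Proof.
move=> [/ray_generatorE [pp pos fac] pd other]; split=> // u Su pu.
apply/SE => q qs; rewrite pairingDr; case: (eqVneq q p) => [->|nq].
  by rewrite pd; move: pu; clear; lia.
by rewrite addr_ge0 ?other //; [apply: (proj1 (SE u) Su) | apply: rays].
Qed.

(** Let g be a weight on the facet of another ray q.  Then p(g) > 0, so g + d is a
    weight, and q(d) = q(g + d) is nonnegative. *)
Lemma demazure_rootI p d : root_data S p d -> demazure_root (dual_cone omega) p d.
Proof.
move=> [pp pd pos [f [Sf nf pf]] down]; split=> //; first exact: ray_generatorI Sf nf pf.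
move=> q /ray_generatorE [pq qpos [g [Sg ng qg]]] nqp.
(* The weight g on the facet of q is positive on p, as q is neither p nor - p. *)
have pg : 0 < pairing p g.
  rewrite lt_def pos // andbT; apply/eqP => pg.
  have [a ha] := primitive_bezout pp; have [b hb] := primitive_bezout pq.
  have [k ek] := primitive_kernel pp pg; have k0 : k != 0 by apply: contraNneq ng => k0; rewrite ek k0 scale0r.
  have d0 : det2 p q = 0.
    by move: qg; rewrite ek pairingZr pairing_rot => /eqP; rewrite mulf_eq0 (negPf k0) => /eqP.
  have eq_qp u : pairing q u = pairing q a * pairing p u.
    move: d0; rewrite /det2 !pairingE => d0; rewrite -[LHS]mul1r -{1}ha pairingE.
    transitivity ((q 0 0 * a 0 0 + q 0 1 * a 0 1) * (p 0 0 * u 0 0 + p 0 1 * u 0 1)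
      + (p 0 0 * q 0 1 - p 0 1 * q 0 0) * (a 0 0 * u 0 1 - a 0 1 * u 0 0)); first by ring.
    by rewrite d0 mul0r addr0.
  have unit : pairing q a * pairing p b = 1 by rewrite -eq_qp.
  have [u Su pu] := positive_weight pp pos.
  have qu := qpos u Su; rewrite eq_qp pmulr_lge0 // in qu.
  have q1 : pairing q a = 1.
    move: (pairing q a) (pairing p b) unit qu => x y e1 x0.
    have y0 : 0 < y by rewrite -(pmulr_rgt0 _ (x := x)) ?e1 // lt_def x0 andbT; apply: contra_eqN e1 => /eqP ->; rewrite mul0r.
    move: x0 y0 e1; clear; nia.
  case/negP: nqp; apply/eqP; apply: row2P.
    by have := eq_qp (vec2 1 0); rewrite q1 mul1r !pairingE !vec2E !mulr1 !mulr0 !addr0.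
  by have := eq_qp (vec2 0 1); rewrite q1 mul1r !pairingE !vec2E !mulr1 !mulr0 !add0r.
have := qpos _ (down g Sg pg); by rewrite pairingDr qg add0r.
Qed.
End RationalCone.

Section ConeShape.
Variable S : 'rV[int]_2 -> Prop.
Hypothesis full : forall u, exists v w, [/\ S v, S w & u = v - w].

Lemma polyhedralI (ps : seq 'rV[int]_2) k (g : 'I_k -> 'rV[int]_2) :
  (forall i p, p \in ps -> 0 <= pairing p (g i)) ->
  (forall u, inequalities ps u -> exists c : 'I_k -> rat,
     (forall i, 0 <= c i) /\ u = \sum_i c i *: to_rat (g i)) ->
  rational_polyhedral (inequalities ps).
Proof.
move=> gin gen; exists k, (\matrix_(i, j) to_rat (g i) 0 j) => u; split.
  move/gen => [c [c0 ->]]; exists (\row_i c i); split=> [i|]; first by rewrite mxE.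
  apply/rowP => j; rewrite summxE mxE; apply: eq_bigr => i _; by rewrite !mxE.
move=> [c [c0 ->]] p pps; have -> : c *m (\matrix_(i, j) to_rat (g i) 0 j) = \sum_i c 0 i *: to_rat (g i).
  apply/rowP => j; rewrite summxE mxE; apply: eq_bigr => i _; by rewrite !mxE.
have -> : pairing (to_rat p) (\sum_i c 0 i *: to_rat (g i)) = \sum_i c 0 i * pairing (to_rat p) (to_rat (g i)).
  apply: (big_rec2 (fun x y => pairing (to_rat p) x = y)); first by rewrite pairingE !mxE !mulr0 addr0.
  by move=> i y1 y2 _ <-; rewrite pairingDr qpairingZr.
by apply: sumr_ge0 => i _; rewrite mulr_ge0 // pairing_to_rat ler0z gin.
Qed.

(** The facet of p contains the weight rot p or - rot p, which makes p a ray of the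
    dual cone. *)
Lemma cone_inequalities : cone_type S -> exists ps,
  [/\ forall u, S u <-> forall p, p \in ps -> 0 <= pairing p u,
      rational_polyhedral (inequalities ps)
    & forall p, p \in ps -> ray_generator (dual_cone (inequalities ps)) p].
Proof.
have posneg (x : rat) : exists a b, [/\ 0 <= a, 0 <= b & x = a - b].
  case: (ltrP x 0) => h; [exists 0, (- x) | exists x, 0]; rewrite ?sub0r ?opprK ?subr0; split=> //.
  by rewrite oppr_ge0 ltW.
case=> [all|p pp S1|p q pp pq d0 S1].
- exists [::]; split; [by move=> u; split | | by []].
  apply: (@polyhedralI _ 4 (fun i => nth 0 [:: vec2 1 0; - vec2 1 0; vec2 0 1; - vec2 0 1] i)) => // u _.
  have [a [b [a0 b0 e0]]] := posneg (u 0 0); have [a' [b' [a0' b0' e1]]] := posneg (u 0 1).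
  exists (fun i => nth 0 [:: a; b; a'; b'] i); split; first by case=> [[|[|[|[|]]]]].
  rewrite !big_ord_recl big_ord0 /=; apply: row2P; rewrite !mxE /= ?e0 ?e1; ring.
- have [a ha] := primitive_bezout pp.
  have S1' u : S u <-> forall p0, p0 \in [:: p] -> 0 <= pairing p0 u.
    by rewrite S1; split=> [h p0|]; [rewrite inE => /eqP -> | apply; rewrite inE].
  exists [:: p]; split=> //.
    apply: (@polyhedralI _ 3 (fun i => nth 0 [:: rot p; - rot p; a] i)).
      move=> i p0; rewrite inE => /eqP -> ; case: i => [[|[|[|]]]] //= _.
      - by rewrite pairing_rot0.
      - by rewrite pairingNr pairing_rot0 oppr0.
      - by rewrite ha.
    move=> u ou; have pu : 0 <= pairing (to_rat p) u by apply: ou; rewrite inE.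
    have [x [y [x0 y0 e]]] := posneg ((a 0 0)%:~R * u 0 1 - (a 0 1)%:~R * u 0 0).
    exists (fun i => nth 0 [:: x; y; pairing (to_rat p) u] i); split; first by case=> [[|[|[|]]]].
    have haq : (p 0 0)%:~R * (a 0 0)%:~R + (p 0 1)%:~R * (a 0 1)%:~R = 1 :> rat.
      by rewrite -!rmorphM -rmorphD -pairingE ha.
    have -> : x = y + ((a 0 0)%:~R * u 0 1 - (a 0 1)%:~R * u 0 0) by rewrite e; ring.
    rewrite !big_ord_recl big_ord0 pairingE /=; apply: row2P; rewrite !mxE /= !rmorphN /=.
      by rewrite -[LHS]mul1r -[X in X * _]haq; ring.
    by rewrite -[LHS]mul1r -[X in X * _]haq; ring.
  move=> p0; rewrite inE => /eqP ->.
  apply: (ray_generatorI S1' full pp (f := rot p)); rewrite ?rot_neq0 ?pairing_rot0 //.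
    by move=> u /S1.
  by apply/S1; rewrite pairing_rot0.
have S1' u : S u <-> forall p0, p0 \in [:: p; q] -> 0 <= pairing p0 u.
  rewrite S1; split=> [[h h'] p0|h]; first by rewrite !inE => /orP[] /eqP ->.
  by split; apply: h; rewrite !inE eqxx ?orbT.
exists [:: p; q]; split=> //.
  apply: (@polyhedralI _ 2 (fun i => nth 0 [:: rot p; - rot q] i)).
    move=> i p0; rewrite !inE => /orP[] /eqP ->; case: i => [[|[|]]] //= _; rewrite ?pairingNr ?pairing_rot0 ?oppr0 //.
    - by rewrite pairing_rot det2C opprK ltW.
    - by rewrite pairing_rot ltW.
  move=> u ou; pose D : rat := (det2 p q)%:~R; have D0 : 0 < D by rewrite ltr0z.
  have pu : 0 <= pairing (to_rat p) u by apply: ou; rewrite inE eqxx.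
  have qu : 0 <= pairing (to_rat q) u by apply: ou; rewrite !inE eqxx orbT.
  exists (fun i => nth 0 [:: pairing (to_rat q) u / D; pairing (to_rat p) u / D] i); split.
    by case=> [[|[|]]] //= _; apply: divr_ge0 => //; apply: ltW.
  have nD : D != 0 by rewrite gt_eqF.
  rewrite !big_ord_recl big_ord0 !pairingE /=; apply: row2P; rewrite !mxE /= !rmorphN /=; apply: (mulIf nD).
    rewrite addr0 mulrDl mulrAC divfK // [X in _ = _ + X]mulrAC divfK // /D /det2 !rmorphB !rmorphM /=; ring.
  rewrite addr0 mulrDl mulrAC divfK // [X in _ = _ + X]mulrAC divfK // /D /det2 !rmorphB !rmorphM /=; ring.
move=> p0; rewrite !inE => /orP[] /eqP ->.
  apply: (ray_generatorI S1' full pp (f := rot p)); rewrite ?rot_neq0 ?pairing_rot0 //.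
    by move=> u /S1 [].
  by apply/S1; rewrite pairing_rot0 pairing_rot; split=> //; apply: ltW.
apply: (ray_generatorI S1' full pq (f := - rot q)); rewrite ?oppr_eq0 ?rot_neq0 ?pairingNr ?pairing_rot0 ?oppr0 //.
  by move=> u /S1 [].
by apply/S1; rewrite !pairingNr pairing_rot0 pairing_rot det2C opprK oppr0; split=> //; apply: ltW.
Qed.
End ConeShape.

(** * Monoid structures given by a comultiplication *)

Section Density.
Variables (K : closedFieldType) (n : nat) (X : pset K n).
Hypotheses (affX : affine_variety X).

Definition joint_pfun (f : 'rV[K]_n -> 'rV[K]_n -> K) :=
  pfun (fun z : 'rV[K]_(n + n) => f (lsubmx z) (rsubmx z)).

Lemma joint_pfun_l f y : joint_pfun f -> pfun (f^~ y).
Proof.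
move=> jf; apply: (pfun_ext _ (pfun_comp jf (pfun_row_mxl y))) => x.
by rewrite row_mxKl row_mxKr.
Qed.

Lemma joint_pfun_r f x : joint_pfun f -> pfun (f x).
Proof.
move=> jf; apply: (pfun_ext _ (pfun_comp jf (pfun_row_mxr x))) => y.
by rewrite row_mxKl row_mxKr.
Qed.

Section DenseMonoid.
Variables (D : pset K n) (mu : 'rV[K]_n -> 'rV[K]_n -> 'rV[K]_n) (e : 'rV[K]_n).
Hypotheses (DX : forall x, D x -> X x) (dD : dense_in X D).
Hypotheses (jmu : forall j, joint_pfun (fun x y => mu x y 0 j)).
Hypotheses (muX : forall x y, X x -> X y -> X (mu x y)).
Hypotheses (De : D e).
Hypotheses (mu_assoc : forall x y z, D x -> D y -> D z -> mu x (mu y z) = mu (mu x y) z).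
Hypotheses (mu_comm : forall x y, D x -> D y -> mu x y = mu y x).
Hypotheses (mu_unit : forall x, D x -> mu e x = x).

Let pl y j : pfun (fun x => mu x y 0 j).
Proof. exact: (joint_pfun_l y (jmu j)). Qed.
Let pr x j : pfun (fun y => mu x y 0 j).
Proof. exact: (joint_pfun_r x (jmu j)). Qed.

(** The identities that define a commutative monoid extend from a dense subset
    to X, one variable at a time. *)
Lemma dense_monoid : comm_monoid X mu e.
Proof.
have comm x y : X x -> X y -> mu x y = mu y x.
  move=> Xx Xy; apply/rowP => j; apply/eqP; rewrite -subr_eq0; apply/eqP; move: x y Xx Xy.
  apply: (dense_pfun2 (f := fun x y => mu x y 0 j - mu y x 0 j) dD) => [x|y|x y Dx Dy].
  - exact: pfunB.
  - exact: pfunB.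
  - by rewrite mu_comm // subrr.
have unit x : X x -> mu e x = x.
  move=> Xx; apply/rowP => j; move: x Xx.
  apply: (dense_cr DX dD); try exact: coordinate_ring_pfun.
    by apply/coordinate_ring_pfun/pfun_coord.
  by move=> x Dx; rewrite mu_unit.
split=> //; last by move=> x Xx; rewrite comm ?unit //; apply: DX.
- split=> [z [h1 h2]|j]; first exact: muX.
  exact/regular_pfun/jmu.
- have assocD x y z : D x -> X y -> X z -> mu x (mu y z) = mu (mu x y) z.
    move=> Dx Xy Xz; apply/rowP => j; apply/eqP; rewrite -subr_eq0; apply/eqP; move: y z Xy Xz.
    apply: (dense_pfun2 (f := fun y z => mu x (mu y z) 0 j - mu (mu x y) z 0 j) dD) => [y|z|y z Dy Dz].
    + apply: pfunB; last exact: pr.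
      exact: (pfun_comp (f := fun w => mu x w 0 j) (g := mu y)).
    + apply: pfunB.
        exact: (pfun_comp (f := fun w => mu x w 0 j) (g := fun y => mu y z)).
      exact: (pfun_comp (f := fun w => mu w z 0 j) (g := mu x)).
    + by rewrite mu_assoc // subrr.
  move=> x y z Xx Xy Xz; apply/rowP => j; move: x Xx; apply: (dense_cr DX dD).
  + exact/coordinate_ring_pfun/pl.
  + apply/coordinate_ring_pfun.
    exact: (pfun_comp (f := fun w => mu w z 0 j) (g := fun x => mu x y)).
  + by move=> x Dx; rewrite assocD.
- exact: DX.
Qed.
End DenseMonoid.

(** Multiplicativity extends by density, one variable at a time; the unit is
    preserved because G is onto. *)
Lemma dense_monoid_iso (D : pset K n) mu e nu e' G G' :
  (forall x, D x -> X x) -> dense_in X D -> comm_monoid X mu e -> comm_monoid X nu e' ->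
  isomorphism X X G G' ->
  (forall x y, D x -> D y -> G (mu x y) = nu (G x) (G y)) -> monoid_iso X mu e X nu e'.
Proof.
move=> DX dD mon mon' iso homD; have cX := affX.1.
have GX x : X x -> X (G x) by apply: (iso_morph iso).1.
have crG j : coordinate_ring X (fun x => G x 0 j).
  by apply: regular_closed => //; apply: (iso_morph iso).2.
have muX x y : X x -> X y -> X (mu x y) by apply: (mu_closed mon).
have hom_l x y : D x -> X y -> G (mu x y) = nu (G x) (G y).
  move=> Dx Xy; apply/rowP => j; move: y Xy; apply: (dense_cr DX dD).
  - apply: (coordinate_ring_comp (crG j)); first by move=> y Xy; apply: muX => //; apply: DX.
    by move=> k; apply: (mu_cr_r cX mon); apply: DX.
  - apply: (coordinate_ring_comp (Y := X) (f := fun w => nu (G x) w 0 j) (g := G)) => //.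
    by apply: (mu_cr_r cX mon'); apply: GX; apply: DX.
  - by move=> y Dy; rewrite homD.
have hom x y : X x -> X y -> G (mu x y) = nu (G x) (G y).
  move=> Xx Xy; apply/rowP => j; move: x Xx; apply: (dense_cr DX dD).
  - apply: (coordinate_ring_comp (crG j)); first by move=> x Xx; apply: muX.
    by move=> k; apply: (mu_cr_l cX mon).
  - apply: (coordinate_ring_comp (Y := X) (f := fun w => nu w (G y) 0 j) (g := G)) => //.
    by apply: (mu_cr_l cX mon'); apply: GX.
  - by move=> x Dx; rewrite hom_l.
exists G, G'; split=> //.
have Xe := mon_unit mon; have Xe' := mon_unit mon'.
have Xh : X (G' e') by apply: (iso_inv_morph iso).1.
have := hom e (G' e') Xe Xh; rewrite (mon_unitl mon Xh) (iso_inv_cancel iso Xe') (mon_unitr mon').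
  by move=> <-.
exact: GX.
Qed.
End Density.

Section Comultiplication.
Variables (K : closedFieldType) (n : nat) (X : pset K n).
Hypotheses (charK : has_pchar0 K) (affX : affine_variety X).
Variables (f : 'rV[K]_2 -> 'rV[K]_n) (tp : toric_param X f).
Notation S := (weight_monoid f).

(** The expansion of f in characters extends from the torus to X by density. *)
Lemma char_coords : exists F c, (forall u, u \in F -> S u) /\
  forall x, X x -> x = char_map F c (fun u => if u \in F then chi f u x else 0) :> 'rV[K]_n.
Proof.
have [F [c [wF hf]]] := tp_coords tp; exists F, c; split=> // x Xx.
apply/rowP => i; rewrite mxE; move: x Xx; apply: (tp_eq affX tp).
- by apply/coordinate_ring_pfun/pfun_coord.
- apply/coordinate_ring_pfun/pfun_sum => u; apply: pfunM; first exact: pfun_const.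
  by case: (boolP (u \in F)) => [/wF|_]; [apply: chi_pfun | apply: pfun_const].
- by move=> t ht; rewrite hf //; apply: eq_big_seq => u uF; rewrite uF (chi_param tp).
Qed.

(** The product of two points is the point with the prescribed characters.  It is
    defined by the polynomial map char_map everywhere, and lies in X and has these
    characters on a dense subset, hence everywhere. *)
Lemma comultiplication_law (Delta : 'rV[int]_2 -> 'rV[K]_n -> 'rV[K]_n -> K) (D : pset K n) :
  (forall u, S u -> joint_pfun (Delta u)) -> dense_in X D ->
  (forall x y, D x -> D y -> exists2 z, X z & forall u, S u -> chi f u z = Delta u x y) ->
  exists mu : 'rV[K]_n -> 'rV[K]_n -> 'rV[K]_n,
    [/\ forall j, joint_pfun (fun x y => mu x y 0 j), forall x y, X x -> X y -> X (mu x y)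
      & forall u x y, S u -> X x -> X y -> chi f u (mu x y) = Delta u x y].
Proof.
move=> jD dD hD; have [F [c [wF hF]]] := char_coords.
pose mu x y := char_map F c (fun u => if u \in F then Delta u x y else 0).
have jmu j : joint_pfun (fun x y => mu x y 0 j).
  apply: (pfun_ext (f := fun z : 'rV_(n + n) => \sum_(u <- F) c j u *
      (if u \in F then Delta u (lsubmx z) (rsubmx z) else 0))); first by move=> z; rewrite mxE.
  apply: pfun_sum => u; apply: pfunM; first exact: pfun_const.
  by case: (boolP (u \in F)) => [/wF/jD //|_]; apply: pfun_const.
have muD x y : D x -> D y -> X (mu x y) /\ forall u, S u -> chi f u (mu x y) = Delta u x y.
  move=> Dx Dy; have [z Xz hz] := hD x y Dx Dy.
  suff -> : mu x y = z by [].
  rewrite (hF z Xz) /mu; apply/rowP => j; rewrite !mxE; apply: eq_big_seq => u uF.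
  by rewrite uF hz //; apply: wF.
have pl y j : pfun (fun x => mu x y 0 j) := joint_pfun_l y (jmu j).
have pr x j : pfun (fun y => mu x y 0 j) := joint_pfun_r x (jmu j).
exists mu; split=> //.
  move=> x y Xx Xy; have [Ps hPs] := affX.1; apply/hPs => P SP; move: x y Xx Xy.
  apply: (dense_pfun2 (f := fun x y => ev P (mu x y)) dD) => [x|y|x y Dx Dy].
  - by apply: (pfun_comp (pfun_ev P)) => j; apply: pr.
  - by apply: (pfun_comp (pfun_ev P)) => j; apply: pl.
  - by have [/hPs h _] := muD x y Dx Dy; apply: h.
move=> u x y Su Xx Xy; apply/eqP; rewrite -subr_eq0; apply/eqP; move: x y Xx Xy.
apply: (dense_pfun2 (f := fun x y => chi f u (mu x y) - Delta u x y) dD) => [x|y|x y Dx Dy].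
- by apply: pfunB; [apply: (pfun_comp (chi_pfun Su)) => j; apply: pr | apply: joint_pfun_r (jD u Su)].
- by apply: pfunB; [apply: (pfun_comp (chi_pfun Su)) => j; apply: pl | apply: joint_pfun_l (jD u Su)].
- by have [_ ->] := muD x y Dx Dy; rewrite ?subrr.
Qed.

Lemma chi_joint_l u : S u -> joint_pfun (fun x _ => chi f u x).
Proof. by move=> Su; apply: (pfun_comp (chi_pfun Su)) => j; apply: pfun_lsubmx. Qed.

Lemma chi_joint_r u : S u -> joint_pfun (fun _ y => chi f u y).
Proof. by move=> Su; apply: (pfun_comp (chi_pfun Su)) => j; apply: pfun_rsubmx. Qed.

(** On a point where no character vanishes, the characters extend to a
    homomorphism from the whole lattice to the multiplicative group. *)
Lemma nonvanishing_torus a0 b0 a1 b1 x : S a0 -> S b0 -> S a1 -> S b1 ->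
  vec2 1 0 = a0 - b0 -> vec2 0 1 = a1 - b1 -> X x -> (forall u, S u -> chi f u x != 0) ->
  x = f (vec2 (chi f a0 x / chi f b0 x) (chi f a1 x / chi f b1 x)).
Proof.
move=> Sa0 Sb0 Sa1 Sb1 e0 e1 Xx nz.
pose A u := proj1_sig (constructive_indefinite_description _ (weight_monoid_full charK tp u)).
have AP u : exists w, [/\ S (A u), S w & u = A u - w].
  exact: (proj2_sig (constructive_indefinite_description _ (weight_monoid_full charK tp u))).
pose h u := chi f (A u) x / chi f (A u - u) x.
have hE u a b : S a -> S b -> u = a - b -> h u = chi f a x / chi f b x.
  move=> Sa Sb e; have [w [SA Sw ew]] := AP u.
  have Ew : A u - u = w by rewrite {2}ew opprB addrC subrK.
  rewrite /h Ew; apply/eqP; rewrite eqr_div ?nz // -!(chiD affX tp) //; apply/eqP.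
  congr chi; rewrite -[A u](subrK w) -ew e; rewrite -addrA [w + b]addrC addrA subrK //.
have h0 u : h u != 0.
  have [w [SA Sw ew]] := AP u; rewrite (hE u (A u) w) // mulf_neq0 ?invr_eq0 ?nz //.
have hD u v : h (u + v) = h u * h v.
  have [w [SA Sw ew]] := AP u; have [w' [SA' Sw' ew']] := AP v.
  rewrite (hE u (A u) w) // (hE v (A v) w') // (hE (u + v) (A u + A v) (w + w')); try exact: weight_monoidD.
    by rewrite !(chiD affX tp) // invfM mulrACA.
  by rewrite {1}ew {1}ew' opprD addrACA.
rewrite -(hE _ _ _ Sa0 Sb0 e0) -(hE _ _ _ Sa1 Sb1 e1).
have ht : torus (vec2 (h (vec2 1 0)) (h (vec2 0 1))) by apply: ord2_ind; rewrite vec2E.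
apply: (chi_separate affX tp) => //; first exact: (tp_in tp).
move=> u Su; rewrite (chi_param tp) // torus_char_hom // (hE u u 0) ?subr0 //; last exact: weight_monoid0.
by rewrite (chi0 affX tp) // divr1.
Qed.

(** A point is a unit if and only if no character vanishes there. *)
Theorem toric_monoid_structure : exists mu,
  [/\ comm_monoid_of_rank X mu (f (torus_one K 2)) 2,
      forall x, invertibles X mu (f (torus_one K 2)) x <-> exists t, torus t /\ x = f t,
      forall s t, torus s -> torus t -> mu (f s) (f t) = f (tmul s t)
    & forall u x y, S u -> X x -> X y -> chi f u (mu x y) = chi f u x * chi f u y].
Proof.
pose D x := exists t, torus t /\ x = f t.
have dD : dense_in X D := tp_dense affX tp.
have DX x : D x -> X x by move=> [t [ht ->]]; apply: (tp_in tp).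
have [|||mu [jmu muX muE]] := @comultiplication_law (fun u x y => chi f u x * chi f u y) D.
- by move=> u Su; apply: pfunM; [apply: chi_joint_l | apply: chi_joint_r].
- exact: dD.
- move=> x y [s [hs ->]] [t [ht ->]]; exists (f (tmul s t)); first exact/(tp_in tp)/torus_tmul.
  by move=> u Su; rewrite !(chi_param tp) ?tchar_tmul //; apply: torus_tmul.
have mu_f s t : torus s -> torus t -> mu (f s) (f t) = f (tmul s t).
  move=> hs ht; have Xs := tp_in tp hs; have Xt := tp_in tp ht.
  have Xst := tp_in tp (torus_tmul hs ht).
  apply: (chi_separate affX tp) => //; first exact: muX.
  by move=> u Su; rewrite muE // !(chi_param tp) ?tchar_tmul //; apply: torus_tmul.
have t1 := torus_one_in K; set e := f (torus_one K 2).
have mon : comm_monoid X mu e.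
  apply: (dense_monoid DX dD jmu muX); first by exists (torus_one K 2).
  - move=> _ _ _ [r [hr ->]] [s [hs ->]] [t [ht ->]]; rewrite !mu_f //; try exact: torus_tmul.
    by congr f; apply/rowP => i; rewrite !mxE mulrA.
  - by move=> _ _ [s [hs ->]] [t [ht ->]]; rewrite !mu_f // tmulC.
  - by move=> _ [t [ht ->]]; rewrite mu_f // tmul1.
have [a0 [b0 [Sa0 Sb0 e0]]] := weight_monoid_full charK tp (vec2 1 0).
have [a1 [b1 [Sa1 Sb1 e1]]] := weight_monoid_full charK tp (vec2 0 1).
have unit_nz x u : invertibles X mu e x -> S u -> chi f u x != 0.
  move=> [Xx [y [Xy exy _]]] Su; have := muE u x y Su Xx Xy; rewrite exy (chi_param tp) // tchar_one => h.
  by apply: contra_eqN h => /eqP ->; rewrite mul0r oner_eq0.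
pose psi x := vec2 (chi f a0 x / chi f b0 x) (chi f a1 x / chi f b1 x).
have unitT x : invertibles X mu e x -> torus (psi x).
  by move=> hx; apply: ord2_ind; rewrite vec2E mulf_neq0 ?invr_eq0 ?unit_nz.
have unitE x : invertibles X mu e x -> f (psi x) = x.
  by move=> hx; rewrite -nonvanishing_torus //; [case: hx | move=> u; apply: unit_nz].
have f_unit t : torus t -> invertibles X mu e (f t).
  move=> ht; split; first exact: (tp_in tp).
  pose t' : 'rV[K]_2 := \row_i (t 0 i)^-1.
  have ht' : torus t' by move=> i; rewrite mxE invr_eq0.
  have tt' : tmul t t' = torus_one K 2 by apply/rowP => i; rewrite !mxE divff.
  by exists (f t'); rewrite !mu_f // (tmulC t' t) tt'; split=> //; apply: (tp_in tp).
exists mu; split=> //.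
- split=> //; exists 0%N, f, psi; split; last first.
    by move=> s t /GmGa20 hs /GmGa20 ht; rewrite GmGa20_mul mu_f.
  split.
  + split=> [t /GmGa20 /f_unit //|j].
    have [F [c [wF hf]]] := tp_coords tp.
    apply: (regular_ext (f := fun t : 'rV[K]_2 => \sum_(u <- F) c j u * torus_char u t)).
      by move=> t /GmGa20 ht; rewrite hf.
    apply: regular_sum => u; apply: regularM; first exact/regular_pfun/pfun_const.
    apply: regular_prod => i; apply: regularXz; first by move=> t /GmGa20.
    exact/regular_pfun/pfun_coord.
  + split=> [x /unitT /GmGa20 //|].
    have reg a b : S a -> S b -> regular_on (invertibles X mu e) (fun x => chi f a x / chi f b x).
      move=> Sa Sb; apply: regularM; first exact/regular_pfun/chi_pfun.
      by apply: regularV; [move=> x hx; apply: unit_nz | apply/regular_pfun/chi_pfun].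
    by apply: ord2_ind; [apply: regular_ext (reg a0 b0 _ _) | apply: regular_ext (reg a1 b1 _ _)] => // x _; rewrite vec2E.
  + move=> t /GmGa20 ht; apply: (tp_inj tp) => //; first exact/unitT/f_unit.
    by rewrite unitE //; apply: f_unit.
  + exact: unitE.
- move=> x; split=> [hx|[t [ht ->]]]; last exact: f_unit.
  by exists (psi x); rewrite unitE //; split=> //; apply: unitT.
Qed.
End Comultiplication.

(** * The monoid structure of a Demazure root *)

Section RootMonoid.
Variables (K : closedFieldType) (n : nat) (X : pset K n).
Hypotheses (charK : has_pchar0 K) (affX : affine_variety X) (norX : normal_variety X).
Variables (f : 'rV[K]_2 -> 'rV[K]_n) (tp : toric_param X f).
Notation S := (weight_monoid f).

Lemma affine_dense1 : dense_in (@affine_space K 2) (fun y => y 0 1 != 0).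
Proof.
move=> P hP x _; case: (eqVneq P 0) => [->|nP]; first by rewrite /ev meval0.
have nX : 'X_1 != 0 :> {mpoly K[2]}.
  apply/eqP => z; have := congr1 (fun Q : {mpoly K[2]} => ev Q (const_mx 1)) z.
  by rewrite /ev mevalXU meval0 mxE => /eqP; rewrite oner_eq0.
have [y [Py yX]] := mpoly_nonzero_point2 nP nX; move: yX; rewrite /ev mevalXU => /hP y0.
by rewrite y0 eqxx in Py.
Qed.

(** The binomial formula for the character t^k x^a of G_m x G_a. *)
Lemma root_binomial (k : int) (a : nat) (g h : 'rV[K]_2) :
  torus_char (vec2 k a%:Z) (vec2 (g 0 0 * h 0 0) (g 0 1 + h 0 1)) =
  \sum_(j < a.+1) torus_char (vec2 k (a%:Z - (a - j)%N%:Z)) g *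
                  torus_char (vec2 k (a%:Z - j%:Z)) h *+ 'C(a, j).
Proof.
rewrite torus_charE !vec2E expfzMl -exprnP addrC exprDn mulr_sumr.
apply: eq_bigr => j _; have ja : (j <= a)%N by rewrite -ltnS.
rewrite !torus_charE !vec2E subzn ?leq_subr // subKn // subzn // -!exprnP.
by rewrite mulrnAr; congr (_ *+ _); ring.
Qed.

Section Root.
Variables (p d : 'rV[int]_2) (rd : root_data S p d).

Lemma root_downs u k : S u -> k%:Z <= pairing p u -> S (u + d *+ k).
Proof.
move=> Su; elim: k => [|k IH] hk; first by rewrite mulr0n addr0.
rewrite mulrSr addrA; apply: (rd_down rd); first by apply: IH; move: hk; clear; lia.
by rewrite pairingDr pairingMnr (rd_root rd) mulNrn; move: hk; rewrite natz; clear; lia.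
Qed.

(** A nonzero weight orthogonal to p is a multiple of rot p, so rot p or its
    opposite is a weight by saturation; it forms a basis with - d because p(d) is
    - 1. *)
Lemma root_basis : exists f0 q : 'rV[int]_2,
  [/\ S f0, pairing p f0 = 0, pairing q f0 = 1, pairing q d = 0
    & forall u, u = pairing q u *: f0 - pairing p u *: d].
Proof.
have [g [Sg ng pg]] := rd_facet rd; have [k ek] := primitive_kernel (rd_primitive rd) pg.
have k0 : k != 0 by apply: contraNneq ng => k0; rewrite ek k0 scale0r.
have pd : p 0 0 * d 0 0 + p 0 1 * d 0 1 = -1 by rewrite -pairingE (rd_root rd).
have [h|h] : S (rot p) \/ S (- rot p).
- case: k k0 ek => k k0 ek; [left | right].
    apply: (weight_monoid_saturated charK tp norX (k := k)); first by move: k0; case: k {ek}.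
    by rewrite -scaler_nat natz -ek.
  apply: (weight_monoid_saturated charK tp norX (k := k.+1)) => //.
  by rewrite -scaler_nat natz scalerN -scaleNr -NegzE -ek.
- exists (rot p), (vec2 (d 0 1) (- d 0 0)); split=> //.
  + exact: pairing_rot0.
  + by rewrite pairingE !mxE /=; apply: oppr_inj; rewrite -pd; ring.
  + by rewrite pairingE !mxE /=; ring.
  + move=> u; rewrite !pairingE !mxE /=; apply: row2P; rewrite !mxE /= -[LHS]opprK -mulN1r -pd; ring.
- exists (- rot p), (vec2 (- d 0 1) (d 0 0)); split=> //.
  + by rewrite pairingNr pairing_rot0 oppr0.
  + by rewrite pairingE !mxE /=; apply: oppr_inj; rewrite -pd; ring.
  + by rewrite pairingE !mxE /=; ring.
  + move=> u; rewrite !pairingE !mxE /=; apply: row2P; rewrite !mxE /= -[LHS]opprK -mulN1r -pd; ring.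
Qed.

Section Basis.
Variables (f0 q : 'rV[int]_2).
Hypotheses (Sf0 : S f0) (pf0 : pairing p f0 = 0) (qf0 : pairing q f0 = 1) (qd : pairing q d = 0).
Hypothesis basis : forall u, u = pairing q u *: f0 - pairing p u *: d.

Definition root_coords (u : 'rV[int]_2) := vec2 (pairing q u) (pairing p u).

Lemma root_coordsD u v : root_coords (u + v) = root_coords u + root_coords v.
Proof. by rewrite /root_coords !pairingDr; apply: row2P; rewrite !mxE. Qed.

Lemma root_coords_down u k : root_coords (u + d *+ k) = vec2 (pairing q u) (pairing p u - k%:Z).
Proof.
rewrite /root_coords !pairingDr !pairingMnr qd mul0rn addr0 (rd_root rd).
by rewrite mulNrn natz.
Qed.

(** The point with coordinates (t, x) in G_m x G_a is the one where the weight
    k f0 - j d has the value t^k x^j.  For x <> 0 it is in the open torus; the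
    case x = 0 follows by density as j >= 0. *)
Lemma root_points : exists phi : 'rV[K]_2 -> 'rV[K]_n,
  [/\ forall g : 'rV[K]_2, g 0 0 != 0 -> X (phi g),
      forall u (g : 'rV[K]_2), S u -> g 0 0 != 0 -> chi f u (phi g) = torus_char (root_coords u) g
    & forall j, regular_on (fun g : 'rV[K]_2 => g 0 0 != 0) (fun g => phi g 0 j)].
Proof.
have [F [c [wF hF]]] := char_coords affX tp.
pose phi (g : 'rV[K]_2) := char_map F c (fun u => if u \in F then torus_char (root_coords u) g else 0).
have on_torus g : torus g -> X (phi g) /\ forall u, S u -> chi f u (phi g) = torus_char (root_coords u) g.
  move=> hg; pose h u := torus_char (root_coords u) g.
  have hh u : torus_char u (vec2 (h (vec2 1 0)) (h (vec2 0 1))) = h u.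
    apply: torus_char_hom => [v w|v]; last exact: tchar_neq0.
    by rewrite /h root_coordsD tcharD.
  set t := vec2 _ _ in hh *; have ht : torus t by apply: ord2_ind; rewrite vec2E; apply: tchar_neq0.
  suff -> : phi g = f t.
    by split=> [|u Su]; [apply: (tp_in tp) | rewrite (chi_param tp) // hh].
  rewrite (hF _ (tp_in tp ht)); apply/rowP => j; rewrite !mxE; apply: eq_big_seq => u uF.
  by rewrite uF (chi_param tp) // hh.
have pchar (l : K) u : S u -> pfun (fun y : 'rV[K]_2 => torus_char (root_coords u) (vec2 l (y 0 1))).
  move=> Su; have := rd_pos rd Su; case E: (pairing p u) => [k|//] _.
  apply: (pfun_ext (f := fun y : 'rV[K]_2 => l ^ pairing q u * y 0 1 ^+ k)).
    by move=> y; rewrite torus_charE !vec2E E.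
  by apply: pfunM; [apply: pfun_const | apply: pfunX; apply: pfun_coord].
have pphi (l : K) j : pfun (fun y : 'rV[K]_2 => phi (vec2 l (y 0 1)) 0 j).
  apply: (pfun_ext (f := fun y : 'rV[K]_2 => \sum_(u <- F) c j u *
     (if u \in F then torus_char (root_coords u) (vec2 l (y 0 1)) else 0))); first by move=> y; rewrite mxE.
  apply: pfun_sum => u; apply: pfunM; first exact: pfun_const.
  by case: (boolP (u \in F)) => [/wF/pchar //|_]; apply: pfun_const.
have tor (l : K) (y : 'rV[K]_2) : l != 0 -> y 0 1 != 0 -> torus (vec2 l (y 0 1)).
  by move=> l0 y1; apply: ord2_ind; rewrite vec2E.
have gE (g : 'rV[K]_2) : g = vec2 (g 0 0) (g 0 1) by apply: row2P; rewrite vec2E.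
exists phi; split.
- move=> g g0; rewrite [g]gE.
  apply: (closed_dense_map affX (Y := @affine_space K 2) (g := fun y => phi (vec2 (g 0 0) (y 0 1))) affine_dense1) => // y y1.
  exact: (on_torus _ (tor _ _ g0 y1)).1.
- move=> u g Su g0; rewrite [g]gE.
  apply: (dense_cr (X := @affine_space K 2) (f := fun y => chi f u (phi (vec2 (g 0 0) (y 0 1))))
     (g := fun y => torus_char (root_coords u) (vec2 (g 0 0) (y 0 1))) _ affine_dense1) => //.
  + by apply/coordinate_ring_pfun/(pfun_comp (chi_pfun Su)).
  + exact/coordinate_ring_pfun/pchar.
  + by move=> y y1; rewrite (on_torus _ (tor _ _ g0 y1)).2.
- move=> j; apply: (regular_ext (f := fun g : 'rV[K]_2 => \sum_(u <- F) c j u *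
     (if u \in F then torus_char (root_coords u) g else 0))); first by move=> y; rewrite mxE.
  apply: regular_sum => u; apply: regularM; first exact/regular_pfun/pfun_const.
  case: (boolP (u \in F)) => [/wF Su|_]; last exact/regular_pfun/pfun_const.
  apply: (regular_ext (f := fun g : 'rV[K]_2 => g 0 0 ^ pairing q u * g 0 1 ^+ absz (pairing p u))).
    by move=> g _; rewrite torus_charE !vec2E exprnP gez0_abs //; apply: (rd_pos rd).
  apply: regularM; last by apply/regularX/regular_pfun/pfun_coord.
  by apply: regularXz => //; apply/regular_pfun/pfun_coord.
Qed.

(** From a weight with p > 0 one descends by d to level 1 and then adds multiples
    of f0. *)
Lemma unit_level_weight : exists (v : 'rV[int]_2) (N : nat), [/\ S v, pairing q v = N & pairing p v = 1].
Proof.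
have [a ha] := primitive_bezout (rd_primitive rd).
have [v [w [Sv Sw e]]] := weight_monoid_full charK tp a.
have pw := rd_pos rd Sw; have pv : 0 < pairing p v by move: ha pw; rewrite e pairingBr; clear; lia.
case E: (pairing p v) pv => [[|k]|//] _ //.
pose v1 := v + d *+ k.
have Sv1 : S v1 by apply: root_downs => //; rewrite E; lia.
have pv1 : pairing p v1 = 1.
  by rewrite /v1 pairingDr pairingMnr (rd_root rd) E mulNrn natz; lia.
exists (v1 + f0 *+ absz (pairing q v1)), (absz (pairing q v1 + (absz (pairing q v1))%:Z)); split.
- by apply: weight_monoidD => //; apply: weight_monoidMn.
- by rewrite pairingDr pairingMnr qf0 natz; lia.
- by rewrite pairingDr pairingMnr pf0 mul0rn addr0.
Qed.

Lemma pairing_basis_inj u v : pairing q u = pairing q v -> pairing p u = pairing p v -> u = v.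
Proof. by move=> e1 e2; rewrite [u]basis [v]basis e1 e2. Qed.

End Basis.

(** The units are the points where the weight f0 on the facet does not vanish.
    There f0 and a weight v with pairing p v = 1 recover the coordinates of
    G_m x G_a. *)
Theorem root_monoid_structure : exists mu e, comm_monoid_of_rank X mu e 1 /\
  forall u x y, S u -> X x -> X y -> let a := `|pairing p u|%N in
    chi f u (mu x y) =
      \sum_(j < a.+1) chi f (u + d *+ (a - j)) x * chi f (u + d *+ j) y *+ 'C(a, j).
Proof.
have [f0 [q [Sf0 pf0 qf0 qd basis]]] := root_basis.
have [phi [phiX phiE phireg]] := root_points q.
have [v [N [Sv qv pv]]] := unit_level_weight Sf0 pf0 qf0 qd.
have absp u : S u -> pairing p u = `|pairing p u|%N :> int.
  by move=> Su; rewrite gez0_abs //; apply: (rd_pos rd).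
pose Delta u x y := let a := `|pairing p u|%N in
  \sum_(j < a.+1) chi f (u + d *+ (a - j)) x * chi f (u + d *+ j) y *+ 'C(a, j).
pose gmul (g h : 'rV[K]_2) := vec2 (g 0 0 * h 0 0) (g 0 1 + h 0 1).
have gmul0 (g h : 'rV[K]_2) : g 0 0 != 0 -> h 0 0 != 0 -> gmul g h 0 0 != 0.
  by move=> g0 h0; rewrite vec2E mulf_neq0.
have down u k : S u -> (k <= `|pairing p u|)%N -> S (u + d *+ k).
  by move=> Su hk; apply: root_downs => //; rewrite absp // lez_nat.
have DeltaE u (g h : 'rV[K]_2) : S u -> g 0 0 != 0 -> h 0 0 != 0 ->
    Delta u (phi g) (phi h) = torus_char (root_coords q u) (gmul g h).
  move=> Su g0 h0; rewrite /root_coords (absp u Su) root_binomial; apply: eq_bigr => j _.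
  have ja : (j <= `|pairing p u|)%N by rewrite -ltnS.
  by rewrite !phiE //; try (by apply: down => //; apply: leq_subr); rewrite !(root_coords_down qd) -(absp u Su).
pose D x := exists g : 'rV[K]_2, g 0 0 != 0 /\ x = phi g.
have DX x : D x -> X x by move=> [g [g0 ->]]; apply: phiX.
have dD : dense_in X D.
  apply: dense_sub (tp_dense affX tp) => _ [t [ht ->]].
  pose g := vec2 (torus_char f0 t) (torus_char (- d) t).
  have g0 : g 0 0 != 0 by rewrite vec2E tchar_neq0.
  exists g; split=> //; apply: (chi_separate affX tp); [exact: (tp_in tp) | exact: phiX |].
  move=> u Su; rewrite phiE // (chi_param tp) //.
  pose h (w : 'rV[int]_2) := torus_char (w 0 0 *: f0 - w 0 1 *: d) t.
  have hh w : torus_char w (vec2 (h (vec2 1 0)) (h (vec2 0 1))) = h w.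
    apply: torus_char_hom => [w1 w2|w1]; last exact: tchar_neq0.
    by rewrite /h !mxE !scalerDl opprD addrACA tcharD.
  have -> : g = vec2 (h (vec2 1 0)) (h (vec2 0 1)).
    by rewrite /g /h !vec2E !scale1r !scale0r subr0 sub0r.
  by rewrite hh /h !vec2E -basis.
have [|||mu [jmu muX muE]] := @comultiplication_law K n X affX f tp Delta D.
- move=> u Su; apply: pfun_sum => j.
  have ja : (j <= `|pairing p u|)%N by rewrite -ltnS.
  apply: (pfun_ext (f := fun z : 'rV_(n + n) => 'C(`|pairing p u|, j)%:R *
    (chi f (u + d *+ (`|pairing p u| - j)) (lsubmx z) * chi f (u + d *+ j) (rsubmx z)))).
    by move=> z; rewrite mulr_natl.
  apply: pfunM; first exact: pfun_const.
  apply: pfunM; [apply: chi_joint_l | apply: chi_joint_r]; apply: down => //; exact: leq_subr.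
- exact: dD.
- move=> x y [g [g0 ->]] [h [h0 ->]]; have gh0 := gmul0 _ _ g0 h0.
  exists (phi (gmul g h)); first exact: phiX.
  by move=> u Su; rewrite DeltaE // phiE.
have mu_phi (g h : 'rV[K]_2) : g 0 0 != 0 -> h 0 0 != 0 -> mu (phi g) (phi h) = phi (gmul g h).
  move=> g0 h0; have gh0 := gmul0 _ _ g0 h0; have Xg := phiX g g0; have Xh := phiX h h0.
  apply: (chi_separate affX tp); [exact: muX | exact: phiX |].
  by move=> u Su; rewrite muE // DeltaE // phiE.
have one0 : (vec2 1 0 : 'rV[K]_2) 0 0 != 0 by rewrite vec2E oner_eq0.
set e := phi (vec2 1 0); have Xe : X e by apply: phiX.
have mon : comm_monoid X mu e.
  apply: (dense_monoid DX dD jmu muX); first by exists (vec2 1 0).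
  - move=> _ _ _ [r [r0 ->]] [s [s0 ->]] [t [t0 ->]]; rewrite !mu_phi ?gmul0 //.
    by congr phi; apply: row2P; rewrite !vec2E ?mulrA ?addrA.
  - move=> _ _ [s [s0 ->]] [t [t0 ->]]; rewrite !mu_phi //.
    by congr phi; apply: row2P; rewrite !vec2E; [rewrite mulrC | rewrite addrC].
  - move=> _ [t [t0 ->]]; rewrite mu_phi //.
    by congr phi; apply: row2P; rewrite !vec2E ?mul1r ?add0r.
have chi_f0 (g : 'rV[K]_2) : g 0 0 != 0 -> chi f f0 (phi g) = g 0 0.
  by move=> g0; rewrite phiE // torus_charE !vec2E qf0 pf0 expr1z expr0z mulr1.
have unit_f0 x : invertibles X mu e x -> chi f f0 x != 0.
  move=> [Xx [y [Xy exy _]]]; have := muE f0 x y Sf0 Xx Xy; rewrite exy chi_f0 // vec2E.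
  rewrite /Delta pf0 /= big_ord_recl big_ord0 bin0 addr0 mulr1n !mulr0n !addr0 => h.
  by apply: contra_eqN h => /eqP ->; rewrite mul0r oner_eq0.
pose psi x := vec2 (chi f f0 x) (chi f v x / chi f f0 x ^+ N).
have phi_unit (g : 'rV[K]_2) : g 0 0 != 0 -> invertibles X mu e (phi g).
  move=> g0; split; first exact: phiX.
  have g0' : (vec2 (g 0 0)^-1 (- g 0 1) : 'rV[K]_2) 0 0 != 0 by rewrite vec2E invr_eq0.
  exists (phi (vec2 (g 0 0)^-1 (- g 0 1))); rewrite !mu_phi //; split; first exact: phiX.
    by congr phi; apply: row2P; rewrite !vec2E ?divff ?subrr.
  by congr phi; apply: row2P; rewrite !vec2E ?mulVf ?addNr.
have psi_phi (g : 'rV[K]_2) : g 0 0 != 0 -> psi (phi g) = g.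
  move=> g0; apply: row2P; rewrite vec2E chi_f0 // phiE // torus_charE !vec2E qv pv expr1z -exprnP.
  by rewrite mulrAC divff ?mul1r // expf_neq0.
have phi_psi x : invertibles X mu e x -> phi (psi x) = x.
  move=> ux; have nz := unit_f0 x ux; have Xx := ux.1.
  have p0 : psi x 0 0 != 0 by rewrite vec2E.
  apply: (chi_separate affX tp) => //; first exact: phiX.
  move=> u Su; rewrite phiE // torus_charE !vec2E.
  (* Both sides of the relation u + (jN + k2) f0 = j v + k1 f0 are sums of weights. *)
  set j := `|pairing p u|%N; have pj : pairing p u = j%:Z by rewrite /j absp.
  have [k1 [k2 ek]] : exists k1 k2 : nat, pairing q u = k1%:Z - k2%:Z.
    case: (pairing q u) => k; first by exists k, 0%N; rewrite subr0.
    by exists 0%N, k.+1; rewrite sub0r NegzE.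
  have rel : u + (f0 *+ (N * j) + f0 *+ k2) = v *+ j + f0 *+ k1.
    apply: (pairing_basis_inj basis); rewrite !pairingDr !pairingMnr ?qf0 ?qv ?pf0 ?pv ?mul0rn ?addr0 //.
      by rewrite ek -[N%:Z *+ j]mulr_natr !natz PoszM; ring.
    by rewrite pj natz.
  have := congr1 (fun w => chi f w x) rel.
  have SMn w k : S w -> S (w *+ k) by apply: weight_monoidMn.
  rewrite /= !(chiD affX tp) ?(chiMn affX tp) //; try (by do ?[apply: weight_monoidD]; apply: SMn).
  move=> h; rewrite ek pj exprzDr ?unitfE // -exprnN -!exprnP exprMn exprVn -exprM.
  apply: (mulIf (x := chi f f0 x ^+ (N * j) * chi f f0 x ^+ k2)); first by rewrite mulf_neq0 // expf_neq0.
  rewrite h; have n1 : chi f f0 x ^+ (N * j) != 0 by rewrite expf_neq0.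
  have n2 : chi f f0 x ^+ k2 != 0 by rewrite expf_neq0.
  by field; rewrite n1 n2.
exists mu, e; split=> //; split=> //; exists 1%N, phi, psi; split; last first.
  by move=> g h /GmGa11 g0 /GmGa11 h0; rewrite GmGa11_mul mu_phi.
split.
- split=> [g /GmGa11 /phi_unit //|j].
  by apply: regular_sub (phireg j) => g /GmGa11.
- split=> [x /unit_f0 h|]; first by apply/GmGa11; rewrite vec2E.
  apply: ord2_ind.
    have reg : regular_on (invertibles X mu e) (chi f f0) by exact/regular_pfun/chi_pfun.
    by apply: regular_ext reg => x _; rewrite vec2E.
  have reg : regular_on (invertibles X mu e) (fun x => chi f v x / chi f f0 x ^+ N).
    apply: regularM; first exact/regular_pfun/chi_pfun.
    apply: regularV; first by move=> x ux; rewrite expf_neq0 // unit_f0.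
    exact/regularX/regular_pfun/chi_pfun.
  by apply: regular_ext reg => x _; rewrite vec2E.
- by move=> g /GmGa11; apply: psi_phi.
- exact: phi_psi.
Qed.
End Root.
End RootMonoid.

(** * Classification by rank *)

Section ByRank.
Variables (K : closedFieldType) (n : nat) (X : pset K n).
Hypotheses (charK : has_pchar0 K) (affX : affine_variety X) (norX : normal_variety X).
Hypothesis dimX : has_dim X 2.

Lemma isomorphism_sym m k (U : pset K m) (V : pset K k) phi psi :
  isomorphism U V phi psi -> isomorphism V U psi phi.
Proof. by case=> *; split. Qed.

Lemma isomorphism_comp m k l (U : pset K m) (V : pset K k) (W : pset K l) phi psi phi' psi' :
  isomorphism U V phi psi -> isomorphism V W phi' psi' ->
  isomorphism U W (fun x => phi' (phi x)) (fun z => psi (psi' z)).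
Proof.
move=> [[h1 r1] [h2 r2] c1 c2] [[h3 r3] [h4 r4] c3 c4]; split.
- split=> [x Ux|j]; first by apply: h3; apply: h1.
  exact: (regular_comp (r3 j) h1 r1).
- split=> [z Wz|j]; first by apply: h2; apply: h4.
  exact: (regular_comp (r2 j) h4 r4).
- by move=> x Ux; rewrite c3 ?c1 //; apply: h1.
- by move=> z Wz; rewrite c2 ?c4 //; apply: h4.
Qed.

Lemma rank2_data mu e : comm_monoid_of_rank X mu e 2 -> exists phi psi,
  [/\ comm_monoid X mu e, isomorphism (@GmGa K 2 0) (invertibles X mu e) phi psi
    & forall x y, GmGa x -> GmGa y -> phi (GmGa_mul x y) = mu (phi x) (phi y)].
Proof.
move=> [mon [s [phi [psi [iso hom]]]]].
have := rank_dim affX mon iso dimX.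
by case: s phi psi iso hom => [|s] phi psi iso hom // _; exists phi, psi.
Qed.

Lemma rank1_data mu e : comm_monoid_of_rank X mu e 1 -> exists phi psi,
  [/\ comm_monoid X mu e, isomorphism (@GmGa K 1 1) (invertibles X mu e) phi psi
    & forall x y, GmGa x -> GmGa y -> phi (GmGa_mul x y) = mu (phi x) (phi y)].
Proof.
move=> [mon [s [phi [psi [iso hom]]]]].
have := rank_dim affX mon iso dimX.
by case: s phi psi iso hom => [|[|s]] phi psi iso hom // _; exists phi, psi.
Qed.

Lemma rank0_data mu e : comm_monoid_of_rank X mu e 0 -> exists phi psi,
  [/\ comm_monoid X mu e, isomorphism (@GmGa K 0 2) (invertibles X mu e) phi psi
    & forall x y, GmGa x -> GmGa y -> phi (GmGa_mul x y) = mu (phi x) (phi y)].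
Proof.
move=> [mon [s [phi [psi [iso hom]]]]].
have := rank_dim affX mon iso dimX.
by case: s phi psi iso hom => [|[|[|s]]] phi psi iso hom // _; exists phi, psi.
Qed.

Lemma rank_toric mu e r : comm_monoid_of_rank X mu e r -> toric X.
Proof.
case: r => [|[|[|r]]] monr.
- have [phi [psi [mon iso hom]]] := rank0_data monr.
  have tp : toric_param X phi := rank0_param affX mon iso; exact: (param_toric affX tp).
- have [phi [psi [mon iso hom]]] := rank1_data monr.
  have tp : toric_param X phi := rank1_param charK affX mon iso hom; exact: (param_toric affX tp).
- have [phi [psi [mon iso hom]]] := rank2_data monr.
  have tp : toric_param X phi := rank2_param affX mon iso hom charK; exact: (param_toric affX tp).
- case: monr => mon [s [phi [psi [iso _]]]].
  by have := rank_dim affX mon iso dimX.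
Qed.

Variables (f : 'rV[K]_2 -> 'rV[K]_n) (tp : toric_param X f).
Notation S := (weight_monoid f).

(** The automorphism of X given by toric_unique multiplies characters on the dense
    torus of units. *)
Lemma rank2_iso mu0 e0 : comm_monoid X mu0 e0 ->
  (forall u x y, S u -> X x -> X y -> chi f u (mu0 x y) = chi f u x * chi f u y) ->
  forall mu e, comm_monoid_of_rank X mu e 2 -> monoid_iso X mu e X mu0 e0.
Proof.
move=> mon0 law mu e monr; have [phi [psi [mon iso hom]]] := rank2_data monr.
have tp' := rank2_param affX mon iso hom charK.
have [th [th' [thD thK th'K thS]]] := toric_unique charK affX norX tp tp'.
have [G [G' [isoG hG]]] := param_iso affX tp tp' thD thK th'K thS.
have GX x : X x -> X (G x) by apply: (iso_morph isoG).1.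
apply: (dense_monoid_iso affX _ (tp_dense affX tp') mon mon0 isoG).
  by move=> x [t [ht ->]]; apply: (tp_in tp').
move=> x y [s [hs ->]] [t [ht ->]].
have Xs := tp_in tp' hs; have Xt := tp_in tp' ht; have hst := torus_tmul hs ht.
have e1 : mu (phi s) (phi t) = phi (tmul s t).
  by rewrite -GmGa20_mul hom //; apply/GmGa20.
have Xst := tp_in tp' hst.
apply: (chi_separate affX tp); first by rewrite e1; apply: GX.
  by apply: (mu_closed mon0); apply: GX.
move=> u Su; rewrite e1 law; [|by []|exact: GX|exact: GX].
by rewrite !hG // !(chi_param tp') // tchar_tmul.
Qed.

(** In the coordinates of G_m x G_a the weights are closed under lowering the
    exponent of G_a, so that this exponent is a ray and (0, -1) is a root. *)
Lemma rank1_root mu e : comm_monoid_of_rank X mu e 1 -> exists p d, root_data S p d /\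
  forall mu0 e0, comm_monoid X mu0 e0 ->
    (forall u x y, S u -> X x -> X y -> let a := `|pairing p u|%N in
       chi f u (mu0 x y) =
         \sum_(j < a.+1) chi f (u + d *+ (a - j)) x * chi f (u + d *+ j) y *+ 'C(a, j)) ->
    monoid_iso X mu e X mu0 e0.
Proof.
move=> monr; have [phi [psi [mon iso hom]]] := rank1_data monr.
have tp' := rank1_param charK affX mon iso hom.
have [th [th' [thD thK th'K thS]]] := toric_unique charK affX norX tp tp'.
have [G [G' [isoG hG]]] := param_iso affX tp tp' thD thK th'K thS.
have th0 : th 0 = 0 by apply: (addrI (th 0)); rewrite -thD !addr0.
have thN u : th (- u) = - th u by apply: (addrI (th u)); rewrite -thD !subrr th0.
have thMn u k : th (u *+ k) = th u *+ k.
  by elim: k => [|k IH]; rewrite ?mulr0n ?th0 // !mulrS thD IH.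
have thZ (k : int) u : th (k *: u) = k *: th u.
  case: k => k; first by rewrite -natz !scaler_nat.
  by rewrite NegzE !scaleNr thN -natz !scaler_nat thMn.
(* p is the exponent of the additive coordinate, as a linear form on the lattice of f. *)
pose p := vec2 (th (vec2 1 0) 0 1) (th (vec2 0 1) 0 1).
pose d := th' (vec2 0 (-1)).
have pE u : pairing p u = th u 0 1.
  have {2}-> : u = u 0 0 *: vec2 1 0 + u 0 1 *: vec2 0 1.
    by apply: row2P; rewrite !mxE /= ?mulr1 ?mulr0 ?addr0 ?add0r.
  by rewrite thD !thZ pairingE !vec2E !mxE mulrC [X in _ + X = _]mulrC.
have pd : pairing p d = -1 by rewrite pE th'K vec2E.
have wpos v : weight_monoid phi v -> 0 <= v 0 1 by move=> /(rank1_weight charK affX mon iso hom) [].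
have drop v k : weight_monoid phi v -> k%:Z <= v 0 1 -> weight_monoid phi (v + vec2 0 (-1) *+ k).
  move=> wv; elim: k => [|k IH] hk; first by rewrite mulr0n addr0.
  rewrite mulrSr addrA; apply: (rank1_down charK affX mon iso hom).
    by apply: IH; move: hk; clear; lia.
  by rewrite mxE -scaler_nat !mxE /= natz; move: hk; clear; lia.
have floor v : weight_monoid phi v -> weight_monoid phi (vec2 (v 0 0) 0).
  move=> wv; have := wpos v wv; case E: (v 0 1) => [k|//] _.
  have := drop v k wv; rewrite E => /(_ (lexx _)).
  have -> // : v + vec2 0 (-1) *+ k = vec2 (v 0 0) 0.
  apply: row2P; rewrite -scaler_nat !mxE /= ?mulr0 ?addr0 // natz E; lia.
have rd : root_data S p d.
  split=> //.
  - have ed := pd; rewrite pairingE in ed; rewrite /primitive.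
    apply/coprimezP; exists (- d 0 0, - d 0 1); rewrite /=.
    by apply: oppr_inj; rewrite -ed; ring.
  - by move=> u /thS /wpos; rewrite pE.
  - have [v [w [wv ww e0]]] := weight_monoid_full charK tp' (vec2 1 0).
    have [z [wz nz]] : exists z, weight_monoid phi (vec2 z 0) /\ z != 0.
      case: (eqVneq (v 0 0) 0) => [v0|nv]; last by exists (v 0 0); split=> //; apply: floor.
      exists (w 0 0); split; first exact: floor.
      apply/eqP => w0; have := congr1 (fun u : 'rV[int]_2 => u 0 0) e0.
      by rewrite !mxE /= v0 w0.
    exists (th' (vec2 z 0)); split.
    + by apply/thS; rewrite th'K.
    + apply: contraNneq nz => h; have := congr1 th h; rewrite th'K th0.
      by move/(congr1 (fun u : 'rV[int]_2 => u 0 0)); rewrite !mxE /= => ->.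
    + by rewrite pE th'K vec2E.
  - move=> u Su; rewrite pE => pu; apply/thS; rewrite thD th'K.
    by apply: (rank1_down charK affX mon iso hom) pu; apply/thS.
exists p, d; split=> // mu0 e0 mon0 law.
have GX x : X x -> X (G x) by apply: (iso_morph isoG).1.
apply: (dense_monoid_iso affX _ (units_dense affX mon) mon mon0 isoG); first by move=> x [].
move=> x y hx hy.
have [g [g0 ->]] : exists g : 'rV[K]_2, g 0 0 != 0 /\ x = phi g.
  exists (psi x); split; last by rewrite (iso_inv_cancel iso).
  by apply/GmGa11; apply: (iso_inv_morph iso).1.
have [h [h0 ->]] : exists g : 'rV[K]_2, g 0 0 != 0 /\ y = phi g.
  exists (psi y); split; last by rewrite (iso_inv_cancel iso).
  by apply/GmGa11; apply: (iso_inv_morph iso).1.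
have Xg := phi_inX iso g0; have Xh := phi_inX iso h0.
have e1 : mu (phi g) (phi h) = phi (vec2 (g 0 0 * h 0 0) (g 0 1 + h 0 1)).
  by rewrite -GmGa11_mul hom //; apply/GmGa11.
have gh0 : (vec2 (g 0 0 * h 0 0) (g 0 1 + h 0 1) : 'rV[K]_2) 0 0 != 0 by rewrite vec2E mulf_neq0.
have Xgh := phi_inX iso gh0.
have chiE := rank1_chi charK affX mon iso hom.
apply: (chi_separate affX tp); first by rewrite e1; apply: GX.
  by apply: (mu_closed mon0); apply: GX.
move=> u Su; rewrite e1 law; [|by []|exact: GX|exact: GX].
have Su' := proj1 (thS u) Su; rewrite hG // chiE //.
have := rd_pos rd Su; case E: (pairing p u) => [a|//] _; rewrite absz_nat.
have thu : th u = vec2 (th u 0 0) a%:Z by apply: row2P; rewrite vec2E // -E pE.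
rewrite {1}thu root_binomial; apply: eq_bigr => j _; have ja : (j <= a)%N by rewrite -ltnS.
have thd k : th (u + d *+ k) = vec2 (th u 0 0) (a%:Z - k%:Z).
  rewrite thD thMn th'K -scaler_nat; apply: row2P; rewrite !mxE /=; first by rewrite mulr0 addr0.
  by rewrite -pE E mulrN1 natz.
have Sd k : (k <= a)%N -> S (u + d *+ k) by move=> ka; apply: (root_downs rd) => //; rewrite E lez_nat.
have S1 := Sd _ (leq_subr j a); have S2 := Sd _ ja.
by rewrite !hG // !chiE //; try (by apply/thS); rewrite !thd.
Qed.

Lemma GmGa02_mul (g h : 'rV[K]_2) : @GmGa_mul K 0 2 g h = g + h.
Proof.
apply/rowP => i; rewrite /GmGa_mul mxE; case: splitP => [[] //|k ik]; rewrite !mxE.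
by have -> : rshift 0 k = i by apply: val_inj; rewrite /= ik.
Qed.

Lemma vector_structure (F : 'rV[K]_n -> 'rV[K]_2) (Psi : 'rV[K]_2 -> 'rV[K]_n) :
  isomorphism X (@affine_space K 2) F Psi ->
  comm_monoid_of_rank X (fun x y => Psi (F x + F y)) (Psi 0) 0.
Proof.
move=> iso; have [[_ rF] [PX rP] FK PK] := iso.
have PX' z : X (Psi z) by apply: PX.
have PK' z : F (Psi z) = z by apply: PK.
have mon : comm_monoid X (fun x y => Psi (F x + F y)) (Psi 0).
  split=> //.
  - split=> [z _ //|j].
    apply: (regular_comp (g := fun z : 'rV_(n + n) => F (lsubmx z) + F (rsubmx z)) (rP j)) => // k.
    apply: (regular_ext (f := fun z : 'rV_(n + n) => F (lsubmx z) 0 k + F (rsubmx z) 0 k)).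
      by move=> z _; rewrite mxE.
    apply: regularD.
      apply: (regular_comp (g := fun z : 'rV_(n + n) => lsubmx z) (rF k)) => [z []|i] //.
      exact/regular_pfun/pfun_lsubmx.
    apply: (regular_comp (g := fun z : 'rV_(n + n) => rsubmx z) (rF k)) => [z []|i] //.
    exact/regular_pfun/pfun_rsubmx.
  - by move=> x y z _ _ _; rewrite !PK' addrA.
  - by move=> x y _ _; rewrite addrC.
  - by move=> x Xx; rewrite PK' add0r FK.
  - by move=> x Xx; rewrite PK' addr0 FK.
split=> //; exists 2%N, Psi, F.
have unit x : X x -> invertibles X (fun x y => Psi (F x + F y)) (Psi 0) x.
  by move=> Xx; split=> //; exists (Psi (- F x)); rewrite !PK' subrr addNr; split.
split; last first.
  by move=> g h _ _; rewrite !PK'; congr Psi; apply: GmGa02_mul.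
split.
- split=> [g _|j]; first exact: unit.
  exact: (regular_sub (U := @affine_space K 2)) (rP j).
- split=> [x _|j]; first exact: GmGa02.
  by apply: regular_sub (rF j) => x [].
- by move=> g _; apply: PK'.
- by move=> x [Xx _]; apply: FK.
Qed.

Lemma rank0_vector_iso mu e : comm_monoid_of_rank X mu e 0 ->
  monoid_iso X mu e (@affine_space K 2) +%R 0.
Proof.
move=> monr; have [phi [psi [mon iso hom]]] := rank0_data monr.
have isoX := rank0_iso affX mon iso; have [_ _ phiK psiK] := isoX.
have unit x : X x -> phi (psi x) = x by apply: psiK.
have add (g h : 'rV[K]_2) : phi (g + h) = mu (phi g) (phi h).
  by rewrite -GmGa02_mul hom //; apply: GmGa02.
have psiD x y : X x -> X y -> psi (mu x y) = psi x + psi y.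
  by move=> Xx Xy; rewrite -{1}(unit x Xx) -{1}(unit y Xy) -add phiK.
exists psi, phi; split=> //; first exact: isomorphism_sym.
have Xe := mon_unit mon; apply: (addrI (psi e)).
by rewrite -psiD // (mon_unitl mon) // addr0.
Qed.

Lemma monoid_iso_via (F : 'rV[K]_n -> 'rV[K]_2) (Psi : 'rV[K]_2 -> 'rV[K]_n) mu e :
  isomorphism X (@affine_space K 2) F Psi -> monoid_iso X mu e (@affine_space K 2) +%R 0 ->
  monoid_iso X mu e X (fun x y => Psi (F x + F y)) (Psi 0).
Proof.
move=> iso [phi [psi [iso' hom unit]]].
have PK z : F (Psi z) = z by apply: (iso_inv_cancel iso).
exists (fun x => Psi (phi x)), (fun y => psi (F y)); split.
- exact: isomorphism_comp iso' (isomorphism_sym iso).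
- by move=> x y Xx Xy; rewrite !PK hom.
- by rewrite unit.
Qed.

(** In the coordinates of G_a^2 = X the weights are the vectors with nonnegative
    coordinates. *)
Lemma rank0_basis mu e : comm_monoid_of_rank X mu e 0 -> exists u1 u2,
  [/\ col_mx u1 u2 \in unitmx, S u1, S u2,
      forall u, S u <-> exists a b : nat, u = u1 *+ a + u2 *+ b
    & exists Psi, isomorphism X (@affine_space K 2)
        (fun x => row_mx (chi f u1 x)%:M (chi f u2 x)%:M) Psi].
Proof.
move=> monr; have [phi [psi [mon iso hom]]] := rank0_data monr.
have tp' := rank0_param affX mon iso; have isoX := rank0_iso affX mon iso.
have [th [th' [thD thK th'K thS]]] := toric_unique charK affX norX tp tp'.
have [G [G' [isoG hG]]] := param_iso affX tp tp' thD thK th'K thS.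
have th'D : {morph th' : u v / u + v} by move=> u v; apply: (can_inj thK); rewrite thD !th'K.
have th'0 : th' 0 = 0 by apply: (addrI (th' 0)); rewrite -th'D !addr0.
have th'N u : th' (- u) = - th' u by apply: (addrI (th' u)); rewrite -th'D !subrr th'0.
have th'Mn u k : th' (u *+ k) = th' u *+ k.
  by elim: k => [|k IH]; rewrite ?mulr0n ?th'0 // !mulrS th'D IH.
have th'Z (k : int) u : th' (k *: u) = k *: th' u.
  case: k => k; first by rewrite -natz !scaler_nat.
  by rewrite NegzE !scaleNr th'N -natz !scaler_nat th'Mn.
pose u1 := th' (vec2 1 0); pose u2 := th' (vec2 0 1).
have th'E v : th' v = v 0 0 *: u1 + v 0 1 *: u2.
  rewrite -!th'Z -th'D; congr th'.
  by apply: row2P; rewrite !mxE /= ?mulr1 ?mulr0 ?addr0 ?add0r.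
have wE u : weight_monoid phi u <-> nonneg_vec u := rank0_weight affX mon iso u.
have S1 : S u1 by apply/thS/wE; rewrite th'K; split; rewrite vec2E.
have S2 : S u2 by apply/thS/wE; rewrite th'K; split; rewrite vec2E.
exists u1, u2; split=> //.
- pose A : 'M[int]_2 := col_mx u1 u2; pose B : 'M[int]_2 := col_mx (th (vec2 1 0)) (th (vec2 0 1)).
  have rows (w1 w2 : 'rV[int]_2) j : (col_mx w1 w2 : 'M[int]_2) 0 j = w1 0 j /\ (col_mx w1 w2 : 'M[int]_2) 1 j = w2 0 j.
    by split; rewrite mxE; case: splitP => k //; rewrite ord1.
  have mulA v : v *m A = th' v.
    apply/rowP => j; rewrite th'E !mxE sum_ord2.
    by rewrite (rows u1 u2 j).1 (rows u1 u2 j).2.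
  have : B *m A = 1%:M.
    apply/row_matrixP => i; rewrite row_mul mulA.
    have rB : row 0 B = th (vec2 1 0) /\ row 1 B = th (vec2 0 1).
      by split; apply/rowP => j; rewrite mxE; [apply: (rows _ _ j).1 | apply: (rows _ _ j).2].
    move: i; apply: ord2_ind; [rewrite rB.1 | rewrite rB.2]; rewrite thK; apply: row2P; by rewrite !mxE.
  by case/mulmx1_unit.
- move=> u; rewrite thS wE; split=> [[h1 h2]|[a [b ->]]].
    case E1: (th u 0 0) h1 => [a|//] _; case E2: (th u 0 1) h2 => [b|//] _.
    by exists a, b; rewrite -[u]thK th'E E1 E2 -!natz !scaler_nat.
  rewrite -!th'Mn -th'D th'K; split; rewrite mxE -!scaler_nat !mxE /=.
    by rewrite mulr1 mulr0 addr0 natz.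
  by rewrite mulr1 mulr0 add0r natz.
- exists (fun z => G (phi z)).
  have chiE v (g : 'rV[K]_2) : nonneg_vec v -> chi phi v (phi g) = torus_char v g.
    move=> nv; have [P hP] := rank0_monomial affX mon iso nv; have wv : weight_monoid phi v by apply/wE.
    rewrite -hP; have Xg : X (phi g) by apply: (iso_morph isoX).1.
    move: (phi g) Xg; apply: (tp_eq affX tp'); [exact: chi_cr | exact/coordinate_ring_pfun/pfun_ev |].
    by move=> t ht; rewrite (chi_param tp') // hP.
  have coordsE g : row_mx (chi f u1 (G (phi g)))%:M (chi f u2 (G (phi g)))%:M = g :> 'rV[K]_2.
    have Xg : X (phi g) by apply: (iso_morph isoX).1.
    rewrite !hG // !th'K !chiE ?torus_charE ?vec2E; try by split; rewrite vec2E.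
    apply: row2P; rewrite mxE; case: splitP => k; rewrite ord1 // mxE => _ /=.
      by rewrite expr1z expr0z mulr1.
    by rewrite expr1z expr0z mul1r.
  have isoC := isomorphism_comp isoX isoG.
  have [GX [_ rinv] cK invK] := isoC.
  split.
  + split=> // j; apply: regular_cr; have := @ord2_ind (fun j => coordinate_ring X (fun x => (row_mx (chi f u1 x)%:M (chi f u2 x)%:M : 'rV[K]_2) 0 j)).
    apply.
      apply: (coordinate_ring_ext (f := chi f u1)); last exact: chi_cr.
      by move=> x _; rewrite mxE; case: splitP => k; rewrite ord1 // mxE.
    apply: (coordinate_ring_ext (f := chi f u2)); last exact: chi_cr.
    by move=> x _; rewrite mxE; case: splitP => k; rewrite ord1 // mxE.
  + exact: GX.
  + by move=> x Xx; rewrite -{1 2}(invK x Xx) coordsE invK.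
  + by move=> y _; apply: coordsE.
Qed.
End ByRank.

Theorem theorem3 (K : closedFieldType) (charK : has_pchar0 K)
    (n : nat) (X : pset K n) (r : nat)
    (mu : 'rV[K]_n -> 'rV[K]_n -> 'rV[K]_n) (e : 'rV[K]_n)
    (surfX : normal_affine_surface X)
    (monX : comm_monoid_of_rank X mu e r) :
  toric X /\
  forall (act : 'rV[K]_2 -> 'rV[K]_n -> 'rV[K]_n) (x0 : 'rV[K]_n),
    toric_structure X act x0 ->
    exists (omega : cone) (chi : 'rV[int]_2 -> 'rV[K]_n -> K),
      [/\ character_grading X act x0 omega chi,
          r = 2%N -> classification_rank2 X act x0 omega chi,
          r = 1%N -> classification_rank1 X omega chi
        & r = 0%N -> classification_rank0 X omega chi].
Proof.
have [affX norX dimX] := surfX; split; first exact: (rank_toric charK affX dimX monX).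
move=> act x0 ts; pose f t := act t x0.
have tp : toric_param X f := toric_structure_param affX ts.
have [ps [SE poly rays]] := cone_inequalities (weight_monoid_full charK tp)
  (weight_cone_type charK norX tp).
have oE u : inequalities ps (to_rat u) <-> weight_monoid f u := inequalitiesE SE u.
have full := weight_monoid_full charK tp.
have f1 : f (torus_one K 2) = x0 by apply: (act_one ts); apply: (act_base ts).
exists (inequalities ps), (chi f); split.
- split=> //.
  + by move=> u t; apply: (chi_param tp).
  + by move=> u /oE; apply: chi_cr.
  + move=> g cg; have [s [c [_ Ss h]]] := chi_span affX tp cg.
    by exists s, c; split=> // u /Ss Su; apply/oE.
  + by move=> s c us _; apply: (chi_independent tp us).
- move=> _; have [mu0 [monr inv mulf law]] := toric_monoid_structure charK affX tp.
  rewrite f1 in monr inv; exists mu0, x0; split=> //.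
  + by split=> //; case: monr.
  + by move=> u /oE Su x y Xx Xy; apply: law.
  + by apply: (rank2_iso charK affX norX dimX tp monr.1) => u x y Su Xx Xy; apply: law.
- move=> _; split=> [mu' e' monr|p d /(demazure_rootE SE rays) rd].
    have [p [d [rd isoI]]] := rank1_root charK affX norX dimX tp monr.
    have [mu0 [e0 [monr0 law]]] := root_monoid_structure charK affX norX tp rd.
    exists p, d, mu0, e0; split=> //; first exact: (demazure_rootI SE full).
      by move=> u /oE Su x y Xx Xy; apply: law.
    exact: isoI monr0.1 law.
  have [mu0 [e0 [monr0 law]]] := root_monoid_structure charK affX norX tp rd.
  by exists mu0, e0; split=> // u /oE Su x y Xx Xy; apply: law.
- move=> r0; rewrite r0 in monX.
  have [u1 [u2 [unit S1 S2 gen [Psi iso]]]] := rank0_basis charK affX norX dimX tp monX.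
  exists u1, u2; split=> //; first by move=> u; rewrite oE.
    by exists Psi.
  set F := fun x => _ in iso; have [_ _ _ PK] := iso.
  exists (fun x y => Psi (F x + F y)), (Psi 0); split.
  + exact: vector_structure iso.
  + have coord u x y j : X x -> X y -> (forall z, X z -> chi f u z = F z 0 j) ->
        chi f u (Psi (F x + F y)) = chi f u x + chi f u y.
      move=> Xx Xy h; rewrite !h //; last by apply: (iso_inv_morph iso).1.
      by rewrite PK // mxE.
    have F1 z : chi f u1 z = F z 0 0 by rewrite mxE; case: splitP => k; rewrite ord1 // mxE.
    have F2 z : chi f u2 z = F z 0 1 by rewrite mxE; case: splitP => k; rewrite ord1 // mxE.
    move=> u; rewrite !inE => /orP[]/eqP -> x y Xx Xy; rewrite /comult /tens mulr1 mul1r.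
      exact: (coord u1 x y 0).
    exact: (coord u2 x y 1).
  + by apply: (rank0_vector_iso affX dimX); apply: vector_structure.
  + move=> mu' e' monr; apply: (monoid_iso_via iso).
    exact: (rank0_vector_iso affX dimX monr).
Qed.
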